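(* Let $K=[0,\infty)\times\mathbb R$. Let $(u_0,v_0)\in L^{1,1}(\mathbb R;M)$ satisfy $v_0(x)\in T_{u_0(x)}M$ for almost every $x\in\mathbb R$, and let $f\in L^1(K;\mathbb R^n)$. For every $M$-valued global mild solution $u$ (on $K$) of the forced wave map equation with initial data $(u_0,v_0)$ and forcing $f$, there exists $(\bar u_0,\bar v_0)\in L^{1,1}(\mathbb R;\mathbb R^n)$ such that, if $u_{\mathrm L}$ denotes the unique solution of the homogeneous linear wave equation $\partial_t^2u_{\mathrm L}-\partial_x^2u_{\mathrm L}=0$ with initial data $u_{\mathrm L}(0,\cdot)=\bar u_0$, $\partial_tu_{\mathrm L}(0,\cdot)=\bar v_0$, then $$\lim_{t\to\infty}\big(\|u(t)-u_{\mathrm L}(t)\|_{L^\infty(\mathbb R)}+\|\partial_tu(t)-\partial_tu_{\mathrm L}(t)\|_{L^1(\mathbb R)}+\|\partial_xu(t)-\partial_xu_{\mathrm L}(t)\|_{L^1(\mathbb R)}\big)=0.$$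
   Context: $u_{\mathrm L}(t,x)=\tfrac12(\bar u_0(x+t)+\bar u_0(x-t))+\tfrac12\int_{x-t}^{x+t}\bar v_0(y)\,dy$. $M\subset\mathbb R^n$ is a compact Riemannian manifold, isometrically embedded in $\mathbb R^n$; $\pi_p:\mathbb R^n\to T_pM$ is the orthogonal projection. Forced wave map equation: $\partial_t^2u-\partial_x^2u=\sum_{j,k=1}^n\Gamma_{jk}(u)(\partial_tu_j\partial_tu_k-\partial_xu_j\partial_xu_k)+P(u)f$, which is the explicit form of the condition $\partial_t^2u-\partial_x^2u-f\perp T_uM$ for $M$-valued $u$. Here $\Gamma_{jk}:M\to\mathbb R^n$ and $P:M\to\mathcal L(\mathbb R^n)$ are Lipschitz, $P(p)=\pi_p$, and $\sum_{j,k}\Gamma_{jk}(p)a_jb_k=A_p(a,b)$ for $a,b\in T_pM$, where $A_p$ is the second fundamental form of $M\subset\mathbb R^n$ ($A_p(a,a)$ is the normal component of $\gamma''(0)$ for any curve $\gamma$ in $M$ with $\gamma(0)=p$, $\gamma'(0)=a$). $\Gamma_{jk}$ and $P$ are extended to bounded, globally Lipschitz functions on $\mathbb R^n$. For an interval $I$: $\dot W^{1,1}(I;\mathbb R^n)$ is the set of locally absolutely continuous $v:I\to\mathbb R^n$ with $Dv=v'\in L^1(I)$; $L^{1,1}(I;\mathbb R^n)=(L^\infty(I;\mathbb R^n)\cap\dot W^{1,1}(I;\mathbb R^n))\times L^1(I;\mathbb R^n)$ and $L^{1,1}(I;M)=(C(I;M)\cap\dot W^{1,1}(I;\mathbb R^n))\times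 L^1(I;\mathbb R^n)$, with norm $\|(g,h)\|_{L^{1,1}(I)}=\|g\|_{L^\infty(I)}+\|g'\|_{L^1(I)}+\|h\|_{L^1(I)}$. An $M$-valued mild solution on $K=[0,\infty)\times\mathbb R$ with initial data $(u_0,v_0)$ (satisfying the compatibility condition) and forcing $f$ is a continuous $u:K\to M$ such that: the weak derivatives $\partial_tu,\partial_xu$ exist as locally integrable functions; for every $t\ge0$, $\partial_tu(t,x)\in T_{u(t,x)}M$ for a.e. $x\in\mathbb R$ (derivatives at fixed $t$ being taken from the representatives continuous in time with values in $L^1$ in space); and for every $(t,x)\in K$ (the double integral being of an integrable function) $$u(t,x)=\tfrac12\big(u_0(x+t)+u_0(x-t)\big)+\tfrac12\int_{x-t}^{x+t}v_0(y)\,dy+\tfrac12\int_0^t\int_{x-t+\tau}^{x+t-\tau}\Big[\sum_{j,k}\Gamma_{jk}(u)(\partial_tu_j\partial_tu_k-\partial_xu_j\partial_xu_k)+P(u)f\Big](\tau,y)\,dy\,d\tau.$$ *)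

(* Defs.v *)
From HB Require Import structures.
From mathcomp Require Import all_boot all_order all_algebra.
From mathcomp Require Import all_classical all_reals all_analysis.

Set Implicit Arguments.
Unset Strict Implicit.
Unset Printing Implicit Defensive.

Import Order.TTheory GRing.Theory Num.Theory.
Import numFieldNormedType.Exports.

Local Open Scope classical_set_scope.
Local Open Scope ring_scope.

Section euclidean.
Context {R : realType} {n : nat}.
Implicit Types a b : 'rV[R]_n.

Definition dot a b : R := \sum_(i < n) a 0 i * b 0 i.

(* The norm that the library puts on ['rV[R]_n] is the sup norm. *)
Definition enorm a : R := Num.sqrt (dot a a).

End euclidean.

(* [f] is of class C^k on the open set [U] (in finite dimension, by iterated
   directional derivatives). *)
Fixpoint classC {R : realType} {V W : normedModType R}
    (k : nat) (U : set V) (f : V -> W) : Prop :=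
  match k with
  | 0 => forall x, U x -> {for x, continuous f}
  | k'.+1 => (forall x, U x -> differentiable f x) /\
             (forall v : V, classC k' U (fun x => 'D_v f x))
  end.

Definition smooth {R : realType} {V W : normedModType R}
  (U : set V) (f : V -> W) : Prop := forall k, classC k U f.

Section submanifold.
Context {R : realType} {n : nat}.
Implicit Types (M : set 'rV[R]_n) (p a b : 'rV[R]_n).

(* Slice charts: around each of its points, [M] is straightened to
   R^d x {0} by a diffeomorphism [Phi : U -> V] with inverse [Psi]. *)
Definition embedded_submanifold (d : nat) M : Prop :=
  (d <= n)%N /\
  forall p, M p -> exists (U V : set 'rV[R]_n) (Phi Psi : 'rV[R]_n -> 'rV[R]_n),
    [/\ open U, U p & open V] /\
    [/\ smooth U Phi, smooth V Psi,
        forall x, U x -> V (Phi x) /\ Psi (Phi x) = x &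
        forall y, V y -> U (Psi y) /\ Phi (Psi y) = y] /\
    (forall x, U x -> (M x <-> forall i : 'I_n, (d <= i)%N -> Phi x 0 i = 0)).

Definition curve_in M (gamma : R -> 'rV[R]_n) : Prop :=
  exists2 e : R, 0 < e &
    smooth (ball (0 : R) e) gamma /\ forall t, ball (0 : R) e t -> M (gamma t).

Definition tangent M p a : Prop :=
  exists gamma : R -> 'rV[R]_n,
    [/\ curve_in M gamma, gamma 0 = p & derive1 gamma 0 = a].

Definition normal M p a : Prop := forall b, tangent M p b -> dot a b = 0.

(* [v *m Q] is the orthogonal projection of [v] onto the tangent space. *)
Definition orthogonal_projection M p (Q : 'M[R]_n) : Prop :=
  forall v : 'rV[R]_n, tangent M p (v *m Q) /\ normal M p (v - v *m Q).

(* [A p] is the symmetric bilinear form on the tangent space at [p] whose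
   diagonal is given by normal components of accelerations; only its values
   on tangent vectors matter. *)
Definition second_fundamental_form M
    (A : 'rV[R]_n -> 'rV[R]_n -> 'rV[R]_n -> 'rV[R]_n) : Prop :=
  forall p, M p ->
  [/\ forall a b, tangent M p a -> tangent M p b -> A p a b = A p b a,
      forall (c : R) a a' b,
        tangent M p a -> tangent M p a' -> tangent M p b ->
        A p (c *: a + a') b = c *: A p a b + A p a' b &
      forall gamma, curve_in M gamma -> gamma 0 = p ->
        normal M p (A p (derive1 gamma 0) (derive1 gamma 0)) /\
        tangent M p (derive1n 2 gamma 0 - A p (derive1 gamma 0) (derive1 gamma 0))].

End submanifold.

Definition bounded_lipschitz {R : realType} {V W : normedModType R}
  (g : V -> W) : Prop := lipschitz g /\ [bounded g x | x in setT].

Section function_spaces.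
Context {R : realType} {n : nat}.

Definition leb : {measure set (measurableTypeR R) -> \bar R} :=
  @lebesgue_measure R.

Definition leb2 : {measure set (measurableTypeR R * measurableTypeR R) -> \bar R} :=
  (@lebesgue_measure R \x @lebesgue_measure R)%E.

Definition vintegrable {dsp} {T : measurableType dsp}
    (m : {measure set T -> \bar R}) (D : set T) (g : T -> 'rV[R]_n) : Prop :=
  forall i : 'I_n, m.-integrable D (fun x => (g x 0 i)%:E).

Definition vintegral {dsp} {T : measurableType dsp}
    (m : {measure set T -> \bar R}) (D : set T) (g : T -> 'rV[R]_n) : 'rV[R]_n :=
  \row_i \int[m]_(x in D) g x 0 i.

(* The L^p norm on the real line, with Euclidean norm on the values. *)
Definition normLp (p : \bar R) (g : R -> 'rV[R]_n) : \bar R :=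
  Lnorm leb p (fun x => (enorm (g x))%:E).

(* The epsilon-delta definition, on every compact interval [a, b]. *)
Definition locally_absolutely_continuous (g : R -> 'rV[R]_n) : Prop :=
  forall a b : R, a <= b -> forall e : R, 0 < e ->
  exists2 dl : R, 0 < dl &
    forall (m : nat) (l r : 'I_m -> R),
      (forall k, a <= l k /\ l k <= r k /\ r k <= b) ->
      trivIset setT (fun k => `]l k, r k[%classic) ->
      \sum_(k < m) (r k - l k) < dl ->
      \sum_(k < m) enorm (g (r k) - g (l k)) < e.

(* The a.e. derivative is given by an L^1 representative [Dg]. *)
Definition W11dot (g : R -> 'rV[R]_n) : Prop :=
  locally_absolutely_continuous g /\
  exists2 Dg : R -> 'rV[R]_n, vintegrable leb setT Dg &
    {ae leb, forall x, is_derive x (1 : R) g (Dg x)}.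

Definition L11 (g h : R -> 'rV[R]_n) : Prop :=
  [/\ (normLp +oo%E g < +oo)%E, W11dot g & vintegrable leb setT h].

Definition L11_in (M : set 'rV[R]_n) (g h : R -> 'rV[R]_n) : Prop :=
  [/\ continuous g, forall x, M (g x), W11dot g & vintegrable leb setT h].

End function_spaces.

(* Functions of time and space are functions of z = (t, x). *)
Section wave.
Context {R : realType} {n : nat}.
Implicit Types (u w ut ux f F : R * R -> 'rV[R]_n).

Definition halfplane : set (R * R) := [set z | 0 <= z.1].

Definition test_function (phi : R * R -> R) : Prop :=
  smooth setT phi /\
  exists2 C : set (R * R), compact C /\ (forall z, C z -> 0 < z.1) &
    forall z, ~ C z -> phi z = 0.

Definition weak_derivative (v : R * R) u w : Prop :=
  forall phi, test_function phi -> forall i : 'I_n,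
    \int[leb2]_(z in halfplane) (u z 0 i * 'D_v phi z) =
    - \int[leb2]_(z in halfplane) (w z 0 i * phi z).

Definition locally_integrable_halfplane w : Prop :=
  forall C : set (R * R), compact C -> C `<=` halfplane ->
    vintegrable leb2 C w.

Definition continuous_in_L1 w : Prop :=
  (forall t : R, 0 <= t -> vintegrable leb setT (fun x => w (t, x))) /\
  (forall t : R, 0 <= t ->
    normLp 1%E (fun x => w (s, x) - w (t, x))
      @[s --> within [set s : R | 0 <= s] (nbhs t)] --> 0%E).

(* [ut] and [ux] are the weak derivatives of [u], in the representatives that
   are continuous in time with values in L^1 in space: this determines
   [ut (t, _)] and [ux (t, _)] a.e. for every [t >= 0]. *)
Definition derivatives u ut ux : Prop :=
  [/\ weak_derivative (1, 0) u ut, weak_derivative (0, 1) u ux,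
      locally_integrable_halfplane ut /\ locally_integrable_halfplane ux &
      continuous_in_L1 ut /\ continuous_in_L1 ux].

(* d'Alembert's formula *)
Definition linear_wave (g h : R -> 'rV[R]_n) : R * R -> 'rV[R]_n :=
  fun z => let: (t, x) := z in
  2^-1 *: (g (x + t) + g (x - t)) +
  2^-1 *: vintegral leb `[x - t, x + t] h.

Definition wave_map_rhs (Gam : 'I_n -> 'I_n -> 'rV[R]_n -> 'rV[R]_n)
    (P : 'rV[R]_n -> 'M[R]_n) f u ut ux : R * R -> 'rV[R]_n :=
  fun z =>
  \sum_(j < n) \sum_(k < n)
    (ut z 0 j * ut z 0 k - ux z 0 j * ux z 0 k) *: Gam j k (u z) +
  f z *m P (u z).

Definition backward_triangle (t x : R) : set (R * R) :=
  [set w | 0 <= w.1 <= t /\ x - t + w.1 <= w.2 <= x + t - w.1].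

Definition mild_solution (M : set 'rV[R]_n)
    (Gam : 'I_n -> 'I_n -> 'rV[R]_n -> 'rV[R]_n) (P : 'rV[R]_n -> 'M[R]_n)
    (u0 v0 : R -> 'rV[R]_n) f u ut ux : Prop :=
  [/\ {within halfplane, continuous u} /\ (forall z, halfplane z -> M (u z)),
      derivatives u ut ux,
      forall t : R, 0 <= t ->
        {ae leb, forall x, tangent M (u (t, x)) (ut (t, x))} &
      forall t x : R, 0 <= t ->
        let F := wave_map_rhs Gam P f u ut ux in
        vintegrable leb2 (backward_triangle t x) F /\
        u (t, x) = linear_wave u0 v0 (t, x) +
          2^-1 *: vintegral leb `[0, t] (fun tau =>
            vintegral leb `[x - t + tau, x + t - tau] (fun y => F (tau, y)))].

End wave.

(* Main.v *)
Require Import Defs.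
From HB Require Import structures.
From mathcomp Require Import all_boot all_order all_algebra.
From mathcomp Require Import all_classical all_reals all_analysis.
From mathcomp Require Import measurable_realfun measurable_fun_approximation ring lra.

Set Implicit Arguments.
Unset Strict Implicit.
Unset Printing Implicit Defensive.

Import Order.TTheory GRing.Theory Num.Theory.
Import numFieldNormedType.Exports.

Local Open Scope classical_set_scope.
Local Open Scope ring_scope.


Section tools.
Context {R : realType}.
Notation leb := (@leb R).
Notation leb2 := (@leb2 R).
Notation Int1 f := (leb.-integrable setT (fun x => (f x)%:E)).
Notation Int2 f := (leb2.-integrable setT (fun x => (f x)%:E)).

Lemma measurable_affine (c d : R) :
  measurable_fun setT (fun x : measurableTypeR R => c * x + d : measurableTypeR R).
Proof. by apply: measurable_funD => //; exact: measurable_funM. Qed.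

Lemma leb_affine (c d : R) (A : set (measurableTypeR R)) :
  c != 0 -> measurable A ->
  leb ((fun x : measurableTypeR R => c * x + d : measurableTypeR R) @^-1` A) = (`|c|^-1%:E * leb A)%E.
Proof.
move=> c0 mA.
have c0' : 0 < `|c| by rewrite normr_gt0.
pose phi := (fun x : measurableTypeR R => c * x + d : measurableTypeR R).
have mphi : measurable_fun setT phi := measurable_affine c d.
pose nc : {nonneg R} := NngNum (normr_ge0 c).
have E B : measurable B -> lebesgue_measure B = mscale nc (pushforward leb phi) B.
  apply: lebesgue_measure_unique => // _ [[a b]] _ <- /=.
  rewrite /mscale /= /pushforward /=.
  have -> : phi @^-1` `]a, b] = if 0 < c then `](a - d) / c, (b - d) / c]%classic
      else `[(b - d) / c, (a - d) / c[%classic.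
    apply/seteqP; split => x /=; case: ltP => hc /=; rewrite ?in_itv/= /phi.
    - by rewrite ltr_pdivrMr// ler_pdivlMr// ltrBlDr lerBrDr mulrC.
    - have hc' : c < 0 by rewrite lt_neqAle c0.
      by rewrite ler_ndivrMr// ltr_ndivlMr// ltrBlDr lerBrDr mulrC andbC.
    - by rewrite ltr_pdivrMr// ler_pdivlMr// ltrBlDr lerBrDr mulrC.
    - have hc' : c < 0 by rewrite lt_neqAle c0.
      by rewrite ler_ndivrMr// ltr_ndivlMr// ltrBlDr lerBrDr mulrC andbC.
  rewrite [X in (_ * X)%E](_ : _ = if 0 < c
    then (lebesgue_measure `](a - d) / c, (b - d) / c]%classic)
    else (lebesgue_measure `[(b - d) / c, (a - d) / c[%classic)); last by case: ifP.
  rewrite !lebesgue_measure_itv/= !lte_fin.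
  case: (ltP 0 c) => hc.
    rewrite ltr_pM2r ?invr_gt0// ltrD2r; case: ifP => ab; last by rewrite mule0.
    rewrite -!EFinD -EFinM gtr0_norm//; congr _%:E; field; exact: lt0r_neq0.
  have hc' : c < 0 by rewrite lt_neqAle c0.
  rewrite ltr_nM2r ?invr_lt0// ltrD2r; case: ifP => ab; last by rewrite mule0.
  by rewrite -!EFinD -EFinM ltr0_norm//; congr _%:E; field.
rewrite [X in (_ * X)%E](E mphi A mA) /mscale/= muleA -EFinM mulVf ?mul1e// gt_eqF//.
Qed.

Lemma ge0_integral_affine (c d : R) (f : measurableTypeR R -> \bar R) :
  c != 0 -> measurable_fun setT f -> (forall x, 0 <= f x)%E ->
  (\int[leb]_x f (c * x + d)%R = `|c|^-1%:E * \int[leb]_x f x)%E.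
Proof.
move=> c0 mf f0.
have c0' : 0 <= `|c|^-1 by rewrite invr_ge0.
have := @ge0_integral_pushforward _ _ _ _ R _ (measurable_affine c d) leb setT f
  measurableT mf (fun y _ => f0 y).
rewrite preimage_setT => <-.
rewrite -(ge0_integral_mscale leb measurableT (NngNum c0') mf (fun x _ => f0 x)).
apply: eq_measure_integral; first exact: measurable_affine.
  move=> mphi A mA _; exact: leb_affine.
Qed.

Definition aff2 (c d e : R) (z : R * R) : R * R := (z.1, c * z.2 + d * z.1 + e).

Lemma measurable_aff2 (c d e : R) : measurable_fun setT
  (aff2 c d e : measurableTypeR R * measurableTypeR R -> measurableTypeR R * measurableTypeR R).
Proof.
apply/measurable_fun_pair => //=; apply: measurable_funD => //.
by apply: measurable_funD; apply: measurable_funM.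
Qed.

Lemma ge0_integral_aff2 (c d e : R) (f : measurableTypeR R * measurableTypeR R -> \bar R) :
  c != 0 -> measurable_fun setT f -> (forall x, 0 <= f x)%E ->
  (\int[leb2]_z f (aff2 c d e z) = `|c|^-1%:E * \int[leb2]_z f z)%E.
Proof.
move=> c0 mf f0; rewrite /Defs.leb2.
rewrite fubini_tonelli1//; last exact: (measurableT_comp mf (measurable_aff2 c d e)).
rewrite fubini_tonelli1// /fubini_F /=.
rewrite -ge0_integralZl//; last 2 first.
- exact: (measurable_fun_fubini_tonelli_F f mf f0).
- by move=> x _; apply: integral_ge0 => y _.
apply: eq_integral => t _ /=.
under eq_integral do rewrite /aff2/= -addrA.
rewrite (ge0_integral_affine (d * t + e) (f := fun y => f (t, y)))//.
exact: (measurableT_comp mf (pair1_measurable t)).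
Qed.


Lemma Int2_measurable (f : R * R -> R) : Int2 f ->
  measurable_fun [set: measurableTypeR R * measurableTypeR R] f.
Proof. by move=> /measurable_int/measurable_EFinP. Qed.

Lemma Int1_measurable (f : R -> R) : Int1 f -> measurable_fun [set: measurableTypeR R] f.
Proof. by move=> /measurable_int/measurable_EFinP. Qed.

Lemma Int1_affine (c d : R) (f : R -> R) : c != 0 -> Int1 f -> Int1 (fun x => f (c * x + d)).
Proof.
move=> c0 fi; have mf := Int1_measurable fi.
have mfa := measurableT_comp mf (measurable_affine c d).
apply/integrableP; split; first exact/measurable_EFinP.
have /integrableP[_] := fi; rewrite /=.
rewrite (ge0_integral_affine (f := fun x => `|(f x)%:E|%E) d c0)//; last first.
  by apply: measurableT_comp => //; exact/measurable_EFinP.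
by move=> h; rewrite lte_mul_pinfty.
Qed.

Lemma integral_affine (c d : R) (f : R -> R) : c != 0 -> Int1 f ->
  \int[leb]_x f (c * x + d) = `|c|^-1 * \int[leb]_x f x.
Proof.
move=> c0 fi; have mf := measurable_int _ fi.
rewrite /Rintegral.
have E1 : (\int[leb]_x (f ((fun x => c * x + d) x))%:E =
    `|c|^-1%:E * \int[leb]_x (f x)%:E)%E.
  rewrite [in LHS]integralE [in RHS]integralE.
  under [X in (X - _ = _)%E]eq_integral do rewrite (funepos_comp (EFin \o f) (fun x => c * x + d))/=.
  under [X in (_ - X = _)%E]eq_integral do rewrite (funeneg_comp (EFin \o f) (fun x => c * x + d))/=.
  rewrite (ge0_integral_affine d c0 (measurable_funepos mf))//.
  rewrite (ge0_integral_affine d c0 (measurable_funeneg mf))//.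
  by rewrite -muleBr// fin_num_adde_defl// fin_numN; exact: integrable_neg_fin_num.
by rewrite E1 fineM//; exact: integrable_fin_num.
Qed.

Lemma Int2_aff2 (c d e : R) (f : R * R -> R) : c != 0 -> Int2 f -> Int2 (fun z => f (aff2 c d e z)).
Proof.
move=> c0 fi; have mf := Int2_measurable fi.
have mfa := measurableT_comp mf (measurable_aff2 c d e).
apply/integrableP; split; first exact/measurable_EFinP.
have /integrableP[_] := fi; rewrite /=.
rewrite (ge0_integral_aff2 (f := fun x => `|(f x)%:E|%E) d e c0)//; last first.
  by apply: measurableT_comp => //; exact/measurable_EFinP.
by move=> h; rewrite lte_mul_pinfty.
Qed.

Lemma aff2K (c d e : R) : c != 0 ->
  cancel (aff2 c d e) (aff2 c^-1 (- d / c) (- e / c)).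
Proof. by move=> c0 [t x]; rewrite /aff2/=; congr pair; field. Qed.

Lemma aff2VK (c d e : R) : c != 0 ->
  cancel (aff2 c^-1 (- d / c) (- e / c)) (aff2 c d e).
Proof. by move=> c0 [t x]; rewrite /aff2/=; congr pair; field. Qed.

Lemma Int2_aff2V (c d e : R) (f : R * R -> R) : c != 0 -> Int2 (fun z => f (aff2 c d e z)) -> Int2 f.
Proof.
move=> c0 /(Int2_aff2 (- d / c) (- e / c) (invr_neq0 c0)).
by under eq_fun do rewrite aff2VK//.
Qed.

Lemma integral_aff2 (c d e : R) (f : R * R -> R) : c != 0 -> Int2 f ->
  \int[leb2]_z f (aff2 c d e z) = `|c|^-1 * \int[leb2]_z f z.
Proof.
move=> c0 fi; have mf := measurable_int _ fi.
rewrite /Rintegral.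
have E1 : (\int[leb2]_x (f ((aff2 c d e) x))%:E =
    `|c|^-1%:E * \int[leb2]_x (f x)%:E)%E.
  rewrite [in LHS]integralE [in RHS]integralE.
  under [X in (X - _ = _)%E]eq_integral do rewrite (funepos_comp (EFin \o f) (aff2 c d e))/=.
  under [X in (_ - X = _)%E]eq_integral do rewrite (funeneg_comp (EFin \o f) (aff2 c d e))/=.
  rewrite (ge0_integral_aff2 d e c0 (measurable_funepos mf))//.
  rewrite (ge0_integral_aff2 d e c0 (measurable_funeneg mf))//.
  by rewrite -muleBr// fin_num_adde_defl// fin_numN; exact: integrable_neg_fin_num.
by rewrite E1 fineM//; exact: integrable_fin_num.
Qed.

(* almost everywhere *)
Lemma leb2_xsection (A : set (measurableTypeR R * measurableTypeR R)) : measurable A ->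
  leb2 A = (\int[leb]_x leb (xsection A x))%E.
Proof. by []. Qed.

Lemma leb2_ysection (A : set (measurableTypeR R * measurableTypeR R)) : measurable A ->
  leb2 A = (\int[leb]_y leb (ysection A y))%E.
Proof.
move=> mA; have ma : measurable_fun setT (fun z => (\1_A z)%:E : \bar R).
  exact/measurable_EFinP.
transitivity (\int[leb2]_z (\1_A z)%:E)%E; first by rewrite integral_indic// setIT.
rewrite /Defs.leb2 (fubini_tonelli1 _ ma); last by move=> z; rewrite lee_fin.
rewrite /fubini_F (fubini_tonelli _ ma) /=; last by move=> z; rewrite lee_fin.
apply: eq_integral => y _.
transitivity (\int[leb]_x (\1_(ysection A y) x)%:E)%E.
  by apply: eq_integral => x _; rewrite !indicE mem_ysection.
by rewrite integral_indic ?setIT//; exact: measurable_ysection.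
Qed.

Lemma ae_slice1 (Q : R * R -> Prop) : {ae leb2, forall z, Q z} ->
  {ae leb, forall t, {ae leb, forall x, Q (t, x)}}.
Proof.
move=> [N [mN N0 QN]].
have := leb2_xsection mN; rewrite N0 => /esym h.
have ms : measurable_fun setT (fun x => leb (xsection N x)).
  exact: measurable_fun_xsection.
have : ae_eq leb setT (fun x => leb (xsection N x)) (cst 0%E).
  apply/ae_eq_integral_abs => //; rewrite -[RHS]h; apply: eq_integral => x _.
  by rewrite gee0_abs.
apply: filterS => t /(_ I) /= ht.
exists (xsection N t); split => //; first exact: measurable_xsection.
by move=> x /= hx; rewrite xsectionP; apply: QN.
Qed.

Lemma ae_slice2 (Q : R * R -> Prop) : {ae leb2, forall z, Q z} ->
  {ae leb, forall x, {ae leb, forall t, Q (t, x)}}.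
Proof.
move=> [N [mN N0 QN]].
have := leb2_ysection mN; rewrite N0 => /esym h.
have ms : measurable_fun setT (fun x => leb (ysection N x)).
  exact: measurable_fun_ysection.
have : ae_eq leb setT (fun x => leb (ysection N x)) (cst 0%E).
  apply/ae_eq_integral_abs => //; rewrite -[RHS]h; apply: eq_integral => x _.
  by rewrite gee0_abs.
apply: filterS => t /(_ I) /= ht.
exists (ysection N t); split => //; first exact: measurable_ysection.
by move=> x /= hx; rewrite ysectionP; apply: QN.
Qed.

Lemma leb2_ae_slices1 (A : set (measurableTypeR R * measurableTypeR R)) : measurable A ->
  {ae leb, forall t, {ae leb, forall x, A (t, x)}} -> {ae leb2, forall z, A z}.
Proof.
move=> mA h; have mC := measurableC mA.
exists (~` A); split => //; rewrite leb2_xsection//.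
rewrite (ae_eq_integral (cst 0%E)) ?integral0//; first exact: measurable_fun_xsection.
apply: filterS h => t ht _; apply: measure_negligible; first exact: measurable_xsection.
by apply: negligibleS ht => x /=; rewrite xsectionP.
Qed.

Lemma leb2_ae_slices2 (A : set (measurableTypeR R * measurableTypeR R)) : measurable A ->
  {ae leb, forall x, {ae leb, forall t, A (t, x)}} -> {ae leb2, forall z, A z}.
Proof.
move=> mA h; have mC := measurableC mA.
exists (~` A); split => //; rewrite leb2_ysection//.
rewrite (ae_eq_integral (cst 0%E)) ?integral0//; first exact: measurable_fun_ysection.
apply: filterS h => t ht _; apply: measure_negligible; first exact: measurable_ysection.
by apply: negligibleS ht => x /=; rewrite ysectionP.
Qed.

Lemma ae_aff2 (c d e : R) (Q : R * R -> Prop) : c != 0 ->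
  {ae leb2, forall z, Q z} -> {ae leb2, forall z, Q (aff2 c d e z)}.
Proof.
move=> c0 [N [mN N0 QN]].
pose N' : set (measurableTypeR R * measurableTypeR R) := aff2 c d e @^-1` N.
have mN' : measurable N' by rewrite -[N']setTI; exact: measurable_aff2.
exists N'; split => //; last by move=> z hz; apply: QN.
have mi : measurable_fun setT (fun z => (\1_N z)%:E : \bar R) by exact/measurable_EFinP.
have := ge0_integral_aff2 d e c0 mi (fun z => ltac:(by rewrite lee_fin)).
by rewrite (integral_indic leb2 measurableT mN) setIT N0 mule0 -[in LHS]/(fun z => \1_N' z) integral_indic// setIT.
Qed.

Lemma ae_affine (c d : R) (Q : R -> Prop) : c != 0 ->
  {ae leb, forall z, Q z} -> {ae leb, forall z, Q (c * z + d)}.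
Proof.
move=> c0 [N [mN N0 QN]].
pose phi := fun x : measurableTypeR R => c * x + d : measurableTypeR R.
exists (phi @^-1` N); split => //; last by move=> z hz; apply: QN.
- by rewrite -[_ @^-1` _]setTI; exact: (measurable_affine c d).
- by rewrite leb_affine// N0 mule0.
Qed.

End tools.

Section tools2.
Context {R : realType}.
Notation leb := (@leb R).
Notation leb2 := (@leb2 R).
Notation Int1 f := (leb.-integrable setT (fun x => (f x)%:E)).
Notation Int2 f := (leb2.-integrable setT (fun x => (f x)%:E)).

Lemma integrable_fine dsp (T : measurableType dsp) (m : {measure set T -> \bar R}) (f : T -> \bar R) :
  m.-integrable setT f -> m.-integrable setT (fun x => (fine (f x))%:E).
Proof.
move=> fi; have mf := measurable_int _ fi.
apply: le_integrable fi => //; first exact/measurable_EFinP/(measurableT_comp _ mf).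
by move=> x _; case: (f x) => [r||] /=; rewrite ?lexx ?leey.
Qed.

Lemma integral_fine dsp (T : measurableType dsp) (m : {measure set T -> \bar R}) (f : T -> \bar R) :
  m.-integrable setT f -> \int[m]_x (fine (f x)) = fine (\int[m]_x f x)%E.
Proof.
move=> fi; have mf := measurable_int _ fi.
rewrite /Rintegral; congr fine; apply: ae_eq_integral => //.
  by have := integrable_fine fi => /measurable_int.
have := integrable_ae measurableT fi.
by apply: filterS => x /(_ I) h _; rewrite fineK.
Qed.

Lemma Int2_slice1 (f : R * R -> R) : Int2 f -> {ae leb, forall t, Int1 (fun x => f (t, x))}.
Proof. by move=> fi; have := ae_integrable1 fi. Qed.

Lemma Int2_slice2 (f : R * R -> R) : Int2 f -> {ae leb, forall x, Int1 (fun t => f (t, x))}.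
Proof. by move=> fi; have := ae_integrable2 fi. Qed.

Lemma Int2_int1 (f : R * R -> R) : Int2 f -> Int1 (fun t => \int[leb]_x f (t, x)).
Proof. by move=> fi; apply: integrable_fine; exact: (integrable_fubini_F fi). Qed.

Lemma integrable_fubini_snd (f : measurableTypeR R * measurableTypeR R -> \bar R) :
  leb2.-integrable setT f -> leb.-integrable setT (fun x => \int[leb]_t f (t, x))%E.
Proof.
move=> fi; have mf := measurable_int _ fi.
have ma : measurable_fun setT (fun z => `|f z|%E) by exact: measurableT_comp.
apply/integrableP; split; first exact: (measurable_fubini_G fi).
have /(integrable21ltyP leb leb mf) := fi; apply: le_lt_trans.
apply: ge0_le_integral => //.
- by apply: measurableT_comp => //; exact: (measurable_fubini_G fi).
- by apply: (measurable_fun_fubini_tonelli_G (m1 := leb) (fun z => `|f z|%E) ma).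
- move=> x _; apply: le_abse_integral => //.
  exact: (measurableT_comp mf (pair2_measurable x)).
Qed.

Lemma Int2_int2 (f : R * R -> R) : Int2 f -> Int1 (fun x => \int[leb]_t f (t, x)).
Proof. by move=> fi; apply: integrable_fine; exact: (integrable_fubini_snd fi). Qed.

Lemma int2_int1 (f : R * R -> R) : Int2 f ->
  \int[leb2]_z f z = \int[leb]_t \int[leb]_x f (t, x).
Proof.
move=> fi; rewrite [RHS]integral_fine; last exact: (integrable_fubini_F fi).
by congr fine; have := integral12_prod_meas1 fi.
Qed.

Lemma int2_int2 (f : R * R -> R) : Int2 f ->
  \int[leb2]_z f z = \int[leb]_x \int[leb]_t f (t, x).
Proof.
move=> fi; rewrite [RHS]integral_fine; last exact: (integrable_fubini_snd fi).
by congr fine; have := integral21_prod_meas1 fi.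
Qed.

Lemma Int_le dsp (T : measurableType dsp) (m : {measure set T -> \bar R}) (f g : T -> R) :
  measurable_fun setT f -> (forall x, `|f x| <= `|g x|) ->
  m.-integrable setT (fun x => (g x)%:E) -> m.-integrable setT (fun x => (f x)%:E).
Proof.
move=> mf fg gi; apply: le_integrable gi => //; first exact/measurable_EFinP.
by move=> x _ /=; rewrite lee_fin.
Qed.

Lemma Int_le_ae dsp (T : measurableType dsp) (m : {measure set T -> \bar R}) (f g : T -> R) :
  measurable_fun setT f -> {ae m, forall x, `|f x| <= `|g x|} ->
  m.-integrable setT (fun x => (g x)%:E) -> m.-integrable setT (fun x => (f x)%:E).
Proof.
move=> mf fg gi; have mg := measurable_int _ gi.
apply/integrableP; split; first exact/measurable_EFinP.
have /integrableP[_] := gi; apply: le_lt_trans.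
apply: ae_ge0_le_integral => //.
- by apply: measurableT_comp => //; exact/measurable_EFinP.
- exact: measurableT_comp.
- by apply: filterS fg => x h _ /=; rewrite lee_fin.
Qed.

Lemma int_le dsp (T : measurableType dsp) (m : {measure set T -> \bar R}) (f g : T -> R) :
  m.-integrable setT (fun x => (f x)%:E) -> m.-integrable setT (fun x => (g x)%:E) ->
  {ae m, forall x, f x <= g x} -> \int[m]_x f x <= \int[m]_x g x.
Proof.
move=> fi gi fg; rewrite -subr_ge0 -RintegralB//.
have h : m.-integrable setT (fun x => (g x - f x)%:E).
  by have := integrableB measurableT gi fi; exact.
rewrite (_ : \int[m]_x (g x - f x) = \int[m]_x `|g x - f x|).
  by apply: Rintegral_ge0.
rewrite /Rintegral; congr fine; apply: ae_eq_integral => //.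
- exact: measurable_int h.
- by apply: measurable_int (integrable_abse h).
- by apply: filterS fg => x h' _; rewrite ger0_norm// subr_ge0.
Qed.

Lemma Int_indic dsp (T : measurableType dsp) (m : {measure set T -> \bar R}) (D : set T) (f : T -> R) :
  measurable D -> m.-integrable D (fun x => (f x)%:E) <-> m.-integrable setT (fun x => (f x * \1_D x)%:E).
Proof.
by move=> mD; rewrite (integrable_mkcond _ mD) epatch_indic.
Qed.

Lemma int_indic dsp (T : measurableType dsp) (m : {measure set T -> \bar R}) (D : set T) (f : T -> R) :
  \int[m]_(x in D) f x = \int[m]_x (f x * \1_D x).
Proof. by rewrite Rintegral_mkcond patch_indic. Qed.

Lemma Int_indicM dsp (T : measurableType dsp) (m : {measure set T -> \bar R}) (D : set T) (f : T -> R) :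
  measurable D -> m.-integrable setT (fun x => (f x)%:E) -> m.-integrable setT (fun x => (f x * \1_D x)%:E).
Proof. by move=> mD fi; apply/(Int_indic m f mD); exact: integrableS fi. Qed.

Lemma Int2M (f g : R -> R) : Int1 f -> Int1 g -> Int2 (fun z => f z.1 * g z.2).
Proof.
move=> fi gi.
have mf := Int1_measurable fi; have mg := Int1_measurable gi.
have m2 : measurable_fun [set: measurableTypeR R * measurableTypeR R] (fun z => f z.1 * g z.2).
  by apply: measurable_funM; apply: measurableT_comp.
apply/(integrable12ltyP leb leb); first exact/measurable_EFinP.
have -> : (\int[leb]_x \int[leb]_y `|(f x * g y)%:E| = (\int[leb]_x `|(f x)%:E|) * (\int[leb]_y `|(g y)%:E|))%E.
  rewrite -ge0_integralZr//; last 2 first.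
  - by apply: measurableT_comp => //; exact/measurable_EFinP.
  - exact: integral_ge0.
  apply: eq_integral => x _; rewrite -ge0_integralZl//; last first.
    by apply: measurableT_comp => //; exact/measurable_EFinP.
  by apply: eq_integral => y _; rewrite -abseM.
have /integrableP[_ h1] := fi; have /integrableP[_ h2] := gi.
by rewrite lte_mul_pinfty ?integral_ge0// ge0_fin_numE ?integral_ge0.
Qed.

(* open sets of the plane *)
Lemma open_measurable2 (U : set (R * R)) : open U ->
  measurable (U : set (measurableTypeR R * measurableTypeR R)).
Proof.
move=> oU.
pose box (p : rat * rat * rat * rat) : set (R * R) :=
  `]ratr p.1.1.1, ratr p.1.1.2[%classic `*` `]ratr p.1.2, ratr p.2[%classic.
have -> : U = \bigcup_(p in [set p | box p `<=` U]) box p.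
  apply/seteqP; split; last by move=> z [p /= pU /pU].
  move=> [t x] /oU[[A B] /= [At Bx] AB].
  have [e1 /= e10 hA] := At; have [e2 /= e20 hB] := Bx.
  have [a ha] := rat_in_itvoo (ltac:(by rewrite ltrBlDr ltrDl) : t - e1 < t).
  have [b hb] := rat_in_itvoo (ltac:(by rewrite ltrDl) : t < t + e1).
  have [c hc] := rat_in_itvoo (ltac:(by rewrite ltrBlDr ltrDl) : x - e2 < x).
  have [d hd] := rat_in_itvoo (ltac:(by rewrite ltrDl) : x < x + e2).
  move: ha hb hc hd; rewrite !in_itv/= => /andP[a1 a2] /andP[b1 b2] /andP[c1 c2] /andP[d1 d2].
  exists (a, b, c, d) => /=; last by rewrite /box/= !in_itv/= a2 b1 c2 d1.
  move=> [s y] [/=]; rewrite !in_itv/= => /andP[s1 s2] /andP[y1 y2].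
  apply: (AB (s, y)); split => /=.
    apply: hA; rewrite /ball_/= ltr_norml; apply/andP; split; lra.
  apply: hB; rewrite /ball_/= ltr_norml; apply/andP; split; lra.
rewrite bigcup_mkcond; apply: countable_bigcupT_measurable => [|p]; first exact: countableP.
by case: ifP => _ //; exact: measurableX.
Qed.

Lemma Int1_le (f g : R -> R) : measurable_fun [set: measurableTypeR R] f ->
  (forall x, `|f x| <= `|g x|) -> Int1 g -> Int1 f.
Proof. exact: (@Int_le _ _ leb). Qed.

Lemma Int2_le (f g : R * R -> R) :
  measurable_fun [set: measurableTypeR R * measurableTypeR R] f ->
  (forall x, `|f x| <= `|g x|) -> Int2 g -> Int2 f.
Proof. exact: (@Int_le _ _ leb2). Qed.

Lemma Int1_le_ae (f g : R -> R) : measurable_fun [set: measurableTypeR R] f ->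
  {ae leb, forall x, `|f x| <= `|g x|} -> Int1 g -> Int1 f.
Proof. exact: (@Int_le_ae _ _ leb). Qed.

Lemma Int2_le_ae (f g : R * R -> R) :
  measurable_fun [set: measurableTypeR R * measurableTypeR R] f ->
  {ae leb2, forall x, `|f x| <= `|g x|} -> Int2 g -> Int2 f.
Proof. exact: (@Int_le_ae _ _ leb2). Qed.

Lemma Int1D (f g : R -> R) : Int1 f -> Int1 g -> Int1 (fun x => f x + g x).
Proof. by move=> fi gi; have := integrableD measurableT fi gi. Qed.
Lemma Int1B (f g : R -> R) : Int1 f -> Int1 g -> Int1 (fun x => f x - g x).
Proof. by move=> fi gi; have := integrableB measurableT fi gi. Qed.
Lemma Int1Z (k : R) (f : R -> R) : Int1 f -> Int1 (fun x => k * f x).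
Proof. by move=> fi; have := integrableZl measurableT k fi. Qed.
Lemma Int2D (f g : R * R -> R) : Int2 f -> Int2 g -> Int2 (fun x => f x + g x).
Proof. by move=> fi gi; have := integrableD measurableT fi gi. Qed.
Lemma Int2B (f g : R * R -> R) : Int2 f -> Int2 g -> Int2 (fun x => f x - g x).
Proof. by move=> fi gi; have := integrableB measurableT fi gi. Qed.
Lemma Int2Z (k : R) (f : R * R -> R) : Int2 f -> Int2 (fun x => k * f x).
Proof. by move=> fi; have := integrableZl measurableT k fi. Qed.

Lemma Int1_bddM (f g : R -> R) (M : R) : measurable_fun [set: measurableTypeR R] g ->
  (forall x, `|g x| <= M) -> Int1 f -> Int1 (fun x => f x * g x).
Proof.
move=> mg gM fi; have mf := Int1_measurable fi.
apply: (@Int1_le _ (fun x => M * f x)); last exact: Int1Z.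
  exact: measurable_funM.
move=> x; rewrite !normrM mulrC ler_wpM2r//.
by rewrite (le_trans (gM x))// ler_norm.
Qed.

Lemma Int2_bddM (f g : R * R -> R) (M : R) :
  measurable_fun [set: measurableTypeR R * measurableTypeR R] g ->
  (forall x, `|g x| <= M) -> Int2 f -> Int2 (fun x => f x * g x).
Proof.
move=> mg gM fi; have mf := Int2_measurable fi.
apply: (@Int2_le _ (fun x => M * f x)); last exact: Int2Z.
  exact: measurable_funM.
move=> x; rewrite !normrM mulrC ler_wpM2r//.
by rewrite (le_trans (gM x))// ler_norm.
Qed.

Lemma indic_pred T (p : T -> bool) (x : T) : \1_[set y | p y] x = (p x)%:R :> R.
Proof. by rewrite indicE; case: (boolP (p x)) => h; [rewrite mem_set|rewrite memNset//; exact/negP]. Qed.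

Lemma measurable_pred dsp (T : measurableType dsp) (p : T -> bool) :
  measurable_fun setT p -> measurable_fun setT (fun x => (p x)%:R : R).
Proof.
move=> mp; rewrite (_ : (fun x => _) = \1_[set y | p y]).
  by apply: measurable_indic; have := mp measurableT [set true] I; rewrite setTI.
by apply/funext => x; rewrite indic_pred.
Qed.

Lemma measurable_le2 : measurable_fun [set: measurableTypeR R * measurableTypeR R]
  (fun z => (z.1 <= z.2)%R%:R : R).
Proof. by apply: measurable_pred; exact: measurable_fun_ler. Qed.

Lemma aeS (P Q : R -> Prop) : (forall x, P x -> Q x) ->
  {ae leb, forall x, P x} -> {ae leb, forall x, Q x}.
Proof. by move=> PQ [N [mN N0 h]]; exists N; split => // x nQ; apply: h => Px; apply/nQ/PQ. Qed.

Lemma aeS2 (P P' Q : R -> Prop) : (forall x, P x -> P' x -> Q x) ->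
  {ae leb, forall x, P x} -> {ae leb, forall x, P' x} -> {ae leb, forall x, Q x}.
Proof.
move=> PQ hP hP'; have h : {ae leb, forall x, P x /\ P' x}.
  exact: (@filterI _ _ (ae_filter_ringOfSetsType leb) _ _ hP hP').
by apply: aeS h => x [/PQ]; apply.
Qed.

Lemma ae2S (P Q : R * R -> Prop) : (forall x, P x -> Q x) ->
  {ae leb2, forall x, P x} -> {ae leb2, forall x, Q x}.
Proof. by move=> PQ [N [mN N0 h]]; exists N; split => // x nQ; apply: h => Px; apply/nQ/PQ. Qed.

Lemma ae2S2 (P P' Q : R * R -> Prop) : (forall x, P x -> P' x -> Q x) ->
  {ae leb2, forall x, P x} -> {ae leb2, forall x, P' x} -> {ae leb2, forall x, Q x}.
Proof.
move=> PQ hP hP'; have h : {ae leb2, forall x, P x /\ P' x}.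
  exact: (@filterI _ _ (ae_filter_ringOfSetsType leb2) _ _ hP hP').
by apply: ae2S h => x [/PQ]; apply.
Qed.

End tools2.

Section bump.
Context {R : realType}.

Lemma classCS {V W : normedModType R} (U : set V) k (f : V -> W) : classC k.+1 U f -> classC k U f.
Proof.
elim: k f => [|k IH] f [df Df].
  by move=> x Ux; apply: differentiable_continuous; exact: df.
by split=> // v; apply: IH; exact: Df.
Qed.

Lemma classCD {V W : normedModType R} k (f g : V -> W) :
  classC k setT f -> classC k setT g -> classC k setT (fun x => f x + g x).
Proof.
elim: k f g => [|k IH] f g.
  by move=> cf cg x _; apply: cvgD; [exact: cf|exact: cg].
move=> [df Df] [dg Dg]; split=> [x _|v].
  by apply: differentiableD; [exact: df|exact: dg].
have -> : (fun x => 'D_v (fun y => f y + g y) x) = (fun x => 'D_v f x + 'D_v g x).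
  by apply/funext => x; rewrite deriveD//; apply: diff_derivable; [exact: df|exact: dg].
by apply: IH; [exact: Df|exact: Dg].
Qed.

Lemma classCZ {V W : normedModType R} k (a : R) (f : V -> W) :
  classC k setT f -> classC k setT (fun x => a *: f x).
Proof.
elim: k f => [|k IH] f.
  by move=> cf x _; apply: cvgZr; exact: cf.
move=> [df Df]; split=> [x _|v].
  by apply: differentiableZ; exact: df.
have -> : (fun x => 'D_v (fun y => a *: f y) x) = (fun x => a *: 'D_v f x).
  by apply/funext => x; rewrite deriveZ//; apply: diff_derivable; exact: df.
by apply: IH; exact: Df.
Qed.

Lemma classCM {V : normedModType R} k (f g : V -> R) :
  classC k setT f -> classC k setT g -> classC k setT (fun x => f x * g x).
Proof.
elim: k f g => [|k IH] f g.
  by move=> cf cg x _; apply: cvgM; [exact: cf|exact: cg].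
move=> cf cg; have [df Df] := cf; have [dg Dg] := cg; split=> [x _|v].
  by apply: differentiableM; [exact: df|exact: dg].
have -> : (fun x => 'D_v (fun y => f y * g y) x) = (fun x => f x * 'D_v g x + g x * 'D_v f x).
  by apply/funext => x; rewrite deriveM//; apply: diff_derivable; [exact: df|exact: dg].
apply: classCD; apply: IH; [exact: classCS|exact: Dg|exact: classCS|exact: Df].
Qed.

Definition plat (m : nat) (x : R) : R := if 0 < x then x ^- m * expR (- x^-1) else 0.

Lemma plat_bound m x : 0 < x -> `|plat m x| <= m.+2`!%:R * x ^+ 2.
Proof.
move=> x0; rewrite /plat x0 ger0_norm; last first.
  by rewrite mulr_ge0 ?expR_ge0 ?invr_ge0 ?exprn_ge0 ?ltW.
have xV0 : 0 <= x^-1 by rewrite invr_ge0 ltW.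
have := expR_ge1Dxn m.+1 xV0 => h.
have h2 : (x^-1) ^+ m.+2 / m.+2`!%:R <= expR x^-1 by apply: le_trans h; rewrite lerDr.
rewrite expRN ler_pdivrMr ?expR_gt0//.
have f0 : 0 < m.+2`!%:R :> R by rewrite ltr0n fact_gt0.
move: h2; rewrite ler_pdivrMr// mulrC => h2.
have -> : x ^- m = (x^-1) ^+ m.+2 * x ^+ 2.
  by rewrite exprVn -addn2 exprD; field; rewrite gt_eqF//= expf_neq0// gt_eqF.
by rewrite [leRHS]mulrAC ler_wpM2r// exprn_ge0// ltW.
Qed.

Lemma plat_derive m (x : R) :
  is_derive x 1 (plat m) (plat m.+2 x - m%:R * plat m.+1 x).
Proof.
have [x0|x0|->] := ltgtP x 0.
- rewrite /plat (lt_gtF x0) mulr0 subr0.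
  apply: (near_eq_is_derive (f := cst 0)).
  by near=> y; rewrite ifF//; apply/negbTE; rewrite -leNgt ltW//; near: y; exact: lt_nbhsl.
- have nb : \near x, x ^- m * expR (- x^-1) = plat m x.
    by near=> y; rewrite /plat ifT//; near: y; exact: lt_nbhsr.
  apply: near_eq_is_derive nb _.
  have xn0 : x != 0 by rewrite gt_eqF.
  have h1 : is_derive x 1 (fun y : R => y^-1) (- x ^- 2).
    apply: is_derive_eq; first exact: (@is_deriveV _ id).
    by rewrite /GRing.scale/= mulr1.
  have h2 : is_derive x 1 (fun y : R => expR (- y^-1)) (x ^- 2 * expR (- x^-1)).
    apply: is_derive_eq.
    by rewrite opprK mulrC.
  have h3 : is_derive x 1 (fun y : R => (y^-1) ^+ m) (- m%:R * x ^- m.+1).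
    rewrite (_ : (fun y : R => y^-1 ^+ m) = (fun y : R => y^-1) ^+ m); last by rewrite exprfctE.
    apply: is_derive_eq.
    rewrite /GRing.scale/=; case: m => [|m]; first by rewrite !(mul0r,oppr0).
    have -> : (x^-1) ^+ m.+1.-1 = x ^- m by rewrite succnK exprVn.
    by rewrite !exprS; field; rewrite xn0 expf_neq0.
  have h4 := is_deriveM h3 h2.
  have -> : (fun y : R => y ^- m * expR (- y^-1)) =
      (fun y : R => (y^-1) ^+ m) * (fun y : R => expR (- y^-1)).
    by apply/funext => y; rewrite /= -exprVn.
  apply: (is_derive_eq h4); rewrite /plat x0 /GRing.scale/= exprVn.
  by rewrite !exprS; field; rewrite xn0 expf_neq0.
have p0 k : plat k 0 = 0 by rewrite /plat ltxx.
rewrite !p0 mulr0 subr0.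
have cv : h^-1 *: (plat m (h *: 1 + 0) - plat m 0) @[h --> (0:R)^'] --> (0 : R).
  apply/cvgr0Pnorm_lt => e e0; near=> h.
  have h0 : h != 0 by near: h; exact: nbhs_dnbhs_neq.
  rewrite p0 subr0 addr0 /GRing.scale/= mulr1 normrM normfV.
  rewrite mulrC ltr_pdivrMr ?normr_gt0//.
  have [hp|hn] := ltP 0 h; last first.
    by rewrite /plat (le_gtF hn) normr0 mulr_gt0// normr_gt0.
  apply: le_lt_trans (plat_bound m hp) _.
  rewrite gtr0_norm// expr2 mulrA ltr_pM2r//.
  rewrite mulrC -ltr_pdivlMr ?ltr0n ?fact_gt0//.
  rewrite -(gtr0_norm hp); near: h; apply: dnbhs0_lt.
  by rewrite divr_gt0// ltr0n fact_gt0.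
apply: DeriveDef; first by apply/cvg_ex; exists 0; exact: cv.
by apply/cvg_lim => //; exact: cv.
Unshelve. all: by end_near. Qed.

Lemma plat_continuous m : continuous (plat m).
Proof.
by move=> x; apply: differentiable_continuous; apply/derivable1_diffP; have [] := plat_derive m x.
Qed.

Section linear_pullback.
Variables (a b : R).
Definition lf (z : R * R) : R := a * z.1 + b * z.2.

Lemma lf_diff c (z : R * R) : is_diff z (fun w => lf w + c) lf.
Proof.
have ll : linear (lf : R * R -> R^o).
  move=> k [u1 u2] [v1 v2]; rewrite /lf/= /GRing.scale/=; ring.
pose L : {linear (R * R)%type -> R^o} := HB.pack (lf : R * R -> R^o) (GRing.isLinear.Build _ _ _ _ _ ll).
have cl : continuous L.
  move=> w; apply: cvgD; apply: cvgZr; first exact: cvg_fst.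
  exact: cvg_snd.
have hL : is_diff z (L : R * R -> R) lf.
  by apply: DiffDef; [exact: linear_differentiable|exact: diff_lin].
by rewrite -[X in is_diff _ _ X]addr0; apply: is_diffD.
Qed.

Lemma pullback_derive (f : R -> R) c (z v : R * R) (df : R) :
  is_derive (lf z + c) 1 f df ->
  differentiable (fun w => f (lf w + c)) z /\ 'D_v (fun w => f (lf w + c)) z = lf v * df.
Proof.
move=> [fd fv].
have [ld lv] := lf_diff c z.
have fd' : differentiable f (lf z + c) by exact/derivable1_diffP.
have dd : differentiable (f \o (fun w => lf w + c)) z by exact: differentiable_comp.
split=> //; rewrite deriveE// (diff_comp ld fd') lv /= deriv1E//.
by rewrite /GRing.scale/= derive1E fv.
Qed.

Lemma classC_plat k m c : classC k setT (fun w => plat m (lf w + c)).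
Proof.
elim: k m => [|k IH] m.
  move=> z _; apply: differentiable_continuous.
  by have [] := pullback_derive (0, 0) (plat_derive m (lf z + c)).
split=> [z _|v]; first by have [] := pullback_derive (0, 0) (plat_derive m (lf z + c)).
have -> : (fun x => 'D_v (fun w => plat m (lf w + c)) x) =
    (fun x => lf v *: plat m.+2 (lf x + c) + (- lf v * m%:R) *: plat m.+1 (lf x + c)).
  apply/funext => x; have [_ ->] := pullback_derive v (plat_derive m (lf x + c)).
  by rewrite /GRing.scale/= mulrBr mulrA mulNr mulNr.
by apply: classCD; apply: classCZ.
Qed.
End linear_pullback.

Definition bump (l r : R) (k : nat) (y : R) : R :=
  plat 0 (k.+1%:R * (y - l)) * plat 0 (k.+1%:R * (r - y)).

Definition dbump (l r : R) (k : nat) (y : R) : R :=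
  k.+1%:R * (plat 2 (k.+1%:R * (y - l)) * plat 0 (k.+1%:R * (r - y)) -
  plat 0 (k.+1%:R * (y - l)) * plat 2 (k.+1%:R * (r - y))).

Lemma plat0_ge0 y : 0 <= plat 0 y.
Proof. by rewrite /plat; case: ifP => // _; rewrite expr0 invr1 mul1r expR_ge0. Qed.

Lemma plat0_le1 y : plat 0 y <= 1.
Proof.
rewrite /plat; case: ifP => // y0; rewrite expr0 invr1 mul1r -expR0 ler_expR.
by rewrite oppr_le0 invr_ge0 ltW.
Qed.

Lemma bump_ge0 l r k y : 0 <= bump l r k y.
Proof. by rewrite mulr_ge0// plat0_ge0. Qed.

Lemma bump_le1 l r k y : bump l r k y <= 1.
Proof. by rewrite -(mulr1 1) ler_pM// ?plat0_ge0 ?plat0_le1. Qed.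

Lemma bump_out l r k y : ~ (l < y < r) -> bump l r k y = 0.
Proof.
move=> /negP; rewrite negb_and -!leNgt /bump/plat => /orP[h|h].
  by rewrite [X in X * _]ifF ?mul0r// pmulr_rgt0// subr_gt0 ltNge h.
by rewrite [X in _ * X]ifF ?mulr0// pmulr_rgt0// subr_gt0 ltNge h.
Qed.

Lemma dbump_out l r k y : ~ (l < y < r) -> dbump l r k y = 0.
Proof.
move=> /negP; rewrite negb_and -!leNgt /dbump/plat => /orP[h|h].
  by rewrite (_ : 0 < k.+1%:R * (y - l) = false) ?(mul0r,subr0,mulr0)// pmulr_rgt0// subr_gt0 ltNge h.
by rewrite (_ : 0 < k.+1%:R * (r - y) = false) ?(mul0r,subr0,mulr0)// pmulr_rgt0// subr_gt0 ltNge h.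
Qed.

Lemma bump_cvg l r y : bump l r k y @[k --> \oo] --> (\1_`]l, r[ y : R).
Proof.
have [lyr|nlyr] := pselect (l < y < r); last first.
  rewrite indicE memNset; last by rewrite /= in_itv.
  by under eq_fun do rewrite bump_out//; exact: cvg_cst.
rewrite indicE mem_set; last by rewrite /= in_itv.
rewrite -[1%:R]mulr1.
move: lyr => /andP[ly yr].
have pc a : 0 < a -> plat 0 (k.+1%:R * a) @[k --> \oo] --> (expR (0 * - a^-1) : R).
  move=> a0; rewrite /plat.
  under eq_fun do rewrite pmulr_rgt0// a0 expr0 invr1 mul1r invfM -mulrN.
  apply: continuous_cvg; first exact: continuous_expR.
  by apply: cvgMl; exact: cvg_harmonic.
have pc' a : 0 < a -> plat 0 (k.+1%:R * a) @[k --> \oo] --> (1 : R).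
  by move=> /pc; rewrite mul0r expR0.
by apply: cvgM; apply: pc'; rewrite subr_gt0.
Qed.

Lemma bump_derive (l r : R) k (y : R) : is_derive y 1 (bump l r k) (dbump l r k y).
Proof.
have h1 : is_derive y 1 (fun y => plat 0 (k.+1%:R * (y - l))) (k.+1%:R * plat 2 (k.+1%:R * (y - l))).
  have hd : is_derive y 1 (fun y : R => k.+1%:R * (y - l)) k.+1%:R.
    by apply: is_derive_eq; rewrite /GRing.scale/=; ring.
  have := @is_derive1_comp _ (plat 0) (fun y : R => k.+1%:R * (y - l)) y _ _ (plat_derive 0 (k.+1%:R * (y - l))) hd.
  by rewrite mul0r subr0 mulrC.
have h2 : is_derive y 1 (fun y => plat 0 (k.+1%:R * (r - y))) (- k.+1%:R * plat 2 (k.+1%:R * (r - y))).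
  have hd : is_derive y 1 (fun y : R => k.+1%:R * (r - y)) (- k.+1%:R).
    by apply: is_derive_eq; rewrite /GRing.scale/=; ring.
  have := @is_derive1_comp _ (plat 0) (fun y : R => k.+1%:R * (r - y)) y _ _ (plat_derive 0 (k.+1%:R * (r - y))) hd.
  by rewrite mul0r subr0 mulrC.
have h := is_deriveM h1 h2; apply: (is_derive_eq h).
by rewrite /dbump /GRing.scale/=; ring.
Qed.

Lemma bump_continuous l r k : continuous (bump l r k).
Proof.
by move=> x; apply: differentiable_continuous; apply/derivable1_diffP; have [] := bump_derive l r k x.
Qed.

Lemma dbump_continuous l r k : continuous (dbump l r k).
Proof.
move=> y.
have c1 m : {for y, continuous (fun y => plat m (k.+1%:R * (y - l)))}.
  apply: (@continuous_comp _ _ _ (fun y : R => k.+1%:R * (y - l)) (plat m)); last exact: plat_continuous.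
  by apply: cvgMr; apply: cvgB; [exact: cvg_id|exact: cvg_cst].
have c2 m : {for y, continuous (fun y => plat m (k.+1%:R * (r - y)))}.
  apply: (@continuous_comp _ _ _ (fun y : R => k.+1%:R * (r - y)) (plat m)); last exact: plat_continuous.
  by apply: cvgMr; apply: cvgB; [exact: cvg_cst|exact: cvg_id].
by apply: cvgMr; apply: cvgB; apply: cvgM; [exact: c1|exact: c2|exact: c1|exact: c2].
Qed.

End bump.

Section weak.
Context {R : realType}.
Notation leb := (@leb R).
Notation leb2 := (@leb2 R).
Notation Int1 f := (leb.-integrable setT (fun x => (f x)%:E)).
Notation Int2 f := (leb2.-integrable setT (fun x => (f x)%:E)).

Definition tbump (s t1 t2 e1 e2 : R) (k : nat) (z : R * R) : R :=
  bump t1 t2 k z.1 * bump e1 e2 k (z.2 - s * z.1).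

Lemma classC_bump k0 (a b l r : R) k : classC k0 setT (fun z : R * R => bump l r k (a * z.1 + b * z.2)).
Proof.
pose K : R := k.+1%:R.
have -> : (fun z : R * R => bump l r k (a * z.1 + b * z.2)) =
  (fun z : R * R => plat 0 ((K * a) * z.1 + (K * b) * z.2 + (- K * l)) *
                    plat 0 ((- K * a) * z.1 + (- K * b) * z.2 + K * r)).
  by apply/funext => z; rewrite /bump -/K; congr (plat _ _ * plat _ _); ring.
by apply: classCM; exact: classC_plat.
Qed.

Lemma tbump_test (s t1 t2 e1 e2 : R) k : 0 < t1 -> test_function (tbump s t1 t2 e1 e2 k).
Proof.
move=> t10; split.
  have -> : tbump s t1 t2 e1 e2 k = (fun z : R * R => bump t1 t2 k (1 * z.1 + 0 * z.2) *
      bump e1 e2 k (- s * z.1 + 1 * z.2)).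
    by apply/funext => z; rewrite /tbump; congr (bump _ _ _ _ * bump _ _ _ _); ring.
  by move=> k0; apply: classCM; exact: classC_bump.
exists ((fun z : R * R => (z.1, z.2 + s * z.1)) @` (`[t1, t2] `*` `[e1, e2])).
  split.
    apply: continuous_compact; last by apply: compact_setX; exact: segment_compact.
    apply: continuous_subspaceT => z.
    apply: (@cvg_pair _ _ _ _ (nbhs z.1) (nbhs (z.2 + s * z.1))); first exact: cvg_fst.
    have [ld _] := lf_diff s 1 0 z; have := differentiable_continuous ld.
    rewrite (_ : z.2 + s * z.1 = lf s 1 z + 0); last by rewrite /lf; ring.
    by apply: cvg_trans; apply: near_eq_cvg; near=> w; rewrite /lf /=; ring.
  by move=> y [[t x] [/=]]; rewrite !in_itv/= => /andP[h _] _ <- /=; exact: lt_le_trans h.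
move=> [t x] /= hz; rewrite /tbump/=.
have [h1|h1] := pselect (t1 < t < t2); last by rewrite bump_out// mul0r.
have [h2|h2] := pselect (e1 < x - s * t < e2); last by rewrite [X in _ * X]bump_out// mulr0.
exfalso; apply: hz; exists (t, x - s * t) => /=; last by rewrite subrK.
by move: h1 h2 => /andP[? ?] /andP[? ?]; rewrite !in_itv/= !ltW.
Unshelve. all: by end_near. Qed.

Lemma tbump_derive (s t1 t2 e1 e2 : R) k (z v : R * R) :
  'D_v (tbump s t1 t2 e1 e2 k) z = v.1 * (dbump t1 t2 k z.1 * bump e1 e2 k (z.2 - s * z.1))
   + (v.2 - s * v.1) * (bump t1 t2 k z.1 * dbump e1 e2 k (z.2 - s * z.1)).
Proof.
have -> : tbump s t1 t2 e1 e2 k = (fun z : R * R => bump t1 t2 k (1 * z.1 + 0 * z.2 + 0)) \*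
      (fun z : R * R => bump e1 e2 k (- s * z.1 + 1 * z.2 + 0)).
  by apply/funext => y; rewrite /tbump/=; congr (bump _ _ _ _ * bump _ _ _ _); ring.
have [d1 D1] := @pullback_derive R 1 0 _ 0 z v _ (bump_derive t1 t2 k _).
have [d2 D2] := @pullback_derive R (- s) 1 _ 0 z v _ (bump_derive e1 e2 k _).
rewrite deriveM; [|exact: diff_derivable..].
rewrite D1 D2 /lf /GRing.scale/=.
have -> : 1 * z.1 + 0 * z.2 + 0 = z.1 by ring.
have -> : - s * z.1 + 1 * z.2 + 0 = z.2 - s * z.1 by ring.
by ring.
Qed.

Lemma continuous_cpt_Int1 (f : R -> R) (l r : R) : continuous f ->
  (forall x, ~ (l <= x <= r) -> f x = 0) -> Int1 f.
Proof.
move=> cf f0; have -> : (fun x => (f x)%:E) = (fun x => (f x * \1_(`[l, r]) x)%:E).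
  apply/funext => x; have [h|h] := pselect (l <= x <= r); last by rewrite f0// mul0r.
  by rewrite indicE mem_set ?mulr1//= in_itv.
apply/(Int_indic leb f (measurable_itv _)).
apply: continuous_compact_integrable; first exact: segment_compact.
exact: continuous_subspaceT.
Qed.

Lemma ibp (g X dX : R -> R) (l r W0 : R) : Int1 g ->
  (forall x : R, is_derive x 1 X (dX x)) -> continuous dX ->
  (forall x, ~ (l <= x <= r) -> X x = 0) -> (forall x, ~ (l <= x <= r) -> dX x = 0) ->
  \int[leb]_x ((W0 + \int[leb]_(y in `]-oo, x]) g y) * dX x) = - \int[leb]_x (g x * X x).
Proof.
move=> gi dXX cdX X0 dX0.
have dXi : Int1 dX by exact: continuous_cpt_Int1 cdX dX0.
have mg := Int1_measurable gi; have mdX := Int1_measurable dXi.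
have FTC (s b : R) : `|s| + `|l| + `|r| < b -> \int[leb]_(t in `[s, b]) dX t = - X s.
  move=> sb.
  have sb' : s < b.
    by apply: le_lt_trans sb; rewrite -addrA (le_trans (ler_norm s))// lerDl addr_ge0.
  have rb : r < b.
    by apply: le_lt_trans sb; rewrite (le_trans (ler_norm r))// lerDr addr_ge0.
  rewrite /Rintegral (continuous_FTC2 (F := X))//.
  - by rewrite /= (X0 b) ?sub0r// => /andP[_]; rewrite leNgt rb.
  - exact: continuous_subspaceT.
  - split => [x _||]; first by have [] := dXX x.
      apply: cvg_at_right_filter; apply: differentiable_continuous.
      by apply/derivable1_diffP; have [] := dXX s.
    apply: cvg_at_left_filter; apply: differentiable_continuous.
    by apply/derivable1_diffP; have [] := dXX b.
  - by move=> x _; rewrite derive1E; have [_ ->] := dXX x.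
pose b0 (s : R) : R := `|s| + `|l| + `|r| + 1.
have FT (s : R) : \int[leb]_(t in `[s, +oo[) dX t = - X s.
  rewrite -(FTC s (b0 s)); last by rewrite /b0 ltrDl.
  rewrite [LHS]int_indic [RHS]int_indic; apply: eq_Rintegral => x _; rewrite !indicE.
  have [h|h] := pselect (l <= x <= r); last by rewrite dX0// !mul0r.
  rewrite !mem_setE /= !in_itv/= andbT.
  suff : x <= b0 s by move=> ->; rewrite andbT.
  move: h => /andP[_ /le_trans]; apply; rewrite /b0 -addrA.
  rewrite (le_trans (ler_norm r))// addrA -[leLHS]addr0 lerD// ?lerDr ?addr_ge0//.
have F0 : \int[leb]_t dX t = 0.
  have Xl : X (l - 1) = 0 by apply: X0 => /andP[+ _]; rewrite leNgt ltrBlDr ltrDl ltr01.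
  have := FT (l - 1); rewrite Xl oppr0 => <-.
  rewrite [RHS]int_indic; apply: eq_Rintegral => x _; rewrite !indicE.
  have [h|h] := pselect (l <= x <= r); last by rewrite dX0// !mul0r.
  rewrite mem_set ?mulr1//= in_itv/= andbT; move/andP : h => [h _].
  by rewrite (le_trans _ h)// gerBl.
pose G (z : R * R) := g z.1 * dX z.2 * (z.1 <= z.2)%R%:R.
have GI : Int2 G.
  apply: (@Int2_le _ _ (fun z => g z.1 * dX z.2)); last exact: Int2M.
  - apply: measurable_funM; last exact: measurable_le2.
    by apply: measurable_funM; apply: measurableT_comp.
  - by move=> z; rewrite /G; case: (z.1 <= z.2)%R; rewrite ?mulr1n ?mulr0n ?mulr1 ?mulr0 ?normr0 ?lexx ?normr_ge0.
have Xi : Int1 X.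
  apply: (@continuous_cpt_Int1 _ l r) => // x.
  by apply: differentiable_continuous; apply/derivable1_diffP; have [] := dXX x.
have GE t x : G (t, x) = g t * dX x * \1_`]-oo, x] t.
  by rewrite /G/= indicE mem_setE /= in_itv.
have GE' t x : G (t, x) = g t * (dX x * \1_`[t, +oo[ x).
  by rewrite /G/= indicE mem_setE /= in_itv/= andbT mulrA.
have Q1 t : \int[leb]_x G (t, x) = -1 * (g t * X t).
  under eq_Rintegral do rewrite GE'.
  rewrite RintegralZl//; last exact: Int_indicM.
  by rewrite -int_indic FT; ring.
have Q2 x : \int[leb]_t G (t, x) = (\int[leb]_(y in `]-oo, x]) g y) * dX x.
  under eq_Rintegral do rewrite GE mulrAC.
  by rewrite RintegralZr -?int_indic//; exact: Int_indicM.
have gXi : Int1 (fun t => g t * X t).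
  have := Int2_int1 GI; under eq_fun do rewrite Q1.
  by move=> /(Int1Z (-1)); under eq_fun do rewrite !mulN1r opprK.
have Idi : Int1 (fun x => (\int[leb]_(y in `]-oo, x]) g y) * dX x).
  by have := Int2_int2 GI; under eq_fun do rewrite Q2.
under eq_Rintegral do rewrite mulrDl.
rewrite RintegralD//; last exact: Int1Z.
rewrite RintegralZl// F0 mulr0 add0r.
under eq_Rintegral do rewrite -Q2.
rewrite -int2_int2// int2_int1//.
under eq_Rintegral do rewrite Q1.
by rewrite RintegralZl// mulN1r.
Qed.

End weak.

Section prim.
Context {R : realType}.
Notation leb := (@leb R).
Notation leb2 := (@leb2 R).
Notation Int1 f := (leb.-integrable setT (fun x => (f x)%:E)).
Notation Int2 f := (leb2.-integrable setT (fun x => (f x)%:E)).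

Definition prim (g : R -> R) (x : R) : R := \int[leb]_(y in `]-oo, x]) g y.

Lemma Int1_itv (g : R -> R) (i : interval R) : Int1 g -> leb.-integrable [set` i] (EFin \o g).
Proof. by move=> gi; apply: integrableS gi. Qed.

Lemma prim_itv (g : R -> R) (a b : R) : Int1 g -> a <= b ->
  prim g b - prim g a = \int[leb]_(x in `]a, b]) g x.
Proof. by move=> gi ab; apply: Rintegral_itvB => //; exact: Int1_itv. Qed.

Lemma prim_derive (g : R -> R) : Int1 g ->
  {ae leb, forall x, is_derive x (1 : R) (prim g) (g x)}.
Proof.
move=> gi.
have gl : locally_integrable [set: R] g.
  split; [exact: (Int1_measurable gi)|exact: openT|].
  move=> K _ cK; have mK : measurable (K : set (measurableTypeR R)) by exact: compact_measurable.
  by have /integrableP[_] := integrableS measurableT mK (@subsetT _ K) gi.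
have : {ae leb, forall x, derivable (prim g) x 1 /\ derive1 (prim g) x = g x}.
  exact: (FTC1Ny (fun y => Int1_itv _ gi) gl).
apply: aeS => x [h1 h2]; apply: DeriveDef => //.
by rewrite -derive1E.
Qed.

Lemma int_abs_cont (g : R -> R) (e : R) : Int1 g -> 0 < e ->
  exists2 d : R, 0 < d & forall A : set (measurableTypeR R), measurable A ->
    (leb A < d%:E)%E -> \int[leb]_(x in A) `|g x| < e.
Proof.
move=> gi e0; have [d [d0 H]] := integral_normr_continuous gi e0.
by exists d => // A mA lA; exact: H.
Qed.

Lemma prim_lip (g : R -> R) (a b : R) : Int1 g -> a <= b ->
  `|prim g b - prim g a| <= \int[leb]_(x in `]a, b]) `|g x|.
Proof. by move=> gi ab; rewrite prim_itv// le_normr_Rintegral//; exact: Int1_itv. Qed.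

Lemma leb_itvoc (a b : R) : a <= b -> leb `]a, b]%classic = (b - a)%:E.
Proof.
move=> ab; rewrite -[LHS]/(lebesgue_measure `]a, b]%classic) lebesgue_measure_itv/= lte_fin.
by case: ltgtP ab => // -> _; rewrite subrr.
Qed.

Lemma prim_continuous (g : R -> R) : Int1 g -> continuous (prim g).
Proof.
move=> gi x; apply/cvgrPdist_lt => e e0.
have [d d0 H] := int_abs_cont gi e0.
near=> y.
have yx : `|x - y| < d by near: y; exact: cvgr_dist_lt.
have [h|/ltW h] := leP x y.
  rewrite distrC; apply: le_lt_trans (prim_lip gi h) _; apply: H => //.
  by rewrite leb_itvoc// lte_fin (le_lt_trans _ yx)// distrC ler_norm.
apply: le_lt_trans (prim_lip gi h) _; apply: H => //.
by rewrite leb_itvoc// lte_fin (le_lt_trans _ yx)// ler_norm.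
Unshelve. all: by end_near. Qed.

Lemma ae0_of_rat_itv (h : R -> R) : Int1 h ->
  (forall a b : rat, ratr a < ratr b :> R -> \int[leb]_x (h x * \1_`]ratr a, ratr b[ x) = 0) ->
  {ae leb, forall x, h x = 0}.
Proof.
move=> hi h0.
have pq (a b : rat) : ratr a < ratr b :> R -> prim h (ratr b) = prim h (ratr a).
  move=> ab; apply/eqP; rewrite -subr_eq0 prim_itv ?ltW//.
  rewrite -Rintegral_itv_bndo_bndc; first by rewrite int_indic h0.
  exact: Int1_itv.
have pc (x : R) : prim h x = prim h 0.
  have [//|/eqP ne] := pselect (prim h x = prim h 0).
  have n0 : 0 < `|prim h 0 - prim h x| by rewrite normr_gt0 subr_eq0 eq_sym.
  have /cvgrPdist_lt/(_ _ n0) [e /= e0 He] := prim_continuous hi (x := x).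
  have [q] := rat_in_itvoo (ltac:(by rewrite ltrDl) : x < x + e).
  rewrite in_itv/= => /andP[q1 q2].
  have := He (ratr q); rewrite /ball_/= ltr_distlC => /(_ (ltac:(lra))).
  suff -> : prim h (ratr q) = prim h 0 by rewrite distrC ltxx.
  have [q0|q0|q0] := ltgtP (ratr q : R) 0.
  - by have := @pq q 0; rewrite raddf0 => ->.
  - by have := @pq 0 q; rewrite raddf0 => ->.
  - by rewrite q0.
have := prim_derive hi; apply: aeS => x [_ <-].
rewrite (_ : prim h = cst (prim h 0)) ?derive_cst//.
by apply/funext => y; rewrite pc.
Qed.

Lemma ae_count (T : countType) dsp (U : measurableType dsp) (m : {measure set U -> \bar R}) (P : T -> U -> Prop) :
  (forall q, {ae m, forall x, P q x}) -> {ae m, forall x, forall q, P q x}.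
Proof.
move=> H.
have : {ae m, forall x, forall n : nat, if unpickle n is Some q then P q x else True}.
  apply: ae_foralln => n; case: unpickle => [q|]; [exact: H|exact: aeW].
by apply: filterS => x hx q; have := hx (pickle q); rewrite pickleK.
Qed.

Lemma int2_slicem (h : R * R -> R) (D E : set (measurableTypeR R)) : measurable D -> measurable E ->
  Int2 h -> Int2 (fun z => h z * \1_D z.1 * \1_E z.2).
Proof.
move=> mD mE hi; apply: (@Int2_bddM _ _ _ 1); last first.
- apply: (@Int2_bddM _ _ _ 1) => //; first by apply: measurableT_comp => //; exact: measurable_indic.
  by move=> z; rewrite indicE; case: (_ \in _); rewrite ?normr1 ?normr0 ?lexx ?ler01.
- by move=> z; rewrite indicE; case: (_ \in _); rewrite ?normr1 ?normr0 ?lexx ?ler01.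
- by apply: measurableT_comp => //; exact: measurable_indic.
Qed.

Lemma indic01 T (D : set T) (x : T) : \1_D x = 0 :> R \/ \1_D x = 1 :> R.
Proof. by rewrite indicE; case: (_ \in _); [right|left]. Qed.

Lemma int_mul01 (f : R -> R) (c : R) : c = 0 \/ c = 1 ->
  \int[leb]_x (f x * c) = (\int[leb]_x f x) * c.
Proof.
case=> ->; last by rewrite mulr1; under eq_Rintegral do rewrite mulr1.
by rewrite mulr0; under eq_Rintegral do rewrite mulr0; rewrite Rintegral_cst// mul0r.
Qed.

Lemma ae0_of_rect (h : R * R -> R) : Int2 h ->
  (forall t1 t2 e1 e2 : R, \int[leb2]_z (h z * \1_`]t1, t2[ z.1 * \1_`]e1, e2[ z.2) = 0) ->
  {ae leb2, forall z, h z = 0}.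
Proof.
move=> hi h0.
have mh := Int2_measurable hi.
have gz (q : rat * rat) : {ae leb, forall x, \int[leb]_t (h (t, x) * \1_`]ratr q.1, ratr q.2[ t) = 0}.
  have hqi : Int2 (fun z => h z * \1_(`]ratr q.1, ratr q.2[) z.1).
    have := int2_slicem (measurable_itv `]ratr q.1, ratr q.2[) measurableT hi.
    by under eq_fun do rewrite indicT mulr1.
  apply: ae0_of_rat_itv; first exact: (Int2_int2 hqi).
  move=> a b ab; rewrite -[RHS](h0 (ratr q.1) (ratr q.2) (ratr a) (ratr b)).
  rewrite int2_int2; last exact: int2_slicem.
  apply: eq_Rintegral => x _.
  rewrite /=; by apply/esym; apply: (int_mul01 (fun t => h (t, x) * \1_`]ratr q.1, ratr q.2[ t)); exact: indic01.
have {}gz := ae_count gz.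
apply: leb2_ae_slices2.
  by have := mh measurableT [set 0] (measurable_set1 0); rewrite setTI.
have := Int2_slice2 hi.
apply: aeS2 gz => x hx hxi.
by apply: ae0_of_rat_itv => // a b ab; exact: (hx (a, b)).
Qed.

End prim.

Section weak2.
Context {R : realType}.
Notation leb := (@leb R).
Notation leb2 := (@leb2 R).
Notation Int1 f := (leb.-integrable setT (fun x => (f x)%:E)).
Notation Int2 f := (leb2.-integrable setT (fun x => (f x)%:E)).

Lemma plat_le m (y : R) : `|plat m.+1 y| <= m.+1`!%:R.
Proof.
rewrite /plat; case: ifP => y0; last by rewrite normr0 ler0n.
rewrite ger0_norm; last by rewrite mulr_ge0 ?expR_ge0 ?invr_ge0 ?exprn_ge0 ?ltW.
have yV0 : 0 <= y^-1 by rewrite invr_ge0 ltW.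
have := expR_ge1Dxn m yV0 => h.
have f0 : 0 < m.+1`!%:R :> R by rewrite ltr0n fact_gt0.
have : y^-1 ^+ m.+1 / m.+1`!%:R <= expR y^-1 by apply: le_trans h; rewrite lerDr.
by rewrite ler_pdivrMr// exprVn expRN ler_pdivrMr ?expR_gt0// mulrC.
Qed.

Lemma dbump_le (l r : R) k (y : R) : `|dbump l r k y| <= k.+1%:R * 4.
Proof.
rewrite /dbump normrM ger0_norm ?ler0n// ler_wpM2l//.
have b (z w : R) : `|plat 2 z * plat 0 w| <= 2.
  rewrite normrM -[leRHS]mulr1 ler_pM//; first exact: (plat_le 1).
  by rewrite ger0_norm ?plat0_ge0 ?plat0_le1.
apply: le_trans (ler_normB _ _) _.
by rewrite (_ : 4 = 2 + 2 :> R) ?lerD ?b// 1?mulrC ?b//; ring.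
Qed.

Lemma bump_norm_le (l r : R) k (y : R) : `|bump l r k y| <= 1.
Proof. by rewrite ger0_norm ?bump_ge0 ?bump_le1. Qed.

Definition quad (N : nat) : set (R * R) := `[0, N%:R] `*` `[- N%:R, N%:R].

Definition locint (f : R * R -> R) := forall N : nat, Int2 (fun z => f z * \1_(quad N) z).

Lemma measurable_quad N : measurable (quad N : set (measurableTypeR R * measurableTypeR R)).
Proof. exact: measurableX. Qed.

Lemma quad_in N (z : R * R) : quad N z <-> [/\ 0 <= z.1, z.1 <= N%:R & `|z.2| <= N%:R].
Proof.
rewrite /quad/= !in_itv/= ler_norml; split; first by move=> [/andP[? ?] ?].
by move=> [-> -> ->].
Qed.

Lemma locintB (f g : R * R -> R) : locint f -> locint g -> locint (fun z => f z - g z).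
Proof.
move=> fi gi N; have := Int2B (fi N) (gi N).
by under eq_fun do rewrite -mulrBl.
Qed.

Lemma locint_mul (f p : R * R -> R) (M : R) (N : nat) : locint f ->
  measurable_fun [set: measurableTypeR R * measurableTypeR R] p ->
  (forall z, `|p z| <= M) -> (forall z, ~ quad N z -> p z = 0) -> Int2 (fun z => f z * p z).
Proof.
move=> fi mp pM p0; have := Int2_bddM mp pM (fi N).
have E z : f z * \1_(quad N) z * p z = f z * p z; last by under eq_fun do rewrite E.
have [h|h] := pselect (quad N z); last by rewrite (p0 _ h) !mulr0.
by rewrite indicE mem_set// mulr1.
Qed.

Lemma bump_meas (l r : R) k : measurable_fun [set: measurableTypeR R] (bump l r k : R -> R).
Proof. exact: (continuous_measurable_fun (@bump_continuous R l r k)). Qed.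

Lemma dbump_meas (l r : R) k : measurable_fun [set: measurableTypeR R] (dbump l r k : R -> R).
Proof. exact: (continuous_measurable_fun (@dbump_continuous R l r k)). Qed.

Lemma ex_quad (t1 t2 e1 e2 : R) : exists N : nat, t2 <= N%:R /\ forall x, e1 < x < e2 -> `|x| <= N%:R.
Proof.
pose M := `|t2| + `|e1| + `|e2|.
have M0 : 0 <= M by rewrite /M !addr_ge0.
exists (Num.truncn M).+1; have MN : M <= (Num.truncn M).+1%:R by apply/ltW/truncnS_gt.
split; first by apply: le_trans MN; rewrite /M -addrA (le_trans (ler_norm t2))// lerDl addr_ge0.
move=> x /andP[x1 x2]; apply: le_trans MN; rewrite /M.
have := ler_norm (- e1); have := ler_norm e2; rewrite normrN => h1 h2.
have := normr_ge0 t2; have := normr_ge0 e1; have := normr_ge0 e2 => ? ? ?.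
by rewrite ler_norml; apply/andP; split; lra.
Qed.

Lemma quad_out (t1 t2 e1 e2 : R) N (z : R * R) : 0 < t1 -> t2 <= N%:R ->
  (forall x, e1 < x < e2 -> `|x| <= N%:R) ->
  ~ quad N z -> ~ (t1 < z.1 < t2) \/ ~ (e1 < z.2 < e2).
Proof.
move=> t10 tN eN zN; apply/not_andP => -[/andP[h1 h2] /eN h3]; apply: zN.
by apply/quad_in; split => //; apply/ltW; [exact: lt_trans h1|exact: lt_le_trans tN].
Qed.

Lemma dct2 (F : nat -> R * R -> R) (f g : R * R -> R) :
  (forall n, measurable_fun [set: measurableTypeR R * measurableTypeR R] (F n)) ->
  measurable_fun [set: measurableTypeR R * measurableTypeR R] f ->
  (forall z, F n z @[n --> \oo] --> f z) -> Int2 g -> (forall n z, `|F n z| <= g z) ->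
  \int[leb2]_z F n z @[n --> \oo] --> \int[leb2]_z f z.
Proof.
move=> mF mf Ff gi Fg.
have hc z : (F n z)%:E @[n --> \oo] --> (f z)%:E.
  by apply: cvg_EFin; [exact: nearW|exact: Ff].
have [] := @dominated_convergence _ _ R leb2 setT measurableT
  (fun n z => (F n z)%:E) (fun z => (f z)%:E) (fun z => (g z)%:E).
- by move=> n; exact/measurable_EFinP.
- exact/measurable_EFinP.
- by apply: aeW => z _; exact: hc.
- exact: gi.
- by apply: aeW => z n _; rewrite /= lee_fin.
move=> fi _ h.
rewrite /Rintegral; apply: fine_cvg; rewrite fineK//.
exact: integrable_fin_num.
Qed.

Lemma prim_le (g : R -> R) (x : R) : Int1 g -> `|prim g x| <= \int[leb]_y `|g y|.
Proof.
move=> gi; rewrite /prim int_indic.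
have gxi : Int1 (fun y => g y * \1_`]-oo, x] y) by exact: Int_indicM.
apply: le_trans (le_normr_Rintegral measurableT gxi) _.
apply: int_le; first exact: (integrable_abse gxi).
  exact: (integrable_abse gi).
apply: aeW => y; rewrite normrM; have [->|->] := @indic01 R _ `]-oo, x]%classic y.
  by rewrite normr0 mulr0.
by rewrite normr1 mulr1.
Qed.

Lemma Int1_primM (g p : R -> R) (W0 : R) : Int1 g -> Int1 p ->
  Int1 (fun x => (W0 + \int[leb]_(y in `]-oo, x]) g y) * p x).
Proof.
move=> gi pi; have h : Int1 (fun x => p x * (W0 + prim g x)).
  apply: (@Int1_bddM _ _ _ (`|W0| + \int[leb]_y `|g y|)) => //.
    apply: measurable_funD => //; exact: continuous_measurable_fun (prim_continuous gi).
  by move=> x; apply: le_trans (ler_normD _ _) _; rewrite lerD2l prim_le.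
by move: h; under eq_fun do rewrite mulrC.
Qed.

Lemma Int1_dbump (t1 t2 : R) k : Int1 (dbump t1 t2 k).
Proof.
apply: (@continuous_cpt_Int1 _ _ t1 t2); first exact: dbump_continuous.
by move=> t ht; rewrite dbump_out// => /andP[h1 h2]; apply: ht; rewrite !ltW.
Qed.

Lemma itv_indicM (a b c d x : R) :
  \1_`]a, b[ x * \1_`]c, d[ x = \1_`]Num.max a c, Num.min b d[ x :> R.
Proof.
rewrite !indicE !mem_setE /= !in_itv/= gt_max lt_min -natrM mulnb.
by congr (nat_of_bool _)%:R; rewrite andbACA.
Qed.

Lemma primitive_quad (A : R * R -> R) (T : R) x : 0 <= T ->
  Int1 (fun s => A (s, x) * \1_`[0, T] s) -> forall t, 0 <= t <= T ->
  \int[leb]_(s in `[0, t]) A (s, x) = \int[leb]_(y in `]-oo, t]) (A (y, x) * \1_`[0, T] y).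
Proof.
move=> T0 Ai t /andP[t0 tT]; rewrite [LHS]int_indic [RHS]int_indic.
apply: eq_Rintegral => s _; rewrite -mulrA; congr (_ * _).
rewrite !indicE !mem_setE /= !in_itv/= -natrM mulnb; congr (nat_of_bool _)%:R.
have [s0|s0] /= := leP 0 s; last by [].
have [st|st] := leP s t; rewrite ?andbF ?andbT//.
by rewrite (le_trans st tT).
Qed.

Lemma weak_to_ae (w c A : R * R -> R) (w0 : R -> R) :
  locint w -> locint c -> locint A ->
  (forall x T, 0 <= T -> Int1 (fun s => A (s, x) * \1_`[0, T] s) /\
     w (T, x) = w0 x + \int[leb]_(s in `[0, T]) A (s, x)) ->
  (forall t1 t2 e1 e2 k, 0 < t1 ->
     \int[leb2]_z (w z * (dbump t1 t2 k z.1 * bump e1 e2 k z.2)) =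
     - \int[leb2]_z (c z * (bump t1 t2 k z.1 * bump e1 e2 k z.2))) ->
  {ae leb2, forall z, 0 < z.1 -> c z = A z}.
Proof.
move=> wl cl Al hA hw.
have mbb t1 t2 e1 e2 k : measurable_fun [set: measurableTypeR R * measurableTypeR R]
    (fun z => bump t1 t2 k z.1 * bump e1 e2 k z.2 : R).
  by apply: measurable_funM; apply: measurableT_comp => //; exact: bump_meas.
have mdb t1 t2 e1 e2 k : measurable_fun [set: measurableTypeR R * measurableTypeR R]
    (fun z => dbump t1 t2 k z.1 * bump e1 e2 k z.2 : R).
  by apply: measurable_funM; apply: measurableT_comp => //; [exact: dbump_meas|exact: bump_meas].
have bb1 t1 t2 e1 e2 k (z : R * R) : `|bump t1 t2 k z.1 * bump e1 e2 k z.2| <= 1.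
  by rewrite normrM -(mulr1 1) ler_pM ?bump_norm_le.
have Ibb g t1 t2 e1 e2 k : 0 < t1 -> locint g ->
    Int2 (fun z => g z * (bump t1 t2 k z.1 * bump e1 e2 k z.2)).
  move=> t10 gl; have [N [tN eN]] := ex_quad t1 t2 e1 e2.
  apply: (@locint_mul g _ 1 N) => // z zN.
  by case: (quad_out t10 tN eN zN) => h; [rewrite bump_out// mul0r|rewrite [X in _ * X]bump_out// mulr0].
(* integrating the identity for w by parts along each line *)
have step1 t1 t2 e1 e2 k : 0 < t1 ->
    \int[leb2]_z (w z * (dbump t1 t2 k z.1 * bump e1 e2 k z.2)) =
    - \int[leb2]_z (A z * (bump t1 t2 k z.1 * bump e1 e2 k z.2)).
  move=> t10; have [N [tN eN]] := ex_quad t1 t2 e1 e2.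
  have wi : Int2 (fun z => w z * (dbump t1 t2 k z.1 * bump e1 e2 k z.2)).
    apply: (@locint_mul w _ (k.+1%:R * 4) N) => //.
      move=> z; rewrite normrM -[leRHS]mulr1 ler_pM//; [exact: dbump_le|exact: bump_norm_le].
    move=> z zN.
    by case: (quad_out t10 tN eN zN) => h; [rewrite dbump_out// mul0r|rewrite [X in _ * X]bump_out// mulr0].
  have Ai := Ibb A t1 t2 e1 e2 k t10 Al.
  rewrite int2_int2// int2_int2// -mulN1r -RintegralZl//; last exact: (Int2_int2 Ai).
  apply: eq_Rintegral => x _ /=.
  pose T := Num.max t2 0.
  have T0 : 0 <= T by rewrite le_max lexx orbT.
  have [AiT _] := hA x T T0.
  have E0 : \int[leb]_t (w (t, x) * (dbump t1 t2 k t * bump e1 e2 k x)) =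
     (\int[leb]_t ((w0 x + \int[leb]_(y in `]-oo, t]) (A (y, x) * \1_`[0, T] y)) * dbump t1 t2 k t)) * bump e1 e2 k x.
    rewrite -RintegralZr//; last by apply: Int1_primM => //; exact: Int1_dbump.
    apply: eq_Rintegral => t _; rewrite -mulrA.
    have [ht|ht] := pselect (t1 < t < t2); last by rewrite dbump_out// mul0r !mulr0.
    move: ht => /andP[ht1 ht2]; congr (_ * _).
    have t0 : 0 <= t by rewrite ltW// (lt_trans t10).
    have [_ ->] := hA x t t0; congr (_ + _).
    by apply: primitive_quad => //; rewrite t0 le_max ltW.
  rewrite {}E0 (ibp (l := t1) (r := t2) (w0 x) AiT (fun t => bump_derive t1 t2 k t))//; last 3 first.
  - exact: dbump_continuous.
  - by move=> t ht; rewrite bump_out// => /andP[h1 h2]; apply: ht; rewrite !ltW.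
  - by move=> t ht; rewrite dbump_out// => /andP[h1 h2]; apply: ht; rewrite !ltW.
  rewrite mulN1r mulNr -RintegralZr//; last first.
    by apply: (@Int1_bddM _ (fun s => A (s, x) * \1_`[0, T] s) (bump t1 t2 k) 1) => //;
      [exact: bump_meas|move=> y; exact: bump_norm_le].
  congr (- _); apply: eq_Rintegral => t _.
  have [ht|ht] := pselect (t1 < t < t2); last by rewrite bump_out// mul0r !mulr0 mul0r.
  rewrite mulrA; congr (_ * _ * _); move: ht => /andP[ht1 ht2].
  rewrite indicE mem_set ?mulr1//= in_itv/=; apply/andP; split.
    by rewrite ltW// (lt_trans t10).
  by rewrite le_max ltW.
pose h z := c z - A z.
have hl : locint h by exact: locintB.
have Ih g t1 t2 e1 e2 : 0 < t1 -> locint g -> Int2 (fun z => g z * (\1_`]t1, t2[ z.1 * \1_`]e1, e2[ z.2)).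
  move=> t10 gl; have [N [tN eN]] := ex_quad t1 t2 e1 e2.
  have := int2_slicem (measurable_itv `]t1, t2[) (measurable_itv `]e1, e2[) (gl N).
  have E z : g z * \1_(quad N) z * \1_`]t1, t2[ z.1 * \1_`]e1, e2[ z.2 = g z * (\1_`]t1, t2[ z.1 * \1_`]e1, e2[ z.2).
    have [zN|zN] := pselect (quad N z); first by rewrite [in \1_(quad N) z]indicE mem_set// mulr1 mulrA.
    rewrite -!mulrA; congr (_ * _).
    case: (quad_out t10 tN eN zN) => H.
      by rewrite (_ : \1_`]t1, t2[ z.1 = 0) ?mul0r ?mulr0// indicE memNset//= in_itv.
    by rewrite (_ : \1_`]e1, e2[ z.2 = 0) ?mulr0// indicE memNset//= in_itv.
  by under eq_fun do rewrite E.
have step2 t1 t2 e1 e2 : 0 < t1 ->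
    \int[leb2]_z (h z * (\1_`]t1, t2[ z.1 * \1_`]e1, e2[ z.2)) = 0.
  move=> t10; have [N [tN eN]] := ex_quad t1 t2 e1 e2.
  have z0 k : \int[leb2]_z (h z * (bump t1 t2 k z.1 * bump e1 e2 k z.2)) = 0.
    under eq_Rintegral do rewrite mulrBl.
    rewrite RintegralB//; [|exact: Ibb|exact: Ibb].
    by rewrite -[X in X - _]opprK -hw// step1// opprK subrr.
  have hNi := integrable_abse (hl N).
  have mh : measurable_fun [set: measurableTypeR R * measurableTypeR R]
      (fun z => h z * (\1_`]t1, t2[ z.1 * \1_`]e1, e2[ z.2)).
    exact: (Int2_measurable (Ih h t1 t2 e1 e2 t10 hl)).
  have cv z : h z * (bump t1 t2 k z.1 * bump e1 e2 k z.2) @[k --> \oo] -->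
      h z * (\1_`]t1, t2[ z.1 * \1_`]e1, e2[ z.2).
    by apply: cvgMr; apply: cvgM; exact: bump_cvg.
  have bd k z : `|h z * (bump t1 t2 k z.1 * bump e1 e2 k z.2)| <= `|h z * \1_(quad N) z|.
    have [zN|zN] := pselect (quad N z).
      rewrite indicE mem_set// mulr1 normrM -[leRHS]mulr1 ler_wpM2l//; exact: bb1.
    by case: (quad_out t10 tN eN zN) => H;
      [rewrite bump_out// mul0r|rewrite [X in _ * (_ * X)]bump_out// mulr0]; rewrite mulr0 normr0.
  have cvI := dct2 (fun k => Int2_measurable (Ibb h t1 t2 e1 e2 k t10 hl)) mh cv hNi bd.
  have cv0 : \int[leb2]_z (h z * (bump t1 t2 k z.1 * bump e1 e2 k z.2)) @[k --> \oo] --> (0 : R).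
    by under eq_fun do rewrite z0; exact: cvg_cst.
  exact: (cvg_unique (@Rhausdorff R) cvI cv0).
have hN N : {ae leb2, forall z, h z * (\1_`](N.+1%:R)^-1, N%:R[ z.1 * \1_`]- N%:R, N%:R[ z.2) = 0}.
  have N0 : 0 < (N.+1%:R)^-1 :> R by rewrite invr_gt0 ltr0n.
  apply: ae0_of_rect; first exact: Ih.
  move=> t1 t2 e1 e2.
  have := step2 (Num.max (N.+1%:R)^-1 t1) (Num.min N%:R t2) (Num.max (- N%:R) e1) (Num.min N%:R e2).
  rewrite lt_max N0 => /(_ isT) H; rewrite -[RHS]H; apply: eq_Rintegral => z _.
  by rewrite -!itv_indicM; ring.
have {}hN := ae_foralln hN.
apply: ae2S hN => z hz z0.
pose N := (Num.truncn ((z.1)^-1 + z.1 + `|z.2|)).+1.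
have hN : (z.1)^-1 + z.1 + `|z.2| < N%:R by exact: truncnS_gt.
have i0 : 0 < (z.1)^-1 by rewrite invr_gt0.
have a0 := normr_ge0 z.2.
have := hz N; rewrite !indicE !mem_set ?mulr1 /=; last 2 first.
- by rewrite in_itv/= -ltr_norml; lra.
- rewrite in_itv/=; apply/andP; split; last by lra.
  rewrite -[ltRHS]invrK ltf_pV2 ?posrE ?ltr0n//.
  have : N%:R <= N.+1%:R :> R by rewrite ler_nat.
  by lra.
by move=> /eqP; rewrite subr_eq0 => /eqP.
Qed.

End weak2.

Section ac.
Context {R : realType}.
Notation leb := (@leb R).
Notation leb2 := (@leb2 R).
Notation Int1 f := (leb.-integrable setT (fun x => (f x)%:E)).
Notation Int2 f := (leb2.-integrable setT (fun x => (f x)%:E)).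

Definition abs_cont (h : R -> R) : Prop :=
  forall a b : R, a <= b -> forall e : R, 0 < e ->
  exists2 dl : R, 0 < dl &
    forall (m : nat) (l r : 'I_m -> R),
      (forall k, a <= l k /\ l k <= r k /\ r k <= b) ->
      trivIset setT (fun k => `]l k, r k[%classic) ->
      \sum_(k < m) (r k - l k) < dl ->
      \sum_(k < m) `|h (r k) - h (l k)| < e.

Lemma leb_itvoo (a b : R) : a <= b -> leb `]a, b[%classic = (b - a)%:E.
Proof.
move=> ab; rewrite -[LHS]/(lebesgue_measure `]a, b[%classic) lebesgue_measure_itv/= lte_fin.
by case: ltgtP ab => // -> _; rewrite subrr.
Qed.

Lemma leb_bigU m (l r : 'I_m -> R) : (forall k, l k <= r k) ->
  trivIset setT (fun k => `]l k, r k[%classic) ->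
  leb (\big[setU/set0]_(k < m) `]l k, r k[%classic) = (\sum_(k < m) (r k - l k))%:E.
Proof.
move=> lr tF; rewrite measure_bigsetU_ord//.
by rewrite -sumEFin; apply: eq_bigr => k _; exact: leb_itvoo.
Qed.

Lemma prim_abs_cont (g : R -> R) : Int1 g -> abs_cont (prim g).
Proof.
move=> gi a b ab e e0; have [d d0 H] := int_abs_cont gi e0.
exists d => // m l r lr tF sd.
have lr' k : l k <= r k by have [_ []] := lr k.
pose F k : set (measurableTypeR R) := `]l k, r k[%classic.
have mU : measurable (\big[setU/set0]_(k < m) F k : set (measurableTypeR R)).
  by apply: bigsetU_measurable => k _; exact: measurable_itv.
have gai : Int1 (fun x => `|g x|) by exact: (integrable_abse gi).
apply: le_lt_trans (H _ mU _); last by rewrite leb_bigU// lte_fin.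
rewrite -lee_fin /Rintegral fineK; last first.
  by apply: integrable_fin_num => //; exact: integrableS gai.
rewrite ge0_integral_bigsetU//; last 4 first.
- by move=> k; exact: measurable_itv.
- exact: index_enum_uniq.
- by apply: sub_trivIset tF.
- by have /measurable_int := gai; apply: measurable_funS.
rewrite -sumEFin; apply: lee_sum => k _.
rewrite -[leRHS]fineK; last first.
  apply: integrable_fin_num => //; first exact: measurable_itv.
  by apply: integrableS gai => //; exact: measurable_itv.
rewrite lee_fin; apply: le_trans (prim_lip gi (lr' k)) _.
by rewrite -Rintegral_itv_bndo_bndc//; exact: Int1_itv.
Qed.

Section zero_derivative.
Variables (h : R -> R) (N U : set (measurableTypeR R)) (a b ep : R).
Hypotheses (oU : open (U : set R)) (NU : N `<=` U).
Hypothesis hN : forall x : R, ~ N x -> is_derive x (1 : R) h 0.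
Hypothesis ep0 : 0 < ep.

Definition chain (x : R) := exists (m : nat) (l r : nat -> R),
  [/\ forall k, (k < m)%N -> [/\ a <= l k, l k <= r k, r k <= x & `]l k, r k[ `<=` U],
      forall i j, (i < j < m)%N -> r i <= l j &
      `|h x - h a| <= ep * (x - a) + \sum_(k < m) `|h (r k) - h (l k)| ].

Lemma chain_start : chain a.
Proof.
by exists 0%N, (fun=> 0), (fun=> 0); split => //; rewrite !subrr normr0 mulr0 big_ord0 addr0.
Qed.

Lemma chain_step y z : a <= y -> y <= z ->
  `|h z - h y| <= ep * (z - y) \/ `]y, z[ `<=` U -> chain y -> chain z.
Proof.
move=> ay yz H [m [l [r [h1 h2 h3]]]].
have tri : `|h z - h a| <= `|h z - h y| + `|h y - h a|.
  by rewrite (_ : h z - h a = (h z - h y) + (h y - h a)) ?ler_normD//; ring.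
case: H => [H|H].
  exists m, l, r; split => // [k km|].
    by have [? ? ? ?] := h1 k km; split => //; exact: le_trans yz.
  apply: le_trans tri _; apply: le_trans (lerD H h3) _.
  by rewrite addrA -mulrDr; rewrite (_ : z - y + (y - a) = z - a)//; ring.
exists m.+1, (fun k => if (k < m)%N then l k else y), (fun k => if (k < m)%N then r k else z).
split => [k|i j|].
- rewrite ltnS leq_eqVlt => /orP[/eqP ->|km]; first by rewrite ltnn; split.
  by rewrite km; have [? ? ? ?] := h1 k km; split => //; exact: le_trans yz.
- move=> /andP[ij]; rewrite ltnS leq_eqVlt => /orP[/eqP jm|jm].
    by rewrite jm ltnn -jm ij; have [_ _ ? _] := h1 i (ltac:(by rewrite -jm)).
  by rewrite jm (ltn_trans ij jm); apply: h2; rewrite ij.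
rewrite big_ord_recr/= ltnn.
rewrite (eq_bigr (fun k : 'I_m => `|h (r k) - h (l k)|)); last by move=> k _; rewrite ltn_ord.
rewrite addrA [leRHS]addrC; apply: le_trans tri _; rewrite lerD2l; apply: le_trans h3 _.
by apply: lerD => //; apply: ler_wpM2l; [exact: ltW|exact: lerB].
Qed.

Lemma chain_end : a <= b -> chain b.
Proof.
move=> ab; pose S := [set x | a <= x <= b /\ chain x].
have Sa : S a by split; [rewrite lexx|exact: chain_start].
have hS : has_sup S by split; [exists a|exists b => x [/andP[]]].
pose s := sup S.
have sb : s <= b by apply: ge_sup; [exists a|move=> x [/andP[]]].
have as_ : a <= s by apply: ub_le_sup => //; exact: hS.2.
have [rho rho0 loc] : exists2 rho, 0 < rho & forall y z, s - rho < y -> y <= s -> s <= z -> z < s + rho ->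
    `|h z - h y| <= ep * (z - y) \/ `]y, z[ `<=` U.
  have [sN|sN] := pselect (N s).
    have /oU [rho /= rho0 H] := NU sN.
    exists rho => // y z y1 y2 z1 z2; right => w /=; rewrite in_itv/= => /andP[w1 w2].
    by apply: H; rewrite /ball_/= ltr_distlC; apply/andP; split; lra.
  have [hd hv] := hN sN.
  have cvd : t^-1 *: (h (t *: 1 + s) - h s) @[t --> (0:R)^'] --> (0 : R).
    by rewrite -[X in _ --> X]hv; exact: hd.
  have := cvd; move=> /cvgr0Pnorm_le /(_ _ ep0) [rho /= rho0 H].
  have loc w : `|w - s| < rho -> `|h w - h s| <= ep * `|w - s|.
    move=> ws; have [->|ne] := eqVneq w s; first by rewrite !subrr normr0 mulr0.
    have d0 : w - s != 0 by rewrite subr_eq0.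
    have := H (w - s); rewrite /ball_/= sub0r normrN => /(_ ws d0).
    rewrite /GRing.scale/= mulr1 subrK normrM normfV mulrC ler_pdivrMr// normr_gt0//.
  exists rho => // y z y1 y2 z1 z2; left.
  have -> : h z - h y = (h z - h s) - (h y - h s) by ring.
  apply: le_trans (ler_normB _ _) _.
  have -> : ep * (z - y) = ep * (z - s) + ep * (s - y) by ring.
  apply: lerD.
    have := loc z; rewrite (ger0_norm (_ : 0 <= z - s)) ?subr_ge0//.
    by apply; lra.
  have := loc y; rewrite [`|y - s|]distrC (ger0_norm (_ : 0 <= s - y)) ?subr_ge0//.
  by apply; lra.
have [y [/andP[y0 y1] cy] y2] := sup_adherent rho0 hS.
have ys : y <= s by apply: ub_le_sup => //; [exact: hS.2|split => //; exact/andP].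
pose z := Num.min b (s + rho / 2).
have sz : s <= z by rewrite le_min sb lerDl divr_ge0// ltW.
have cz : chain z.
  apply: (@chain_step y) => //; first exact: le_trans sz.
  apply: (loc y z y2 ys sz); rewrite gt_min; apply/orP; right.
  by rewrite ltrD2l ltr_pdivrMr// ltr_pMr// ltr1n.
have zs : z <= s.
  apply: ub_le_sup; first exact: hS.2.
  by split => //; rewrite (le_trans as_ sz) ge_min lexx.
move: zs; rewrite /z ge_min => /orP[bs|]; last by rewrite gerDl leNgt divr_gt0.
suff <- : z = b by [].
by apply/eqP; rewrite eq_le ge_min lexx/= (le_trans bs).
Qed.

End zero_derivative.

Lemma zero_derivative_const (h : R -> R) : abs_cont h ->
  {ae leb, forall x : R, is_derive x (1 : R) h 0} -> forall a b, a <= b -> h b = h a.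
Proof.
move=> ac [N [mN N0 hN]] a b ab.
have hN' x : ~ N x -> is_derive x (1 : R) h 0.
  by move=> xN; apply: contrapT => hx; apply: xN; exact: hN.
apply/eqP; rewrite -subr_eq0 -normr_le0; apply/ler_addgt0Pr => e e0; rewrite add0r.
pose ep := e / 2 / (b - a + 1).
have ba : 0 < b - a + 1 by rewrite ltr_wpDl// subr_ge0.
have ep0 : 0 < ep by rewrite divr_gt0// divr_gt0.
have e20 : 0 < e / 2 by rewrite divr_gt0.
have [d d0 H] := ac a b ab _ e20.
have [U [oU NU UN]] := lebesgue_regularity_outer mN (ltac:(by rewrite [X in (X < _)%E]N0) : (lebesgue_measure N < +oo)%E) d0.
have mU : measurable (U : set (measurableTypeR R)) by exact: open_measurable.
have lU : (leb U < d%:E)%E.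
  have -> : U = (U `\` N) `|` N by rewrite setUC setDUK.
  apply: le_lt_trans (measureU2 _ _ _) _ => //; first exact: measurableD.
  by rewrite [X in (_ + X < _)%E]N0 adde0.
have [m [l [r [h1 h2 h3]]]] := chain_end oU NU hN' ep0 ab.
pose L (k : 'I_m) := l k; pose Q (k : 'I_m) := r k.
have tF : trivIset setT (fun k => `]L k, Q k[%classic).
  move=> i j _ _ [x [/=]]; rewrite !in_itv/= => /andP[i1 i2] /andP[j1 j2].
  apply/val_inj; have [ij|ji|//] := ltngtP (val i) (val j).
    by have := h2 i j; rewrite ij ltn_ord => /(_ isT) hh; exfalso; move: hh i2 j1; rewrite /L /Q; lra.
  by have := h2 j i; rewrite ji ltn_ord => /(_ isT) hh; exfalso; move: hh j2 i1; rewrite /L /Q; lra.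
have lQ k : L k <= Q k by have [] := h1 k (ltn_ord k).
have : \sum_(k < m) `|h (Q k) - h (L k)| < e / 2.
  apply: H => //; first by move=> k; have [? ? ? _] := h1 k (ltn_ord k).
  rewrite -lte_fin -leb_bigU//; apply: le_lt_trans lU; apply: le_measure; rewrite ?inE//.
    by apply: bigsetU_measurable => k _; exact: measurable_itv.
  by elim/big_ind: _ => // [X Y XU YU x [/XU|/YU]//|k _]; have [_ _ _] := h1 k (ltn_ord k).
move=> hs; apply: le_trans h3 _; apply: le_trans (lerD (lexx _) (ltW hs)) _.
have : ep * (b - a) <= e / 2.
  by rewrite /ep -mulrA ler_piMr ?(ltW e20)// [leLHS]mulrC ler_pdivrMr// mul1r lerDl ler01.
by lra.
Qed.

Lemma abs_contB (f g : R -> R) : abs_cont f -> abs_cont g -> abs_cont (fun x => f x - g x).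
Proof.
move=> hf hg a b ab e e0; have e20 : 0 < e / 2 by rewrite divr_gt0.
have [d1 d10 H1] := hf a b ab _ e20; have [d2 d20 H2] := hg a b ab _ e20.
exists (Num.min d1 d2); first by rewrite lt_min d10.
move=> m l r lr tF; rewrite lt_min => /andP[s1 s2].
have := H1 m l r lr tF s1; have := H2 m l r lr tF s2 => h2 h1.
apply: (@le_lt_trans _ _ (\sum_(k < m) `|f (r k) - f (l k)| + \sum_(k < m) `|g (r k) - g (l k)|)); last by lra.
rewrite -big_split/=; apply: ler_sum => k _.
rewrite (_ : f (r k) - g (r k) - _ = (f (r k) - f (l k)) - (g (r k) - g (l k))); last by ring.
exact: ler_normB.
Qed.

Theorem abs_cont_FTC (f Df : R -> R) : abs_cont f -> Int1 Df ->
  {ae leb, forall x : R, is_derive x (1 : R) f (Df x)} ->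
  forall x, f x = f 0 - prim Df 0 + prim Df x.
Proof.
move=> acf Di hd x.
have ac : abs_cont (fun x => f x - prim Df x) by apply: abs_contB => //; exact: prim_abs_cont.
have := zero_derivative_const ac.
have h0 : {ae leb, forall x : R, is_derive x (1 : R) (fun x => f x - prim Df x) 0}.
  apply: aeS2 hd (prim_derive Di) => y h1 h2.
  by have := is_deriveB h1 h2; rewrite subrr.
move=> /(_ h0) H.
have E : f x - prim Df x = f 0 - prim Df 0.
  by have [/H ->|/ltW/H ->] := leP 0 x.
by rewrite -E subrK.
Qed.

End ac.

Section mild.
Context {R : realType}.
Notation leb := (@leb R).
Notation leb2 := (@leb2 R).
Notation Int1 f := (leb.-integrable setT (fun x => (f x)%:E)).
Notation Int2 f := (leb2.-integrable setT (fun x => (f x)%:E)).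

Lemma measurable_triangle (t x : R) :
  measurable (backward_triangle t x : set (measurableTypeR R * measurableTypeR R)).
Proof.
rewrite (_ : backward_triangle t x = [set w | (0 <= w.1) && (w.1 <= t) && ((x - t + w.1 <= w.2) && (w.2 <= x + t - w.1))]).
  rewrite -[X in measurable X]setTI.
  have m1 : measurable_fun [set: measurableTypeR R * measurableTypeR R] (fun w => w.1 : R) by exact: measurable_fst.
  have m2 : measurable_fun [set: measurableTypeR R * measurableTypeR R] (fun w => w.2 : R) by exact: measurable_snd.
  have mc (k : R) : measurable_fun [set: measurableTypeR R * measurableTypeR R] (fun w => k) by exact: measurable_cst.
  apply: (@measurable_and _ _ setT
    (fun w : measurableTypeR R * measurableTypeR R => (0 <= w.1) && (w.1 <= t))
    (fun w => (x - t + w.1 <= w.2) && (w.2 <= x + t - w.1)) _ _ measurableT [set true]) => //.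
    by apply: measurable_and; apply: measurable_fun_ler.
  apply: measurable_and; apply: measurable_fun_ler => //; first exact: measurable_funD.
  exact: measurable_funB.
by apply/seteqP; split => z /=; [move=> [-> ->]|move=> /andP[]].
Qed.

Lemma triangleP (sg t x s y : R) : sg = 1 \/ sg = -1 ->
  \1_(backward_triangle t (x + sg * t)) (s, x + (2 * sg) * y - sg * s) =
  \1_`[0, t] y * \1_`[0, y] s :> R.
Proof.
move=> hsg; rewrite !indicE !mem_setE/= !in_itv/= -natrM mulnb; congr (nat_of_bool _)%:R.
apply/idP/idP.
  rewrite inE /backward_triangle/= => -[/andP[h1 h2] /andP[h3 h4]].
  by case: hsg h3 h4 => -> h3 h4; apply/andP; split; apply/andP; split; lra.
move=> /andP[/andP[h1 h2] /andP[h3 h4]]; rewrite inE /backward_triangle/=.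
by case: hsg => ->; split; apply/andP; split; lra.
Qed.

Lemma locint_shear (d : R) (f : R * R -> R) : locint f -> locint (fun z => f (aff2 1 d 0 z)).
Proof.
move=> fl N.
pose M := (N + (Num.truncn (`|d| * N%:R)).+1)%N.
have hM : `|d| * N%:R <= M%:R - N%:R.
  by rewrite /M natrD addrC addKr ltW// truncnS_gt.
have := Int_indicM (measurable_quad N) (Int2_aff2 d 0 (oner_neq0 R) (fl M)).
have E z : f (aff2 1 d 0 z) * \1_(quad M) (aff2 1 d 0 z) * \1_(quad N) z = f (aff2 1 d 0 z) * \1_(quad N) z.
  have [zN|zN] := pselect (quad N z); last by rewrite [\1_(quad N) z]indicE memNset// !mulr0.
  rewrite [in \1_(quad M) _]indicE mem_set ?mulr1//; apply/quad_in.
  move/quad_in : zN => [z0 z1 z2]; rewrite /aff2/= mul1r addr0.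
  have dz : `|d * z.1| <= `|d| * N%:R by rewrite normrM ler_wpM2l// ger0_norm.
  have dn : 0 <= `|d| * N%:R by rewrite mulr_ge0.
  split => //; first by lra.
  by apply: le_trans (ler_normD _ _) _; lra.
by under eq_fun do rewrite E.
Qed.

Lemma measurable_param dsp (T : measurableType dsp) (f : T * measurableTypeR R -> \bar R) :
  measurable_fun setT f -> measurable_fun setT (fun z => \int[leb]_y f (z, y))%E.
Proof.
move=> mf.
have -> : (fun z => \int[leb]_y f (z, y))%E =
  (fun z => (\int[leb]_y f^\+ (z, y)) - (\int[leb]_y f^\- (z, y)))%E.
  apply/funext => z; rewrite integralE; congr (_ - _)%E; apply: eq_integral => y _.
    by rewrite (funepos_comp f (fun y => (z, y))).
  by rewrite (funeneg_comp f (fun y => (z, y))).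
apply: emeasurable_funB.
  exact: (measurable_fun_fubini_tonelli_F (f^\+)%E (measurable_funepos mf) (funepos_ge0 f)).
exact: (measurable_fun_fubini_tonelli_F (f^\-)%E (measurable_funeneg mf) (funeneg_ge0 f)).
Qed.

Lemma ae_snd (Q : R -> Prop) : {ae leb, forall x, Q x} -> {ae leb2, forall z, Q z.2}.
Proof.
move=> [N [mN N0 QN]].
exists (setT `*` N); split.
- exact: measurableX.
- transitivity (@lebesgue_measure R setT * @lebesgue_measure R N)%E; last by rewrite [X in (_ * X)%E]N0 mule0.
  exact: product_measure1E.
- by move=> z hz; split => //; apply: QN.
Qed.

Lemma Int1_indic_itv (a b : R) : Int1 (\1_`[a, b] : R -> R).
Proof.
apply/integrableP; split.
  by apply/measurable_EFinP; apply: measurable_indic; exact: measurable_itv.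
under eq_integral do rewrite gee0_abs ?lee_fin//.
rewrite integral_indic// setIT.
rewrite -[X in (X < _)%E]/(lebesgue_measure `[a, b]%classic) lebesgue_measure_itv/=.
by case: ifP => _; rewrite -?EFinD ltry.
Qed.

Lemma locint_prim (H : R * R -> R) : locint H ->
  locint (fun z => \int[leb]_(s in `[0, z.1]) H (s, z.2)).
Proof.
move=> Hl N; pose G z := H z * \1_(quad N) z.
have GI : Int2 G by exact: Hl.
have mG := Int2_measurable GI.
pose f (p : (measurableTypeR R * measurableTypeR R) * measurableTypeR R) : R :=
  G (p.2, p.1.2) * (p.2 <= p.1.1)%R%:R.
have mf : measurable_fun setT f.
  apply: measurable_funM.
    apply: (measurableT_comp mG); apply/measurable_fun_pair => //=.
    exact: (measurableT_comp measurable_snd measurable_fst).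
  apply: measurable_pred; apply: measurable_fun_ler => //.
  exact: (measurableT_comp measurable_fst measurable_fst).
have mP : measurable_fun [set: measurableTypeR R * measurableTypeR R] (fun z => \int[leb]_s f (z, s)).
  have mfE : measurable_fun setT (fun p => (f p)%:E) by exact/measurable_EFinP.
  exact: (measurableT_comp _ (measurable_param mfE)).
have IG : Int1 (fun x => \int[leb]_s `|G (s, x)|).
  exact: (@Int2_int2 _ (fun z => `|G z|) (integrable_abse GI)).
have I1 : Int1 (\1_`[0, N%:R] : R -> R) by exact: Int1_indic_itv.
have E z : (\int[leb]_(s in `[0, z.1]) H (s, z.2)) * \1_(quad N) z = \int[leb]_s f (z, s) * \1_(quad N) z.
  have [zN|zN] := pselect (quad N z); last by rewrite indicE memNset// !mulr0.
  congr (_ * _); rewrite int_indic; apply: eq_Rintegral => s _.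
  rewrite /f/= /G -mulrA; congr (_ * _).
  move/quad_in : zN => [z0 z1 z2].
  rewrite !indicE -natrM mulnb mem_setE/= in_itv/=; congr (nat_of_bool _)%:R.
  apply/idP/idP => /andP[].
    by move=> s0 sz; rewrite sz andbT inE; apply/quad_in; split => //=; exact: le_trans sz z1.
  by rewrite inE => /quad_in[/= -> _ _ ->].
under eq_fun do rewrite E.
have b := Int2M I1 IG.
apply: Int2_le_ae b.
  by apply: measurable_funM => //; apply: measurable_indic; exact: measurable_quad.
have := ae_snd (Int2_slice2 GI); apply: ae2S => z hz.
have [zN|zN] := pselect (quad N z); last by rewrite [\1_(quad N) z]indicE memNset// mulr0 normr0.
move/quad_in : (zN) => [z0 z1 z2].
rewrite !indicE !mem_set//=; last by rewrite in_itv/= z0.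
rewrite mulr1 mul1r.
have fi : Int1 (fun s => f (z, s)).
  apply: (Int1_le _ _ hz).
    by apply: (measurableT_comp mf); exact: pair1_measurable.
  move=> s; rewrite /f/=; case: (s <= z.1)%R; rewrite ?mulr1n ?mulr0n ?mulr1 ?mulr0 ?normr0 ?lexx ?normr_ge0//.
apply: le_trans (le_normr_Rintegral measurableT fi) _.
apply: le_trans (ler_norm _); apply: int_le.
- exact: (integrable_abse fi).
- exact: (integrable_abse hz).
apply: aeW => s; rewrite /f/=; case: (s <= z.1)%R; rewrite ?mulr1n ?mulr0n ?mulr1 ?mulr0 ?normr0 ?lexx ?normr_ge0//.
Qed.

Lemma Int1_indicM (i : interval R) (f : R -> R) : Int1 f -> Int1 (fun x => f x * \1_([set` i]) x).
Proof. exact: Int_indicM. Qed.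

Lemma locint_snd (e : R -> R) : Int1 e -> locint (fun z => e z.2).
Proof.
move=> ei N.
have := Int2M (Int1_indic_itv 0 N%:R) (Int1_indicM `[- N%:R, N%:R] ei).
have E (z : R * R) : \1_`[0, N%:R] z.1 * (e z.2 * \1_`[- N%:R, N%:R] z.2) = e z.2 * \1_(quad N) z.
  rewrite mulrCA; congr (_ * _); rewrite !indicE -natrM mulnb; congr (nat_of_bool _)%:R.
  rewrite !mem_setE/= !in_itv/=; apply/idP/idP.
    by move=> /andP[/andP[? ?] ?]; rewrite inE; apply/quad_in; rewrite ler_norml; split.
  by rewrite inE => /quad_in[-> ->]; rewrite ler_norml.
by under eq_fun do rewrite E.
Qed.

Lemma locintD (f g : R * R -> R) : locint f -> locint g -> locint (fun z => f z + g z).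
Proof.
move=> fi gi N; have := Int2D (fi N) (gi N).
by under eq_fun do rewrite -mulrDl.
Qed.

Lemma locintZ (k : R) (f : R * R -> R) : locint f -> locint (fun z => k * f z).
Proof.
move=> fi N; have := Int2Z k (fi N).
by under eq_fun do rewrite mulrA.
Qed.

Definition charF (sg : R) (F : R * R -> R) (z : R * R) : R := F (aff2 1 (- sg) 0 z).

Definition charA (sg : R) (F : R * R -> R) (e : R -> R) (z : R * R) : R :=
  e z.2 + \int[leb]_(s in `[0, z.1]) charF sg F (s, z.2).

Lemma triangles_locint (F : R * R -> R) :
  (forall t x : R, 0 <= t -> leb2.-integrable (backward_triangle t x) (fun z => (F z)%:E)) -> locint F.
Proof.
move=> hF N.
apply/(Int_indic leb2 F (measurable_quad N)).
apply: integrableS (hF (2 * N%:R) 0 _); [exact: measurable_triangle|exact: measurable_quad| |].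
  move=> z /quad_in[z0 z1 z2]; move: z2; rewrite ler_norml => /andP[z2 z3].
  by split; apply/andP; split => //; lra.
by rewrite mulr_ge0.
Qed.

Lemma locint_charA (sg : R) (F : R * R -> R) (e : R -> R) : locint F -> Int1 e -> locint (charA sg F e).
Proof.
move=> Fl ei; apply: locintD; first exact: locint_snd.
by apply: locint_prim; exact: locint_shear.
Qed.

Lemma linear_line (sg k0 eta T : R) (D v0 : R -> R) : sg = 1 \/ sg = -1 -> 0 <= T -> Int1 D -> Int1 v0 ->
  let x := eta + sg * T in let u0 y := k0 + prim D y in
  2^-1 * (u0 (x + T) + u0 (x - T)) + 2^-1 * \int[leb]_(y in `[x - T, x + T]) v0 y =
  u0 eta + \int[leb]_s ((v0 (2 * sg * s + eta) + sg * D (2 * sg * s + eta)) * \1_`[0, T] s).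
Proof.
move=> hsg T0 Di vi x u0.
have xT : x - T <= x + T by lra.
have sg0 : 2 * sg != 0 by case: hsg => ->; lra.
have asg : `|2 * sg| = 2 by case: hsg => ->; rewrite ?mulr1 ?mulrN1 ?normrN ger0_norm.
have ei : Int1 (fun y => v0 y + sg * D y) by apply: Int1D => //; exact: Int1Z.
have E1 : u0 (x + T) + u0 (x - T) = 2 * u0 eta + sg * \int[leb]_(y in `[x - T, x + T]) D y.
  rewrite -Rintegral_itv_obnd_cbnd -?prim_itv//; last exact: Int1_itv.
  rewrite /u0 /x; case: hsg => ->.
    by rewrite mul1r addrK; ring.
  by rewrite mulN1r subrK; ring.
have E2 : \int[leb]_s ((v0 (2 * sg * s + eta) + sg * D (2 * sg * s + eta)) * \1_`[0, T] s) =
    2^-1 * \int[leb]_(y in `[x - T, x + T]) (v0 y + sg * D y).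
  rewrite [in RHS]int_indic (_ : 2^-1 = `|2 * sg|^-1 :> R); last by rewrite asg.
  rewrite -(integral_affine eta sg0); last exact: Int1_indicM.
  apply: eq_Rintegral => s _; congr (_ * _); rewrite !indicE !mem_setE/= !in_itv/=.
  congr (nat_of_bool _)%:R; rewrite /x; apply/idP/idP => /andP[h1 h2].
    by case: hsg => ->; apply/andP; split; lra.
  by case: hsg h1 h2 => -> h1 h2; apply/andP; split; lra.
rewrite E1 E2 RintegralD//; last 2 first.
- exact: Int1_itv.
- by apply: Int1_itv; exact: Int1Z.
rewrite RintegralZl//; last exact: Int1_itv.
by field.
Qed.

Lemma duhamel_line (sg eta T : R) (F : R * R -> R) : sg = 1 \/ sg = -1 -> 0 <= T ->
  let x := eta + sg * T in
  leb2.-integrable (backward_triangle T x) (fun z => (F z)%:E) ->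
  let p s := (\int[leb]_(r in `[0, s]) charF sg F (r, 2 * sg * s + eta)) * \1_`[0, T] s in
  Int1 p /\
  2^-1 * \int[leb]_(r in `[0, T]) \int[leb]_(y in `[x - T + r, x + T - r]) F (r, y) = \int[leb]_s p s.
Proof.
move=> hsg T0 x.
have sg0 : 2 * sg != 0 by case: hsg => ->; lra.
have asg : `|2 * sg| = 2 by case: hsg => ->; rewrite ?mulr1 ?mulrN1 ?normrN ger0_norm.
move=> /(Int_indic leb2 F (measurable_triangle T x)) FI p.
pose Ft z := F z * \1_(backward_triangle T x) z.
have FaI : Int2 (fun z => Ft (aff2 (2 * sg) (- sg) eta z)) by exact: Int2_aff2.
have Ep s : \int[leb]_r Ft (aff2 (2 * sg) (- sg) eta (r, s)) = p s.
  rewrite /p [in RHS]int_indic -int_mul01; last exact: indic01.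
  apply: eq_Rintegral => r _; rewrite /Ft /charF /aff2 /=.
  rewrite -[RHS]mulrA; congr (F (_, _) * _); first by ring.
  rewrite [in RHS]mulrC -(triangleP T eta r s hsg) /x; congr (\1_(_) (_, _)); ring.
split; first by have := Int2_int2 FaI; under eq_fun do rewrite Ep.
under [RHS]eq_Rintegral do rewrite -Ep.
rewrite -(int2_int2 FaI) (integral_aff2 _ _ sg0 FI) asg; congr (_ * _).
rewrite int2_int1// int_indic; apply: eq_Rintegral => r _.
rewrite int_indic -int_mul01; last exact: indic01.
apply: eq_Rintegral => y _; rewrite /Ft -mulrA; congr (_ * _).
rewrite !indicE -natrM mulnb !mem_setE/= !in_itv/=; congr (nat_of_bool _)%:R.
rewrite /backward_triangle; apply/idP/idP.
  by move=> /andP[/andP[? ?] /andP[? ?]]; rewrite inE/=; split; apply/andP; split.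
by rewrite inE/= => -[/andP[-> ->] /andP[-> ->]].
Qed.

End mild.

Section charae.
Context {R : realType}.
Notation leb := (@leb R).
Notation leb2 := (@leb2 R).
Notation Int1 f := (leb.-integrable setT (fun x => (f x)%:E)).
Notation Int2 f := (leb2.-integrable setT (fun x => (f x)%:E)).

Lemma continuous_measurable2 (f : R * R -> R) : continuous f ->
  measurable_fun [set: measurableTypeR R * measurableTypeR R] f.
Proof.
move=> cf; apply: (measurability _ (@RGenOpens.measurableE R)) => _ [_ [a [b -> <-]]].
rewrite setTI; apply: open_measurable2; apply: open_comp => //; exact: interval_open.
Qed.

Lemma measurable_halfplane : measurable (@halfplane R : set (measurableTypeR R * measurableTypeR R)).
Proof.
rewrite (_ : halfplane = fst @^-1` `[0, +oo[%classic); last first.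
  by apply/seteqP; split => z /=; rewrite in_itv/= andbT.
rewrite -[X in measurable X]setTI.
apply: (@measurable_fst _ _ (measurableTypeR R) (measurableTypeR R)) => //.
Qed.

Lemma within_continuous_measurable2 (w : R * R -> R) : {within @halfplane R, continuous w} ->
  measurable_fun [set: measurableTypeR R * measurableTypeR R] (fun z => w z * \1_halfplane z).
Proof.
move=> cw.
pose r (z : R * R) : R * R := (Num.max 0 z.1, z.2).
have cr : continuous r.
  move=> z; apply: (@cvg_pair _ _ _ _ (nbhs (Num.max 0 z.1)) (nbhs z.2)); last exact: cvg_snd.
  apply: (@continuous_comp _ _ _ fst (fun x : R => Num.max 0 x)); first exact: cvg_fst.
  by apply: continuous_max => //; exact: cvg_cst.
have cwr : continuous (w \o r).
  have /subspace_continuousP H := cw.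
  move=> z B /= hB; have rz : halfplane (r z) by rewrite /halfplane/= le_max lexx.
  have h1 : nbhs (r z) (fun y => halfplane y -> B (w y)) := H _ rz B hB.
  have h2 : nbhs z (fun x => halfplane (r x) -> B (w (r x))) := cr z _ h1.
  suff : nbhs z (fun x => B (w (r x))) by [].
  apply: filterS h2 => y /=.
  by apply; rewrite /halfplane/= le_max lexx.
have mh : measurable (@halfplane R : set (measurableTypeR R * measurableTypeR R)).
  exact: measurable_halfplane.
rewrite (_ : (fun z => _) = (fun z => (w \o r) z * \1_halfplane z)).
  by apply: measurable_funM; [exact: continuous_measurable2|exact: measurable_indic].
apply/funext => z; have [h|h] := pselect (halfplane z); last by rewrite indicE memNset// !mulr0.
congr (_ * _); rewrite /r/= max_r//; by case: (z).
Qed.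

Lemma within_locint (w : R * R -> R) : {within @halfplane R, continuous w} -> locint w.
Proof.
move=> cw N.
have sub : quad N `<=` @halfplane R by move=> z /quad_in[].
have cq : compact (@quad R N) by apply: compact_setX; exact: segment_compact.
have [M [_ HM]] : bounded_set (w @` quad N).
  apply: compact_bounded; apply: continuous_compact => //.
  exact: continuous_subspaceW cw.
have mw := within_continuous_measurable2 cw.
have I1 : Int2 (fun z : R * R => (`|M| + 1) * \1_(quad N) z).
  apply: Int2Z.
  apply: (@Int2_le _ _ (fun z => \1_`[0, N%:R] z.1 * \1_`[- N%:R, N%:R] z.2)).
  - by apply: measurable_indic; exact: measurable_quad.
  - move=> z; rewrite !indicE -natrM mulnb !mem_setE/= !in_itv/=.
    have [h|h] := pselect (quad N z); last by rewrite memNset// normr0.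
    by rewrite mem_set//; move/quad_in : h => [-> ->]; rewrite ler_norml => ->.
  - exact: Int2M (Int1_indic_itv _ _) (Int1_indic_itv _ _).
apply: Int2_le I1.
  rewrite (_ : (fun z => _) = (fun z => w z * \1_halfplane z * \1_(quad N) z)).
    by apply: measurable_funM => //; apply: measurable_indic; exact: measurable_quad.
  apply/funext => z; have [h|h] := pselect (quad N z); last by rewrite [in \1_(quad N) z]indicE memNset// !mulr0.
  by rewrite [\1_halfplane z]indicE mem_set ?mulr1//; exact: sub.
move=> z; have [h|h] := pselect (quad N z); last by rewrite [in \1_(quad N) z]indicE memNset// !mulr0.
rewrite indicE mem_set// !mulr1 (ger0_norm (_ : 0 <= `|M| + 1)) ?addr_ge0//.
have h1 : M < `|M| + 1 by rewrite (le_lt_trans (ler_norm _))// ltrDl.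
by apply: (HM _ h1 (w z)); exists z.
Qed.

Lemma shear_mul (sg M : R) (N : nat) (g p : R * R -> R) : locint g ->
  measurable_fun [set: measurableTypeR R * measurableTypeR R] p ->
  (forall z, `|p z| <= M) -> (forall z, ~ quad N z -> p z = 0) ->
  Int2 (fun z => g z * p (aff2 1 (- sg) 0 z)) /\
  \int[leb2]_z (g z * p (aff2 1 (- sg) 0 z)) = \int[leb2]_z (g (aff2 1 sg 0 z) * p z).
Proof.
move=> gl mp pM p0.
have K z : aff2 1 (- sg) 0 (aff2 1 sg 0 z) = z :> R * R.
  by case: z => t x; rewrite /aff2/=; congr pair; ring.
have h : Int2 (fun z => g (aff2 1 sg 0 z) * p (aff2 1 (- sg) 0 (aff2 1 sg 0 z))).
  under eq_fun do rewrite K.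
  by apply: (locint_mul (locint_shear sg gl) mp pM p0).
have h' := Int2_aff2V (f := fun z => g z * p (aff2 1 (- sg) 0 z)) (oner_neq0 R) h.
split=> //; have := integral_aff2 sg 0 (oner_neq0 R) h'.
by rewrite normr1 invr1 mul1r => <-; apply: eq_Rintegral => z _; rewrite K.
Qed.

Definition dalembert (k0 : R) (D v0 : R -> R) (F : R * R -> R) (t x : R) : R :=
  2^-1 * ((k0 + prim D (x + t)) + (k0 + prim D (x - t))) +
  2^-1 * \int[leb]_(y in `[x - t, x + t]) v0 y +
  2^-1 * \int[leb]_(r in `[0, t]) \int[leb]_(y in `[x - t + r, x + t - r]) F (r, y).

Section char.
Variables (sg k0 : R) (D v0 : R -> R) (F w : R * R -> R).
Hypotheses (hsg : sg = 1 \/ sg = -1) (Di : Int1 D) (vi : Int1 v0).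
Hypothesis hF : forall t x : R, 0 <= t ->
  leb2.-integrable (backward_triangle t x) (fun z => (F z)%:E).
Hypothesis hw : forall t x, 0 <= t -> w (t, x) = dalembert k0 D v0 F t x.
Let e y := v0 y + sg * D y.

Lemma mild_line eta T : 0 <= T ->
  Int1 (fun s => charA sg F e (s, 2 * sg * s + eta) * \1_`[0, T] s) /\
  w (T, eta + sg * T) = k0 + prim D eta + \int[leb]_(s in `[0, T]) charA sg F e (s, 2 * sg * s + eta).
Proof.
move=> T0.
have sg0 : 2 * sg != 0 by case: hsg => ->; lra.
have [pI pE] := duhamel_line hsg T0 (hF (eta + sg * T) T0).
have eI : Int1 (fun s => e (2 * sg * s + eta) * \1_`[0, T] s).
  by apply: Int1_indicM; apply: Int1_affine => //; apply: Int1D => //; exact: Int1Z.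
have cE s : charA sg F e (s, 2 * sg * s + eta) * \1_`[0, T] s =
    e (2 * sg * s + eta) * \1_`[0, T] s +
    (\int[leb]_(r in `[0, s]) charF sg F (r, 2 * sg * s + eta)) * \1_`[0, T] s.
  by rewrite /charA mulrDl.
split; first by under eq_fun do rewrite cE; exact: Int1D.
rewrite hw// /dalembert (linear_line k0 eta hsg T0 Di vi) pE [in RHS]int_indic.
under [in RHS]eq_Rintegral do rewrite cE.
by rewrite RintegralD// addrA.
Qed.

Variables (ct cx : R * R -> R).
Hypotheses (cw : {within @halfplane R, continuous w}) (ctl : locint ct) (cxl : locint cx).
Hypothesis hct : forall phi, test_function phi ->
  \int[leb2]_(z in halfplane) (w z * 'D_(1, 0) phi z) = - \int[leb2]_(z in halfplane) (ct z * phi z).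
Hypothesis hcx : forall phi, test_function phi ->
  \int[leb2]_(z in halfplane) (w z * 'D_(0, 1) phi z) = - \int[leb2]_(z in halfplane) (cx z * phi z).

Lemma char_ae : {ae leb2, forall z, 0 < z.1 ->
  ct (aff2 1 (- sg) 0 z) + sg * cx (aff2 1 (- sg) 0 z) = charA sg F e z}.
Proof.
pose S := aff2 1 sg 0 : R * R -> R * R.
have wl := within_locint cw.
have ei : Int1 e by apply: Int1D => //; exact: Int1Z.
have cl : locint (fun z => ct z + sg * cx z) by apply: locintD => //; exact: locintZ.
have main : {ae leb2, forall z, 0 < z.1 ->
    ct (S z) + sg * cx (S z) = charA sg F e (aff2 1 (2 * sg) 0 z)}.
  apply: (@weak_to_ae _ (fun z => w (S z)) (fun z => ct (S z) + sg * cx (S z))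
    (fun z => charA sg F e (aff2 1 (2 * sg) 0 z)) (fun x => k0 + prim D x)).
  - exact: locint_shear.
  - exact: (locint_shear sg cl).
  - by apply: locint_shear; apply: locint_charA => //; exact: triangles_locint.
  - move=> x T T0; have [h1 h2] := mild_line x T0.
    have E s : aff2 1 (2 * sg) 0 (s, x) = (s, 2 * sg * s + x) by rewrite /aff2/=; congr pair; ring.
    split; first by under eq_fun do rewrite E.
    rewrite {1}/S {1}/aff2/= (_ : 1 * x + sg * T + 0 = x + sg * T); last by ring.
    by rewrite h2; congr (_ + _); apply: eq_Rintegral => s _; rewrite E.
  - move=> t1 t2 e1 e2 k t10.
    have T := tbump_test sg t2 e1 e2 k t10.
    pose bb (z : R * R) := bump t1 t2 k z.1 * bump e1 e2 k z.2.
    pose db (z : R * R) := dbump t1 t2 k z.1 * bump e1 e2 k z.2.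
    pose bd (z : R * R) := bump t1 t2 k z.1 * dbump e1 e2 k z.2.
    have aE z : aff2 1 (- sg) 0 z = (z.1, z.2 - sg * z.1) by rewrite /aff2; congr pair; ring.
    have phiE z : tbump sg t1 t2 e1 e2 k z = bb (aff2 1 (- sg) 0 z) by rewrite aE.
    have D1 z : 'D_(1, 0) (tbump sg t1 t2 e1 e2 k) z = db (aff2 1 (- sg) 0 z) - sg * bd (aff2 1 (- sg) 0 z).
      by rewrite tbump_derive aE /db /bd/=; ring.
    have D2 z : 'D_(0, 1) (tbump sg t1 t2 e1 e2 k) z = bd (aff2 1 (- sg) 0 z).
      by rewrite tbump_derive aE /bd/=; ring.
    have [N [tN eN]] := ex_quad t1 t2 e1 e2.
    have out z : ~ quad N z -> [/\ bb z = 0, db z = 0 & bd z = 0].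
      move=> /(quad_out t10 tN eN)[H|H]; rewrite /bb /db /bd.
        by rewrite bump_out// dbump_out// !mul0r.
      by rewrite [bump e1 e2 k _]bump_out// [dbump e1 e2 k _]dbump_out// !mulr0.
    have hp (f p : R * R -> R) : (forall z, z.1 <= t1 -> p z = 0) ->
      \int[leb2]_(z in halfplane) (f z * p (aff2 1 (- sg) 0 z)) = \int[leb2]_z (f z * p (aff2 1 (- sg) 0 z)).
      move=> p0; rewrite int_indic; apply: eq_Rintegral => z _.
      have [h|h] := pselect (halfplane z); first by rewrite indicE mem_set// mulr1.
      rewrite p0 ?mulr0 ?mul0r//= ltW// (lt_trans _ t10)//.
      by rewrite ltNge; apply/negP.
    have mb a b := @bump_meas R a b k; have mdb a b := @dbump_meas R a b k.
    have mm (p q : R -> R) : measurable_fun [set: measurableTypeR R] p ->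
      measurable_fun [set: measurableTypeR R] q ->
      measurable_fun [set: measurableTypeR R * measurableTypeR R] (fun z => p z.1 * q z.2).
      by move=> mp mq; apply: measurable_funM; apply: measurableT_comp.
    have le2 (a b p q : R) : `|p| <= a -> `|q| <= b -> `|p * q| <= a * b.
      by move=> h1 h2; rewrite normrM ler_pM.
    have bbl z := le2 _ _ _ _ (bump_norm_le t1 t2 k z.1) (bump_norm_le e1 e2 k z.2).
    have dbl z := le2 _ _ _ _ (dbump_le t1 t2 k z.1) (bump_norm_le e1 e2 k z.2).
    have bdl z := le2 _ _ _ _ (bump_norm_le t1 t2 k z.1) (dbump_le e1 e2 k z.2).
    have [iw1 ew1] := @shear_mul sg _ N w db wl (mm _ _ (mdb _ _) (mb _ _)) dbl (fun z h => let: And3 _ h2 _ := out z h in h2).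
    have [iw2 ew2] := @shear_mul sg _ N w bd wl (mm _ _ (mb _ _) (mdb _ _)) bdl (fun z h => let: And3 _ _ h3 := out z h in h3).
    have [it et] := @shear_mul sg _ N ct bb ctl (mm _ _ (mb _ _) (mb _ _)) bbl (fun z h => let: And3 h1 _ _ := out z h in h1).
    have [ix ex] := @shear_mul sg _ N cx bb cxl (mm _ _ (mb _ _) (mb _ _)) bbl (fun z h => let: And3 h1 _ _ := out z h in h1).
    have [_ ec] := @shear_mul sg _ N _ bb cl (mm _ _ (mb _ _) (mb _ _)) bbl (fun z h => let: And3 h1 _ _ := out z h in h1).
    rewrite -/(S _) in ec.
    have nt (z : R * R) : z.1 <= t1 -> ~ (t1 < z.1 < t2) by move=> h /andP[h1 _]; rewrite leNgt h1 in h.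
    have bb0 z : z.1 <= t1 -> bb z = 0 by move=> h; rewrite /bb (bump_out k (nt z h)) mul0r.
    have bd0 z : z.1 <= t1 -> bd z = 0 by move=> h; rewrite /bd (bump_out k (nt z h)) mul0r.
    have db0 z : z.1 <= t1 -> db z = 0 by move=> h; rewrite /db (dbump_out k (nt z h)) mul0r.
    have := hct T; under eq_Rintegral do rewrite D1.
    have dd0 z : z.1 <= t1 -> db z - sg * bd z = 0 by move=> h; rewrite (db0 z h) (bd0 z h) mulr0 subr0.
    rewrite (hp w (fun z => db z - sg * bd z) dd0).
    under [X in _ = - X]eq_Rintegral do rewrite phiE.
    rewrite (hp ct bb bb0) => Ht.
    have := hcx T; under eq_Rintegral do rewrite D2.
    rewrite (hp w bd bd0); under [X in _ = - X]eq_Rintegral do rewrite phiE.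
    rewrite (hp cx bb bb0) => Hx.
    rewrite -[LHS]ew1 -[in RHS]ec.
    under [in RHS]eq_Rintegral do rewrite mulrDl -mulrA.
    rewrite RintegralD; [|exact: measurableT|exact: it|exact: (Int2Z sg ix)].
    rewrite RintegralZl; [|exact: measurableT|exact: ix]; rewrite opprD -Ht -mulrN -Hx.
    have Ez z' : w z' * (db (aff2 1 (- sg) 0 z') - sg * bd (aff2 1 (- sg) 0 z')) =
      w z' * db (aff2 1 (- sg) 0 z') - sg * (w z' * bd (aff2 1 (- sg) 0 z')) by ring.
    under [X in _ = X + _]eq_Rintegral do rewrite Ez.
    rewrite RintegralB; [|exact: measurableT|exact: iw1|exact: (Int2Z sg iw2)].
    rewrite RintegralZl; [|exact: measurableT|exact: iw2].
    by rewrite subrK.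
have := ae_aff2 (- (2 * sg)) 0 (oner_neq0 R) main.
apply: ae2S => z; rewrite /aff2/= => /[apply].
rewrite /S /aff2/=.
have -> : 1 * (1 * z.2 + - (2 * sg) * z.1 + 0) + sg * z.1 + 0 = 1 * z.2 + - sg * z.1 + 0 by ring.
have -> : 1 * (1 * z.2 + - (2 * sg) * z.1 + 0) + 2 * sg * z.1 + 0 = z.2 by ring.
by case: z.
Qed.

End char.
End charae.

Section geom.
Context {R : realType} {n : nat}.
Implicit Types (M : set 'rV[R]_n) (p a b : 'rV[R]_n).

Lemma dotDl a b c : dot (a + b) c = dot a c + dot b c.
Proof. by rewrite /dot -big_split/=; apply: eq_bigr => i _; rewrite mxE mulrDl. Qed.

Lemma dotZl (k : R) a b : dot (k *: a) b = k * dot a b.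
Proof. by rewrite /dot mulr_sumr; apply: eq_bigr => i _; rewrite mxE mulrA. Qed.

Lemma dotC a b : dot a b = dot b a.
Proof. by rewrite /dot; apply: eq_bigr => i _; rewrite mulrC. Qed.

Lemma dotBr a b c : dot a (b - c) = dot a b - dot a c.
Proof. by rewrite -scaleN1r dotC dotDl dotZl mulN1r dotC (dotC c). Qed.

Lemma dot_eq0 a : dot a a = 0 -> a = 0.
Proof.
move=> /eqP; rewrite /dot psumr_eq0; last by move=> i _; rewrite -expr2 sqr_ge0.
move=> /allP h; apply/rowP => i; rewrite mxE; apply/eqP.
by have := h i; rewrite mem_index_enum mulf_eq0 orbb => /(_ isT).
Qed.

Lemma tangentP M p (Q : 'M[R]_n) a : orthogonal_projection M p Q -> tangent M p a <-> a *m Q = a.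
Proof.
move=> hQ; split; last by move=> <-; exact: (hQ a).1.
move=> ta; have [t1 n1] := hQ a.
apply/esym/eqP; rewrite -subr_eq0; apply/eqP; apply: dot_eq0.
by rewrite dotBr (n1 _ ta) (n1 _ t1) subrr.
Qed.

Lemma tangentD M p (Q : 'M[R]_n) a b : orthogonal_projection M p Q ->
  tangent M p a -> tangent M p b -> tangent M p (a + b).
Proof.
move=> hQ /(tangentP _ hQ) ha /(tangentP _ hQ) hb; apply/(tangentP _ hQ).
by rewrite mulmxDl ha hb.
Qed.

Lemma second_form_normal M A p (Q : 'M[R]_n) a b : second_fundamental_form M A -> M p ->
  orthogonal_projection M p Q -> tangent M p a -> tangent M p b -> normal M p (A p a b).
Proof.
move=> hA Mp hQ ta tb; have [sym lin diag] := hA p Mp.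
have dn c : tangent M p c -> normal M p (A p c c).
  by move=> [g [gM g0 <-]]; have [] := diag g gM g0.
have tab := tangentD hQ ta tb.
have E : A p (a + b) (a + b) = A p a a + A p a b + (A p a b + A p b b).
  have l c c' d : tangent M p c -> tangent M p c' -> tangent M p d ->
      A p (c + c') d = A p c d + A p c' d.
    by move=> tc tc' td; have := lin 1 c c' d tc tc' td; rewrite !scale1r.
  rewrite l// [A p a (a + b)]sym// [A p b (a + b)]sym// !l//.
  by rewrite [A p b a]sym.
move=> d td.
have := dn _ tab d td; rewrite E !dotDl (dn _ ta d td) (dn _ tb d td) add0r addr0 => /eqP.
by rewrite -mulr2n mulrn_eq0 /= => /eqP.
Qed.

Section curve.
Variables (q w : 'rV[R]_n).
Let l (s : R) : 'rV[R]_n := q + s *: w.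

Lemma line_diff (s : R) : differentiable l s /\ 'D_1 l s = w.
Proof.
have [ds dE] := is_diff_scalel s w.
have [cl cE] : is_diff s (cst q + ( *:%R ^~ w)) (0 + ( *:%R ^~ w)) by exact: is_diffD.
split=> //; rewrite deriveE// -[l]/(cst q + ( *:%R ^~ w)) cE /=.
by rewrite [LHS]add0r scale1r.
Qed.

Lemma classC_line k (V : set 'rV[R]_n) (D : set R) (Psi g : _) (c : R) : open D ->
  (forall s, D s -> V (l s)) -> (forall s, D s -> g s = c *: (Psi (l s) : 'rV[R]_n)) ->
  classC k V Psi -> classC k D g.
Proof.
move=> oD DV.
have nearg (g' h : R -> 'rV[R]_n) s : D s -> (forall s, D s -> g' s = h s) -> \near s, h s = g' s.
  by move=> Ds gh; have : nbhs s D by [exact: open_nbhs_nbhs]; apply: filterS => y /gh.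
elim: k Psi g c => [|k IH] Psi g c hg.
  move=> cPsi s Ds.
  have cc : {for s, continuous (fun s => c *: Psi (l s))}.
    apply: cvgZr; apply: (@continuous_comp _ _ _ l Psi); last by apply: cPsi; exact: DV.
    by apply: differentiable_continuous; have [] := line_diff s.
  suff : g y @[y --> s] --> g s by [].
  rewrite (hg s Ds); apply: cvg_trans cc; apply: near_eq_cvg.
  by apply: nearg => // y Dy; rewrite hg.
move=> [dPsi DPsi].
have dg s : D s -> differentiable g s /\ forall v : R, 'D_v g s = (c * v) *: 'D_w Psi (l s).
  move=> Ds; have [ld lD] := line_diff s.
  have dP := dPsi _ (DV _ Ds).
  have dc : differentiable (Psi \o l) s by exact: differentiable_comp.
  have hd : derivable (fun s => c *: Psi (l s)) s 1.
    by apply: derivableZ; apply/derivable1_diffP.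
  have ng := nearg g _ s Ds hg.
  split; first by apply/derivable1_diffP; apply: near_eq_derivable ng hd.
  move=> v; rewrite -(near_eq_derive v ng).
  have -> : 'D_v (fun s => c *: Psi (l s)) s = v *: 'D_1 (fun s => c *: Psi (l s)) s.
    rewrite !deriveE; [|by apply/derivable1_diffP..].
    by rewrite -linearZ/= /GRing.scale/= mulr1.
  rewrite deriveZ; last by apply/derivable1_diffP.
  have E1 : 'D_1 (Psi \o l) s = 'D_w Psi (l s).
    rewrite deriveE// (diff_comp ld dP)/= (deriveE _ dP).
    by congr ('d Psi (l s) _); rewrite -deriveE.
  by rewrite -[fun y => Psi (l y)]/(Psi \o l) E1 scalerA mulrC.
split=> [s Ds|v]; first by have [] := dg s Ds.
apply: (IH ('D_w Psi) _ (c * v)); first by move=> s Ds; have [_ ->] := dg s Ds.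
exact: DPsi.
Qed.
End curve.

Lemma tangent_derivative d M (g : R -> 'rV[R]_n) (x : R) a :
  embedded_submanifold d M -> (\forall y \near x, M (g y)) ->
  is_derive x (1 : R) g a -> tangent M (g x) a.
Proof.
move=> [_ hM] Mg [gd ga].
have Mgx : M (g x) by exact: nbhs_singleton Mg.
have [U [V [Phi [Psi [[oU Ux oV] [[sPhi sPsi UV VU] MU]]]]]] := hM _ Mgx.
have gdiff : differentiable g x by apply/derivable1_diffP.
have dPhi : differentiable Phi (g x) by have [h _] := sPhi 1%N; exact: h.
have [VPhi PsiPhi] := UV _ Ux.
have dPsi : differentiable Psi (Phi (g x)) by have [h _] := sPsi 1%N; exact: h.
have dPg : differentiable (Phi \o g) x by exact: differentiable_comp.
pose w := 'D_1 (Phi \o g) x.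
have gU : \forall y \near x, U (g y).
  by apply: (differentiable_continuous gdiff); exact: open_nbhs_nbhs.
have w0 (i : 'I_n) : (d <= i)%N -> w 0 i = 0.
  move=> di; rewrite /w derive_mx; last exact/derivable1_diffP.
  rewrite mxE (near_eq_derive (g := cst 0)) ?derive_cst//.
  near=> y => /=; apply: (MU _ _).1 => //; first by near: y.
  by near: y.
pose q := Phi (g x).
pose c (s : R) := Psi (q + s *: w).
have lc : continuous (fun s : R => q + s *: w).
  by move=> s; have [/differentiable_continuous] := line_diff q w s.
have oL : open [set s : R | V (q + s *: w)].
  by apply: open_comp => // s _; exact: lc.
have [e /= e0 He] : nbhs (0 : R) [set s : R | V (q + s *: w)].
  by apply: open_nbhs_nbhs; split => //=; rewrite scale0r addr0.
exists c; split.
- exists e => //; split.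
    move=> k; apply: (@classC_line q w k V _ Psi c 1).
    + exact: ball_open.
    + by move=> s /He.
    + by move=> s _; rewrite scale1r.
    + exact: sPsi.
  move=> s /He /= Vs; have [Uc Pc] := VU _ Vs.
  apply/(MU _ Uc) => i di; rewrite Pc !mxE w0// mulr0 addr0.
  by apply: (MU _ Ux).1.
- by rewrite /c scale0r addr0.
- rewrite derive1E /c.
  have [l0 lD] := line_diff q w 0.
  have dPsi0 : differentiable Psi (q + 0 *: w) by rewrite scale0r addr0.
  have -> : 'D_1 (fun s : R => Psi (q + s *: w)) 0 = 'd Psi q w.
    rewrite -[fun s : R => _]/(Psi \o (fun s : R => q + s *: w)).
    rewrite deriveE; last exact: differentiable_comp.
    have lD' : 'd (fun s : R => q + s *: w) 0 1 = w by rewrite -(deriveE _ l0).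
    by rewrite (diff_comp l0 dPsi0) /comp lD' scale0r addr0.
  rewrite -ga (@near_eq_derive _ _ _ g (Psi \o (Phi \o g)) x 1); last first.
    by apply: filterS gU => y Ugy /=; have [_ ->] := UV _ Ugy.
  rewrite deriveE; last exact: differentiable_comp.
  have wE : 'd (Phi \o g) x 1 = w by rewrite -(deriveE _ dPg).
  by rewrite (diff_comp dPg dPsi) [in RHS]/comp wE.
Unshelve. all: by end_near. Qed.

End geom.

Section energy.
Context {R : realType}.
Notation leb := (@leb R).
Notation leb2 := (@leb2 R).
Notation Int1 f := (leb.-integrable setT (fun x => (f x)%:E)).
Notation Int2 f := (leb2.-integrable setT (fun x => (f x)%:E)).

Lemma Int1_mul_prim (p : R -> R) : Int1 p -> Int1 (fun s => prim p s * p s).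
Proof.
move=> pi; have := Int1_primM 0 pi pi.
by under eq_fun do rewrite add0r.
Qed.

Lemma sq_int (p : R -> R) : Int1 p ->
  (\int[leb]_x p x) ^+ 2 = 2 * \int[leb]_s (prim p s * p s).
Proof.
move=> pi; have mp := Int1_measurable pi.
have PI := Int2M pi pi.
pose K1 (z : R * R) : R := p z.1 * p z.2 * (z.1 <= z.2)%R%:R.
pose K2 (z : R * R) : R := p z.1 * p z.2 * (z.2 < z.1)%R%:R.
have I1 : Int2 K1.
  apply: (@Int2_bddM _ _ (fun z => (z.1 <= z.2)%R%:R) 1) => //; first exact: measurable_le2.
  by move=> z; case: (z.1 <= z.2)%R; rewrite ?normr1 ?normr0.
have I2 : Int2 K2.
  have := Int2B PI I1; congr (_.-integrable _ _); apply/funext => z.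
  rewrite /K1 /K2 ltNge; case: (z.1 <= z.2)%R => /=; rewrite ?mulr1 ?mulr0 ?subrr ?subr0//.
have E0 : \int[leb2]_z (p z.1 * p z.2) = (\int[leb]_x p x) ^+ 2.
  rewrite int2_int1//= expr2.
  under eq_Rintegral do rewrite RintegralZl//.
  by rewrite RintegralZr.
have E1 : \int[leb2]_z K1 z = \int[leb]_s (prim p s * p s).
  rewrite int2_int2//; apply: eq_Rintegral => s _.
  rewrite /prim [in RHS]int_indic -RintegralZr; [|exact: measurableT|exact: (Int1_indicM `]-oo, s] pi)].
  apply: eq_Rintegral => r _; rewrite /K1/= mulrAC; congr (_ * _ * _).
  by rewrite indicE mem_setE/= in_itv.
have E2 : \int[leb2]_z K2 z = \int[leb]_s (prim p s * p s).
  rewrite int2_int1//; apply: eq_Rintegral => s _.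
  rewrite /prim -Rintegral_itv_bndo_bndc; last exact: Int1_itv.
  rewrite [in RHS]int_indic -RintegralZr; [|exact: measurableT|exact: (Int1_indicM `]-oo, s[ pi)].
  apply: eq_Rintegral => r _; rewrite /K2/= (_ : \1_`]-oo, s[ r = (r < s)%R%:R); first by ring.
  by rewrite indicE mem_setE/= in_itv.
rewrite -E0 mulrDl mul1r -{1}E1 -E2 -RintegralD//.
apply: eq_Rintegral => z _; rewrite /K1 /K2 ltNge.
by case: (z.1 <= z.2)%R => /=; rewrite ?mulr1 ?mulr0 ?addr0 ?add0r.
Qed.

Lemma prim_sq (p : R -> R) (a0 t : R) : Int1 p ->
  (a0 + prim p t) ^+ 2 = a0 ^+ 2 + 2 * \int[leb]_(s in `]-oo, t]) ((a0 + prim p s) * p s).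
Proof.
move=> pi; pose q s := p s * \1_`]-oo, t] s.
have qi : Int1 q by exact: Int1_indicM.
have pq : prim p t = \int[leb]_s q s by rewrite /prim int_indic.
have E s : (a0 + prim p s) * p s * \1_`]-oo, t] s = a0 * q s + prim q s * q s.
  rewrite /q [in RHS]/prim indicE mem_setE/= in_itv/=; have [st|st] := leP s t; last first.
    by rewrite !mulr0 addr0.
  rewrite !mulr1 mulrDl; congr (_ + _ * _).
  rewrite /prim int_indic [RHS]int_indic; apply: eq_Rintegral => r _.
  rewrite -mulrA; congr (_ * _); rewrite !indicE !mem_setE/= !in_itv/= -natrM mulnb.
  congr (nat_of_bool _)%:R; apply/idP/idP; last by move=> /andP[].
  by move=> rs; rewrite (le_trans rs st) rs.
rewrite pq sqrrD (sq_int qi) [in RHS]int_indic.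
under [in RHS]eq_Rintegral do rewrite E.
rewrite RintegralD//; [|exact: Int1Z|exact: Int1_mul_prim].
by rewrite RintegralZl//; ring.
Qed.

Lemma Int1_sum (n : nat) (f : 'I_n -> R -> R) : (forall i, Int1 (f i)) ->
  Int1 (fun x => \sum_(i < n) f i x).
Proof.
move=> fi; have := @integrable_sum _ _ _ leb setT measurableT 'I_n (index_enum 'I_n) xpredT (fun i x => (f i x)%:E) (fun i _ => fi i).
by under eq_fun do rewrite sumEFin.
Qed.

Lemma int_sum (n : nat) (f : 'I_n -> R -> R) : (forall i, Int1 (f i)) ->
  \int[leb]_x (\sum_(i < n) f i x) = \sum_(i < n) \int[leb]_x f i x.
Proof.
elim: n f => [|n IH] f fi.
  by rewrite big_ord0; under eq_Rintegral do rewrite big_ord0; rewrite Rintegral_cst// mul0r.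
under eq_Rintegral do rewrite big_ord_recr.
rewrite big_ord_recr/= -IH// -RintegralD//.
all: try by move=> *; exact: fi.
by apply: Int1_sum => i; exact: fi.
Qed.

Lemma energy1 (n : nat) (p : 'I_n -> R -> R) (a0 : 'I_n -> R) (g : R -> R) :
  (forall i, Int1 (p i)) -> (forall i s, s < 0 -> p i s = 0) -> Int1 g -> (forall s, 0 <= g s) ->
  let a i t := a0 i + prim (p i) t in
  let N t := Num.sqrt (\sum_(i < n) a i t ^+ 2) in
  {ae leb, forall s, 0 <= s -> \sum_(i < n) a i s * p i s <= N s * g s} ->
  forall t, 0 <= t -> N t <= Num.sqrt (\sum_(i < n) a0 i ^+ 2) + 2 * \int[leb]_s g s.
Proof.
move=> pi p0 gi g0 a N hae t t0.
have ca i : continuous (a i).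
  by move=> x; apply: cvgD; [exact: cvg_cst|exact: prim_continuous].
have cN : {within `[0, t], continuous N}.
  apply: continuous_subspaceT => x; apply: (@continuous_comp _ _ _ (fun s => \sum_(i < n) a i s ^+ 2) Num.sqrt).
    apply: cvg_big; first exact: add_continuous.
    by move=> i _; apply: cvgM; exact: ca.
  exact: sqrt_continuous.
have [c ct Nc] := EVT_max t0 cN.
pose N0 := Num.sqrt (\sum_(i < n) a0 i ^+ 2).
pose G := \int[leb]_s g s.
have G0 : 0 <= G by exact: Rintegral_ge0.
have Sq s : N s ^+ 2 = \sum_(i < n) a i s ^+ 2.
  by rewrite sqr_sqrtr// sumr_ge0// => i _; exact: sqr_ge0.
have Sq0 : N0 ^+ 2 = \sum_(i < n) a0 i ^+ 2.
  by rewrite sqr_sqrtr// sumr_ge0// => i _; exact: sqr_ge0.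
have apI i : Int1 (fun s => a i s * p i s) by exact: Int1_primM.
have key : N c ^+ 2 <= N0 ^+ 2 + 2 * (N c * G).
  rewrite Sq Sq0 (eq_bigr (fun i => a0 i ^+ 2 + 2 * \int[leb]_(s in `]-oo, c]) (a i s * p i s))); last first.
    by move=> i _; exact: prim_sq.
  rewrite big_split/= lerD2l -mulr_sumr ler_wpM2l//.
  rewrite (eq_bigr (fun i => \int[leb]_s (a i s * p i s * \1_`]-oo, c] s))); last by move=> i _; exact: int_indic.
  rewrite -int_sum; last by move=> i; exact: Int1_indicM.
  rewrite mulrC -RintegralZr//.
  apply: int_le; [by apply: Int1_sum => i; exact: Int1_indicM| |].
    by under eq_fun do rewrite mulrC; exact: Int1Z.
  apply: aeS hae => s hs; rewrite -mulr_suml.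
  rewrite indicE mem_setE/= in_itv/=.
  have Nc0 : 0 <= N c by exact: sqrtr_ge0.
  have [sc|sc] := leP s c; last by rewrite mulr0 mulr_ge0.
  rewrite mulr1; have [s0|s0] := leP 0 s; last first.
    by rewrite big1 ?mulr_ge0// => i _; rewrite p0// mulr0.
  apply: le_trans (hs s0) _; rewrite [leRHS]mulrC ler_wpM2r//; apply: Nc.
  by move: ct; rewrite !in_itv/= s0 => /andP[_ /(le_trans sc)].
have : N c <= N0 + 2 * G.
  have Nc0 : 0 <= N c by exact: sqrtr_ge0.
  have N00 : 0 <= N0 by exact: sqrtr_ge0.
  have [h|h] := leP (N c) N0; first by apply: le_trans h _; rewrite lerDl mulr_ge0.
  have Np : 0 < N c by exact: le_lt_trans h.
  rewrite -(ler_pM2r Np); apply: (@le_trans _ _ (N0 ^+ 2 + 2 * (N c * G))); first by rewrite -expr2.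
  have := ler_wpM2l N00 (ltW h); rewrite expr2 => hh; lra.
by apply: le_trans; apply: Nc; rewrite in_itv/= t0 lexx.
Qed.

End energy.

Section vectors.
Context {R : realType}.
Notation leb := (@leb R).
Notation leb2 := (@leb2 R).
Notation Int1 f := (leb.-integrable setT (fun x => (f x)%:E)).
Notation Int2 f := (leb2.-integrable setT (fun x => (f x)%:E)).

Lemma sqrt_sum_le (n : nat) (a : 'I_n -> R) : Num.sqrt (\sum_i a i ^+ 2) <= \sum_i `|a i|.
Proof.
have h m (b : 'I_m -> R) : \sum_i b i ^+ 2 <= (\sum_i `|b i|) ^+ 2.
  elim: m b => [|m IH] b; first by rewrite !big_ord0.
  rewrite !big_ord_recr/= sqrrD -[b ord_max ^+ 2]real_normK ?num_real// lerD2r.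
  by apply: le_trans (IH _) _; rewrite lerDl mulrn_wge0// mulr_ge0// sumr_ge0.
rewrite -[leRHS]ger0_norm ?sumr_ge0// -sqrtr_sqr.
by rewrite ler_wsqrtr// h.
Qed.

Lemma le_sqrt_sum (n : nat) (a : 'I_n -> R) i : `|a i| <= Num.sqrt (\sum_i a i ^+ 2).
Proof.
rewrite -sqrtr_sqr ler_wsqrtr// (bigD1 i)//= lerDl sumr_ge0// => j _; exact: sqr_ge0.
Qed.

Lemma enormE n (a : 'rV[R]_n) : enorm a = Num.sqrt (\sum_i a 0 i ^+ 2).
Proof. by congr Num.sqrt; apply: eq_bigr => i _; rewrite expr2. Qed.

Lemma enorm_ge0 n (a : 'rV[R]_n) : 0 <= enorm a.
Proof. exact: sqrtr_ge0. Qed.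

Lemma enorm_le_sum n (a : 'rV[R]_n) : enorm a <= \sum_i `|a 0 i|.
Proof. by rewrite enormE; exact: sqrt_sum_le. Qed.

Lemma le_enorm n (a : 'rV[R]_n) i : `|a 0 i| <= enorm a.
Proof. by rewrite enormE; exact: (le_sqrt_sum (fun i => a 0 i)). Qed.

Lemma Int2_swap (f : R * R -> R) : Int2 f -> Int2 (fun z => f (z.2, z.1)).
Proof.
move=> fi; have /integrableP[mf _] := fi.
have mfs : measurable_fun [set: measurableTypeR R * measurableTypeR R] (fun z => (f (z.2, z.1))%:E).
  by apply: (measurableT_comp mf); exact: measurable_swap.
apply/(integrable12ltyP leb leb); first exact: mfs.
by have /(integrable21ltyP leb leb) := fi; apply.
Qed.

Lemma ae_fst (Q : R -> Prop) : {ae leb, forall t, Q t} -> {ae leb2, forall z, Q z.1}.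
Proof.
move=> [N [mN N0 QN]]; exists (N `*` setT); split.
- by apply: measurableX.
- rewrite (@leb2_ysection R)//; last exact: measurableX.
  under eq_integral => y _.
    have -> : ysection (N `*` [set: measurableTypeR R]) y = N.
      by apply/seteqP; split => x; rewrite ysectionP /=; [case|].
    rewrite N0; over.
  by rewrite integral0.
- by move=> z /= nQ; split => //; exact: QN.
Qed.

Lemma locint_measurable (f : R * R -> R) : locint f ->
  measurable_fun [set: measurableTypeR R * measurableTypeR R] (fun z => f z * \1_halfplane z).
Proof.
move=> fl.
apply: (@measurable_fun_cvg _ _ R setT (fun N z => f z * \1_(quad N) z)) => //.
  by move=> N; exact: Int2_measurable (fl N).
move=> z _; apply: cvg_near_cst.
have [h|h] := pselect (halfplane z); last first.
  near=> N; rewrite !indicE !memNset// => /quad_in[z0 _ _]; exact: h.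
exists (Num.truncn (`|z.1| + `|z.2|)).+1 => // N /= hN.
rewrite !indicE !mem_set//; apply/quad_in.
have hM : `|z.1| + `|z.2| <= N%:R.
  by apply: le_trans (ltW (truncnS_gt _)) _; rewrite ler_nat.
split => //; first by apply: le_trans hM; rewrite (le_trans (ler_norm _))// lerDl.
by apply: le_trans hM; rewrite lerDr.
Unshelve. all: by end_near. Qed.

Lemma quad_halfplane N : quad N `<=` @halfplane R.
Proof. by move=> z /quad_in[]. Qed.

Lemma compact_quad N : compact (@quad R N).
Proof. by apply: compact_setX; exact: segment_compact. Qed.

Lemma locint_comp n (w : R * R -> 'rV[R]_n) i : locally_integrable_halfplane w ->
  locint (fun z => w z 0 i).
Proof.
move=> hw N; apply/(Int_indic leb2 (fun z => w z 0 i) (measurable_quad N)).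
by have := hw (quad N) (@compact_quad N) (@quad_halfplane N) i.
Qed.

Lemma is_derive_row n (g : R -> 'rV[R]_n) (x : R) (a : 'rV[R]_n) :
  is_derive x (1 : R) g a <-> forall i, is_derive x (1 : R) (fun y => g y 0 i) (a 0 i).
Proof.
split=> [[dg ga] i|h].
  have /derivable_mxP h := dg; split; first exact: h.
  by rewrite -ga derive_mx// mxE.
have dg : derivable g x 1.
  by apply/derivable_mxP => i j; rewrite ord1; have [] := h j.
split=> //; rewrite derive_mx//; apply/rowP => j; rewrite mxE.
by have [_ ->] := h j.
Qed.

Lemma W11dot_comp n (g : R -> 'rV[R]_n) : W11dot g ->
  exists2 D : 'I_n -> R -> R, forall i, Int1 (D i) &
    forall i x, g x 0 i = (g 0 0 i - prim (D i) 0) + prim (D i) x.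
Proof.
move=> [ac [Dg Di dD]]; exists (fun i x => Dg x 0 i); first by move=> i; exact: Di.
move=> i; apply: (@abs_cont_FTC _ (fun x => g x 0 i)).
- move=> a b ab e e0; have [dl dl0 H] := ac a b ab e e0; exists dl => // m l r lr tF sd.
  apply: le_lt_trans (H m l r lr tF sd); apply: ler_sum => k _.
  by have := le_enorm (g (r k) - g (l k)) i; rewrite !mxE.
- exact: Di.
- by apply: aeS dD => x /is_derive_row.
Qed.

Lemma lipschitz_continuous (V W : normedModType R) (g : V -> W) : lipschitz g -> continuous g.
Proof.
move=> [M [_ H]] x.
have M0 : 0 < `|M| + 1 by rewrite ltr_wpDl.
have H' y : `|g x - g y| <= (`|M| + 1) * `|x - y|.
  by apply: (H (`|M| + 1) _ (x, y)) => //; rewrite (le_lt_trans (ler_norm M))// ltrDl.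
apply/cvgrPdist_le => /= ep ep0; near=> y.
apply: le_trans (H' y) _; rewrite -ler_pdivlMl// mulrC.
by near: y; apply: cvgr_dist_le; [exact: cvg_id|exact: divr_gt0].
Unshelve. all: by end_near. Qed.

Lemma bounded_setT (T : Type) (V : normedModType R) (g : T -> V) : [bounded g x | x in setT] ->
  exists2 C : R, 0 <= C & forall x, `|g x| <= C.
Proof.
move=> [M [_ H]]; exists (`|M| + 1); first by rewrite addr_ge0.
by move=> x; apply: (H (`|M| + 1)) => //; rewrite (le_lt_trans (ler_norm M))// ltrDl.
Qed.

Lemma Int2_sum (m : nat) (h : 'I_m -> R * R -> R) : (forall i, Int2 (h i)) ->
  Int2 (fun x => \sum_(i < m) h i x).
Proof.
move=> fi; have := @integrable_sum _ _ _ leb2 setT measurableT 'I_m (index_enum 'I_m) xpredT (fun i x => (h i x)%:E) (fun i _ => fi i).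
by under eq_fun do rewrite sumEFin.
Qed.

Lemma Int1_abs (h : R -> R) : Int1 h -> Int1 (fun x => `|h x|).
Proof. by move=> hi; exact: (integrable_abse hi). Qed.

Lemma Int2_abs (h : R * R -> R) : Int2 h -> Int2 (fun x => `|h x|).
Proof. by move=> hi; exact: (integrable_abse hi). Qed.

Lemma ae_neq (c : R) : {ae leb, forall x, x != c}.
Proof.
exists [set c]; split; first exact: measurable_set1.
  exact: lebesgue_measure_set1.
by move=> x /= /negP; rewrite negbK => /eqP.
Qed.

End vectors.

Section solution.
Context {R : realType} {n : nat}.
Notation leb := (@leb R).
Notation leb2 := (@leb2 R).
Notation Int1 f := (leb.-integrable setT (fun x => (f x)%:E)).
Notation Int2 f := (leb2.-integrable setT (fun x => (f x)%:E)).
Variables (d : nat) (M : set 'rV[R]_n).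
Variables (A : 'rV[R]_n -> 'rV[R]_n -> 'rV[R]_n -> 'rV[R]_n).
Variables (Gam : 'I_n -> 'I_n -> 'rV[R]_n -> 'rV[R]_n) (P : 'rV[R]_n -> 'M[R]_n).
Hypotheses (hM : embedded_submanifold d M) (hA : second_fundamental_form M A).
Hypothesis hGam : forall j k : 'I_n, bounded_lipschitz (Gam j k).
Hypothesis hGamA : forall p a b : 'rV[R]_n, M p -> tangent M p a -> tangent M p b ->
  \sum_(j < n) \sum_(k < n) (a 0 j * b 0 k) *: Gam j k p = A p a b.
Hypothesis hP : bounded_lipschitz P.
Hypothesis hPproj : forall p : 'rV[R]_n, M p -> orthogonal_projection M p (P p).
Variables (u0 v0 : R -> 'rV[R]_n) (f u ut ux : R * R -> 'rV[R]_n).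
Hypothesis hf : vintegrable leb2 halfplane f.
Hypothesis hu : mild_solution M Gam P u0 v0 f u ut ux.
Variables (k0 : 'I_n -> R) (D : 'I_n -> R -> R).
Hypothesis vi : forall i, Int1 (fun x => v0 x 0 i).
Hypothesis Di : forall i, Int1 (D i).
Hypothesis hu0 : forall i x, u0 x 0 i = k0 i + prim (D i) x.

Let F i (z : R * R) : R := wave_map_rhs Gam P f u ut ux z 0 i.
Definition edge sg i (y : R) : R := v0 y 0 i + sg * D i y.
Let e := edge.
Definition speed sg i (z : R * R) : R := charA sg (F i) (e sg i) z.

Lemma edge_Int1 sg i : Int1 (e sg i).
Proof. by apply: Int1D => //; exact: Int1Z. Qed.

Lemma rhs_triangle i (t x : R) : 0 <= t ->
  leb2.-integrable (backward_triangle t x) (fun z => (F i z)%:E).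
Proof. by move=> t0; have [_ _ _ h] := hu; have [h1 _] := h t x t0; exact: h1. Qed.

Lemma rhs_locint i : locint (F i).
Proof. by apply: triangles_locint; exact: rhs_triangle. Qed.

Lemma mild_dalembert i t x : 0 <= t ->
  u (t, x) 0 i = dalembert (k0 i) (D i) (fun y => v0 y 0 i) (F i) t x.
Proof.
move=> t0; have [_ _ _ h] := hu; have [_ ->] := h t x t0.
rewrite /linear_wave /vintegral !mxE !hu0; congr (_ + _ * _).
by apply: eq_Rintegral => r _; rewrite mxE.
Qed.

Lemma u_coord_within i : {within @halfplane R, continuous (fun z => u z 0 i)}.
Proof.
have [[cu _] _ _ _] := hu; move=> z.
by apply: (@continuous_comp _ _ _ (u : subspace _ -> _) (fun a : 'rV[R]_n => a 0 i)); [exact: cu|exact: coord_continuous].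
Qed.

Lemma char_ae_coord sg i : sg = 1 \/ sg = -1 -> {ae leb2, forall z, 0 < z.1 ->
  ut (aff2 1 (- sg) 0 z) 0 i + sg * ux (aff2 1 (- sg) 0 z) 0 i = speed sg i z}.
Proof.
move=> hsg; have [_ [wt wx [lt lx] _] _ _] := hu.
apply: (@char_ae _ sg (k0 i) (D i) (fun y => v0 y 0 i) (F i) (fun z => u z 0 i) hsg (Di i) (vi i)
  (rhs_triangle i) (mild_dalembert i) (fun z => ut z 0 i) (fun z => ux z 0 i)).
- exact: u_coord_within.
- exact: locint_comp.
- exact: locint_comp.
- by move=> phi tphi; exact: wt.
- by move=> phi tphi; exact: wx.
Qed.

Definition speedv sg (z : R * R) : 'rV[R]_n := \row_i speed sg i z.

Lemma ae_ord (Q : 'I_n -> R * R -> Prop) : (forall i, {ae leb2, forall z, Q i z}) ->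
  {ae leb2, forall z, forall i, Q i z}.
Proof. exact: ae_count. Qed.

Lemma char_ae_vec sg : sg = 1 \/ sg = -1 -> {ae leb2, forall z, 0 < z.1 ->
  ut (aff2 1 (- sg) 0 z) + sg *: ux (aff2 1 (- sg) 0 z) = speedv sg z}.
Proof.
move=> hsg; have := ae_ord (fun i => char_ae_coord i hsg).
by apply: ae2S => z h z0; apply/rowP => i; rewrite !mxE h.
Qed.

(* along one characteristic *)
Lemma tangent_line sg eta : sg = 1 \/ sg = -1 ->
  {ae leb, forall s, 0 < s -> tangent M (u (s, eta + sg * s)) (speedv sg (s, 2 * sg * s + eta))}.
Proof.
move=> hsg; have [[_ uM] _ _ _] := hu.
pose p (T : nat) i (s : R) := speed sg i (s, 2 * sg * s + eta) * \1_`[0, T%:R] s.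
have ml i t t0 := @mild_line _ sg (k0 i) (D i) (fun y => v0 y 0 i) (F i) (fun z => u z 0 i)
  hsg (Di i) (vi i) (rhs_triangle i) (mild_dalembert i) eta t t0.
have pI T i : Int1 (p T i) by have [] := ml i _ (ler0n R T).
have : {ae leb, forall s, forall q : nat * 'I_n, is_derive (s : R) (1 : R) (prim (p q.1 q.2)) (p q.1 q.2 s)}.
  by apply: ae_count => q; exact: prim_derive.
apply: aeS => s hs s0.
pose T := (Num.truncn s).+1.
have sT : s < T%:R by exact: truncnS_gt.
pose g (r : R) := u (r, eta + sg * r).
have rI : \forall r \near s, 0 < r < T%:R.
  have : nbhs s `]0, T%:R[%classic by apply: open_nbhs_nbhs; split; [exact: interval_open|rewrite /= in_itv/= s0].
  by apply: filterS => r /=; rewrite in_itv.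
apply: (@tangent_derivative _ _ d M g s) => //.
  by apply: filterS rI => r /andP[r0 _]; apply: uM; exact: ltW.
apply/is_derive_row => i.
have -> : speedv sg (s, 2 * sg * s + eta) 0 i = p T i s.
  by rewrite mxE /p indicE mem_set/= ?mulr1// in_itv/= ltW//= ltW.
have h2 : is_derive (s : R) (1 : R) (prim (p T i)) (p T i s) := hs (T, i).
have hd := is_deriveD (is_derive_cst (k0 i + prim (D i) eta) s (1 : R)) h2.
rewrite add0r in hd.
refine (near_eq_is_derive _ hd).
apply: filterS rI => r /andP[r0 rT].
have [_ E] := ml i r (ltW r0).
rewrite /g; apply/esym; etransitivity; first exact: E.
congr (_ + _).
rewrite (@primitive_quad _ (fun z => speed sg i (z.1, 2 * sg * z.1 + eta)) T%:R 0) ?ler0n ?ltW//.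
exact: pI.
Qed.

Lemma speed_measurable sg i :
  measurable_fun [set: measurableTypeR R * measurableTypeR R] (fun z => speed sg i z * \1_halfplane z).
Proof.
apply: locint_measurable; apply: locint_charA; [exact: rhs_locint|exact: edge_Int1].
Qed.

Lemma P_measurable i j : measurable_fun [set: measurableTypeR R * measurableTypeR R]
  (fun z => P (u z) i j * \1_halfplane z).
Proof.
apply: within_continuous_measurable2 => z; have [[cu _] _ _ _] := hu.
apply: (@continuous_comp _ _ _ (u : subspace _ -> _) (fun a : 'rV[R]_n => P a i j)); first exact: cu.
apply: (@continuous_comp _ _ _ P (fun B : 'M[R]_n => B i j)); last exact: coord_continuous.
by apply: lipschitz_continuous; have [] := hP.
Qed.

Lemma halfplane_aff2 c0 c e0 (z : R * R) : halfplane (aff2 c0 c e0 z) <-> halfplane z.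
Proof. by []. Qed.

Lemma speed_tangent sg : sg = 1 \/ sg = -1 -> {ae leb2, forall z, 0 < z.1 ->
  tangent M (u (aff2 1 (- sg) 0 z)) (speedv sg z)}.
Proof.
move=> hsg; have [[_ uM] _ _ _] := hu.
pose al i (z : R * R) := speed sg i z * \1_halfplane z.
pose Q i j (z : R * R) := P (u z) i j * \1_halfplane z.
pose h i (z : R * R) : R := (\sum_(j < n) al j (aff2 1 (2 * sg) 0 z) * Q j i (aff2 1 sg 0 z)) - al i (aff2 1 (2 * sg) 0 z).
have mh i : measurable_fun [set: measurableTypeR R * measurableTypeR R] (h i).
  apply: measurable_funB.
    apply: measurable_sum => j; apply: measurable_funM.
      exact: (measurableT_comp (speed_measurable sg j) (measurable_aff2 _ _ _)).
    exact: (measurableT_comp (P_measurable j i) (measurable_aff2 _ _ _)).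
  exact: (measurableT_comp (speed_measurable sg i) (measurable_aff2 _ _ _)).
have hE i z : halfplane z -> h i z =
    (speedv sg (aff2 1 (2 * sg) 0 z) *m P (u (aff2 1 sg 0 z)) - speedv sg (aff2 1 (2 * sg) 0 z)) 0 i.
  move=> hz; rewrite /h /al /Q !mxE; congr (_ - _); last by rewrite indicE mem_set ?mulr1.
  by apply: eq_bigr => j _; rewrite !indicE !mem_set ?mulr1// mxE.
have main i : {ae leb2, forall z, 0 < z.1 -> h i z = 0}.
  pose S : set (measurableTypeR R * measurableTypeR R) := [set z | h i z * (0 < z.1)%R%:R = 0].
  have mS : measurable S.
    have mm : measurable_fun [set: measurableTypeR R * measurableTypeR R] (fun z => h i z * (0 < z.1)%R%:R).
      apply: measurable_funM => //; apply: measurable_pred; exact: measurable_fun_ltr.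
    by have := mm measurableT [set 0] (measurable_set1 0); rewrite setTI.
  suff : {ae leb2, forall z, S z}.
    by apply: ae2S => z; rewrite /S/= => + z0; rewrite z0 mulr1.
  apply: leb2_ae_slices2 => //; apply/aeW => x.
  apply: aeS (tangent_line x hsg) => s hs; rewrite /S/=.
  have [s0|s0] := ltP 0 s; rewrite ?mulr0// mulr1 hE; last exact: ltW.
  have Mu : M (u (s, x + sg * s)) by apply: uM; exact: ltW.
  have := (tangentP _ (hPproj Mu)).1 (hs s0).
  have -> : aff2 1 (2 * sg) 0 (s, x) = (s, 2 * sg * s + x) by rewrite /aff2/=; congr (_, _); ring.
  have -> : aff2 1 sg 0 (s, x) = (s, x + sg * s) by rewrite /aff2/=; congr (_, _); ring.
  by move=> ->; rewrite subrr mxE.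
have := ae_ord main.
move=> /(ae_aff2 (- (2 * sg)) 0 (oner_neq0 R)).
apply: ae2S => z hz z0.
have z0' : halfplane z by exact: ltW.
apply/(tangentP _ (hPproj (uM _ _))) => //.
apply/rowP => i; apply/eqP; rewrite -subr_eq0.
have := hz i z0; rewrite hE//.
have -> : aff2 1 (2 * sg) 0 (aff2 1 (- (2 * sg)) 0 z) = z by case: z {hz z0 z0'} => t x; rewrite /aff2/=; congr (_, _); ring.
have -> : aff2 1 sg 0 (aff2 1 (- (2 * sg)) 0 z) = aff2 1 (- sg) 0 z by rewrite /aff2/=; congr (_, _); ring.
by rewrite [X in X = 0 -> _]mxE [X in _ + X = 0 -> _]mxE => ->.
Qed.

End solution.

Section rhs.
Context {R : realType} {n : nat}.
Variables (M : set 'rV[R]_n).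
Variables (A : 'rV[R]_n -> 'rV[R]_n -> 'rV[R]_n -> 'rV[R]_n).
Variables (Gam : 'I_n -> 'I_n -> 'rV[R]_n -> 'rV[R]_n) (P : 'rV[R]_n -> 'M[R]_n).
Hypothesis hA : second_fundamental_form M A.
Hypothesis hGam : forall j k : 'I_n, bounded_lipschitz (Gam j k).
Hypothesis hGamA : forall p a b : 'rV[R]_n, M p -> tangent M p a -> tangent M p b ->
  \sum_(j < n) \sum_(k < n) (a 0 j * b 0 k) *: Gam j k p = A p a b.
Hypothesis hP : bounded_lipschitz P.
Hypothesis hPproj : forall p : 'rV[R]_n, M p -> orthogonal_projection M p (P p).
Variables (f u ut ux : R * R -> 'rV[R]_n).

Lemma rhs_null sg z : sg = 1 \/ sg = -1 ->
  let a := ut z + sg *: ux z in let b := ut z - sg *: ux z in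
  wave_map_rhs Gam P f u ut ux z =
  2^-1 *: (\sum_(j < n) \sum_(k < n) (a 0 j * b 0 k) *: Gam j k (u z) +
           \sum_(j < n) \sum_(k < n) (b 0 j * a 0 k) *: Gam j k (u z)) + f z *m P (u z).
Proof.
move=> hsg a b; rewrite /wave_map_rhs; congr (_ + _).
rewrite -big_split/= scaler_sumr; apply: eq_bigr => j _; rewrite -big_split/= scaler_sumr.
apply: eq_bigr => k _; rewrite -scalerDl scalerA; congr (_ *: _).
by rewrite /a /b !mxE; case: hsg => ->; field.
Qed.

Lemma rhs_dot sg z (t : 'rV[R]_n) : sg = 1 \/ sg = -1 -> M (u z) -> tangent M (u z) (ut z + sg *: ux z) ->
  tangent M (u z) (ut z - sg *: ux z) -> tangent M (u z) t ->
  dot t (wave_map_rhs Gam P f u ut ux z) = dot t (f z).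
Proof.
move=> hsg Mu ta tb tt; rewrite (rhs_null z hsg) !hGamA//.
have na := second_form_normal hA Mu (hPproj Mu) ta tb.
have nb := second_form_normal hA Mu (hPproj Mu) tb ta.
rewrite dotC dotDl dotZl dotDl na// nb// addr0 mulr0 add0r.
have := (hPproj Mu (f z)).2 _ tt; rewrite dotC dotBr => /eqP; rewrite subr_eq0 => /eqP ->.
by rewrite dotC.
Qed.

Lemma mx_entry_le p q (B : 'M[R]_(p, q)) i j : `|B i j| <= `|B|.
Proof. by rewrite [leRHS]/Num.Def.normr/= mx_normrE; exact: (le_bigmax _ (fun ij => `|B ij.1 ij.2|) (i, j)). Qed.

Lemma rhs_bound : exists2 C : R, 0 <= C & forall sg z i, sg = 1 \/ sg = -1 ->
  let a := ut z + sg *: ux z in let b := ut z - sg *: ux z in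
  `|wave_map_rhs Gam P f u ut ux z 0 i| <=
    C * ((\sum_j `|a 0 j|) * (\sum_k `|b 0 k|)) + C * \sum_j `|f z 0 j|.
Proof.
have [CP CP0 hCP] := bounded_setT hP.2.
have h j k : exists2 C : R, 0 <= C & forall x, `|Gam j k x| <= C := bounded_setT (hGam j k).2.
pose CG j k := sval (cid2 (h j k)).
have CGP j k : 0 <= CG j k /\ forall x, `|Gam j k x| <= CG j k by rewrite /CG; case: cid2.
pose C := CP + \sum_j \sum_k CG j k.
have S0 : 0 <= \sum_j \sum_k CG j k.
  by apply: sumr_ge0 => j _; apply: sumr_ge0 => k _; exact: (CGP j k).1.
have GC j k x i : `|Gam j k x 0 i| <= C.
  apply: le_trans (mx_entry_le _ _ _) _; apply: le_trans ((CGP j k).2 x) _.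
  rewrite /C (bigD1 j)//= (bigD1 k)//=.
  rewrite addrCA -addrA lerDl; apply: addr_ge0.
    by apply: sumr_ge0 => l _; exact: (CGP j l).1.
  by rewrite addr_ge0//; apply: sumr_ge0 => l _; apply: sumr_ge0 => m _; exact: (CGP l m).1.
have C0 : 0 <= C by rewrite addr_ge0.
exists C => // sg z i hsg; cbv zeta.
set a := ut z + sg *: ux z; set b := ut z - sg *: ux z.
have qb (c e : 'rV[R]_n) : `|(\sum_(j < n) \sum_(k < n) (c 0 j * e 0 k) *: Gam j k (u z)) 0 i| <=
    C * ((\sum_j `|c 0 j|) * (\sum_k `|e 0 k|)).
  rewrite summxE; apply: le_trans (ler_norm_sum _ _ _) _.
  rewrite mulr_suml mulr_sumr; apply: ler_sum => j _.
  rewrite summxE; apply: le_trans (ler_norm_sum _ _ _) _.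
  rewrite mulr_sumr mulr_sumr; apply: ler_sum => k _.
  by rewrite mxE !normrM mulrC ler_wpM2r// mulr_ge0.
rewrite (rhs_null z hsg) -/a -/b mxE; apply: le_trans (ler_normD _ _) _; apply: lerD.
  rewrite !mxE normrM ger0_norm ?invr_ge0//.
  apply: (@le_trans _ _ (2^-1 * (C * ((\sum_j `|a 0 j|) * (\sum_k `|b 0 k|)) + C * ((\sum_j `|b 0 j|) * (\sum_k `|a 0 k|))))).
    rewrite ler_wpM2l ?invr_ge0//; apply: le_trans (ler_normD _ _) _.
    by apply: lerD; exact: qb.
  rewrite [X in _ * (_ + _ * X)]mulrC; set X := C * _; lra.
rewrite mxE; apply: le_trans (ler_norm_sum _ _ _) _.
rewrite mulr_sumr; apply: ler_sum => j _; rewrite normrM mulrC ler_wpM2r//.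
apply: le_trans (mx_entry_le _ _ _) _; apply: le_trans (hCP _) _.
by rewrite lerDl.
Qed.

End rhs.

Section solution2.
Context {R : realType} {n : nat}.
Notation leb := (@leb R).
Notation leb2 := (@leb2 R).
Notation Int1 f := (leb.-integrable setT (fun x => (f x)%:E)).
Notation Int2 f := (leb2.-integrable setT (fun x => (f x)%:E)).
Variables (d : nat) (M : set 'rV[R]_n).
Variables (A : 'rV[R]_n -> 'rV[R]_n -> 'rV[R]_n -> 'rV[R]_n).
Variables (Gam : 'I_n -> 'I_n -> 'rV[R]_n -> 'rV[R]_n) (P : 'rV[R]_n -> 'M[R]_n).
Hypotheses (hM : embedded_submanifold d M) (hA : second_fundamental_form M A).
Hypothesis hGam : forall j k : 'I_n, bounded_lipschitz (Gam j k).
Hypothesis hGamA : forall p a b : 'rV[R]_n, M p -> tangent M p a -> tangent M p b ->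
  \sum_(j < n) \sum_(k < n) (a 0 j * b 0 k) *: Gam j k p = A p a b.
Hypothesis hP : bounded_lipschitz P.
Hypothesis hPproj : forall p : 'rV[R]_n, M p -> orthogonal_projection M p (P p).
Variables (u0 v0 : R -> 'rV[R]_n) (f u ut ux : R * R -> 'rV[R]_n).
Hypothesis hf : vintegrable leb2 halfplane f.
Hypothesis hu : mild_solution M Gam P u0 v0 f u ut ux.
Variables (k0 : 'I_n -> R) (D : 'I_n -> R -> R).
Hypothesis vi : forall i, Int1 (fun x => v0 x 0 i).
Hypothesis Di : forall i, Int1 (D i).
Hypothesis hu0 : forall i x, u0 x 0 i = k0 i + prim (D i) x.

Let F i (z : R * R) : R := wave_map_rhs Gam P f u ut ux z 0 i.
Let e := edge v0 D.
Let spd := speed Gam P v0 f u ut ux D.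
Let spdv := speedv Gam P v0 f u ut ux D.

Lemma aff2K1 c (z : R * R) : aff2 1 (- c) 0 (aff2 1 c 0 z) = z.
Proof. by case: z => t x; rewrite /aff2/=; congr (_, _); ring. Qed.

Lemma null_speed sg : sg = 1 \/ sg = -1 -> {ae leb2, forall z, 0 < z.1 ->
  ut z + sg *: ux z = spdv sg (aff2 1 sg 0 z)}.
Proof.
move=> hsg; have := ae_aff2 sg 0 (oner_neq0 R) (char_ae_vec hu vi Di hu0 hsg).
by apply: ae2S => z h z0; have := h z0; rewrite aff2K1.
Qed.

Lemma null_tangent sg : sg = 1 \/ sg = -1 -> {ae leb2, forall z, 0 < z.1 ->
  tangent M (u z) (ut z + sg *: ux z)}.
Proof.
move=> hsg; have := ae_aff2 sg 0 (oner_neq0 R) (speed_tangent hM hP hPproj hu vi Di hu0 hsg).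
move=> h; have := ae2S2 _ h (null_speed hsg); apply => z h1 h2 z0.
by rewrite h2//; have := h1 z0; rewrite aff2K1.
Qed.

Lemma rhs_dot_ae sg : sg = 1 \/ sg = -1 -> {ae leb2, forall z, 0 < z.1 ->
  \sum_i spd sg i z * F i (aff2 1 (- sg) 0 z) = \sum_i spd sg i z * f (aff2 1 (- sg) 0 z) 0 i}.
Proof.
move=> hsg; have hsg' : - sg = 1 \/ - sg = -1 by case: hsg => ->; [right|left; rewrite opprK].
have h0 := ae2S2 (fun z a b => conj a b) (null_tangent hsg) (null_tangent hsg').
have h1 := ae_aff2 (- sg) 0 (oner_neq0 R) h0.
have := ae2S2 _ h1 (char_ae_vec hu vi Di hu0 hsg); apply => z [ta tb] E z0.
have [[_ uM] _ _ _] := hu.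
have Mu : M (u (aff2 1 (- sg) 0 z)) by apply: uM; exact: ltW.
have := rhs_dot hA hGamA hPproj f hsg Mu (ta z0) _ (ta z0).
rewrite -scaleNr => /(_ (tb z0)); rewrite E//.
by rewrite /dot; under eq_bigr do rewrite mxE; under [in RHS]eq_bigr do rewrite mxE.
Qed.

Definition fsum (z : R * R) : R := \sum_(i < n) `|f z 0 i * \1_halfplane z|.

Lemma fsum_Int2 : Int2 fsum.
Proof.
apply: Int2_sum => i; apply: Int2_abs.
by apply/(Int_indic leb2 (fun z => f z 0 i) (@measurable_halfplane R)); exact: hf.
Qed.

Definition maxspeed sg (xi : R) : R :=
  \sum_i `|e sg i xi| + 2 * \int[leb]_s fsum (aff2 1 (- sg) 0 (s, xi)).

Lemma maxspeed_Int1 sg : Int1 (maxspeed sg).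
Proof.
apply: Int1D; first by apply: Int1_sum => i; apply: Int1_abs; exact: edge_Int1.
by apply: Int1Z; exact: (Int2_int2 (Int2_aff2 (- sg) 0 (oner_neq0 R) fsum_Int2)).
Qed.

Lemma speed_le sg : sg = 1 \/ sg = -1 ->
  {ae leb, forall xi, forall t i, 0 <= t -> `|spd sg i (t, xi)| <= maxspeed sg xi}.
Proof.
move=> hsg.
have h1 := ae_slice2 (rhs_dot_ae hsg).
have h2 : {ae leb, forall xi, forall q : nat * 'I_n,
    Int1 (fun s => charF sg (F q.2) (s, xi) * \1_(quad q.1) (s, xi))}.
  apply: ae_count => q.
  by have := Int2_slice2 (locint_shear (- sg) (rhs_locint hu q.2) q.1).
have h3 : {ae leb, forall xi, Int1 (fun s => fsum (aff2 1 (- sg) 0 (s, xi)))}.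
  by have := Int2_slice2 (Int2_aff2 (- sg) 0 (oner_neq0 R) fsum_Int2).
have h23 := aeS2 (fun z a b => conj a b) h2 h3.
have := aeS2 _ h1 h23; apply => xi H1 [H2 H3] t i t0.
pose N := (Num.truncn (t + `|xi|)).+1.
have hN : t + `|xi| < N%:R by exact: truncnS_gt.
have tN : t <= N%:R by apply: le_trans (ltW hN); rewrite lerDl.
have qE s : \1_(quad N) (s, xi) = \1_`[0, N%:R] s :> R.
  rewrite !indicE; congr (nat_of_bool _)%:R.
  have hx : `|xi| <= N%:R by apply: le_trans (ltW hN); rewrite lerDr.
  apply/idP/idP => /set_mem.
    by move=> /quad_in[/= s0 sN _]; rewrite inE/= in_itv/= s0.
  by rewrite /= in_itv/= => /andP[s0 sN]; apply/mem_set/quad_in.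
pose p i s := charF sg (F i) (s, xi) * \1_`[0, N%:R] s.
have pI j : Int1 (p j).
  by have := H2 (N, j); rewrite /=; under eq_fun do rewrite qE.
have p0 j s : s < 0 -> p j s = 0.
  by move=> s0; rewrite /p indicE memNset ?mulr0//= in_itv/= leNgt s0.
pose g s := fsum (aff2 1 (- sg) 0 (s, xi)).
have g0 s : 0 <= g s by exact: sumr_ge0.
have aE j s : 0 <= s <= N%:R -> e sg j xi + prim (p j) s = spd sg j (s, xi).
  move=> hs; rewrite /spd /speed /charA /= (@primitive_quad _ (charF sg (F j)) N%:R xi)//.
  exact: pI.
have key : {ae leb, forall s, 0 <= s -> \sum_(j < n) (e sg j xi + prim (p j) s) * p j s <=
    Num.sqrt (\sum_(j < n) (e sg j xi + prim (p j) s) ^+ 2) * g s}.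
  have := aeS2 _ H1 (ae_neq (0 : R)); apply => s hs sn0 s0.
  have sp : 0 < s by rewrite lt_neqAle eq_sym sn0.
  have [sN|sN] := leP s N%:R; last first.
    rewrite big1 ?mulr_ge0 ?sqrtr_ge0// => j _.
    by rewrite /p indicE memNset ?mulr0//= in_itv/= [s <= _]leNgt sN andbF.
  have sI : 0 <= s <= N%:R by rewrite s0.
  under eq_bigr do rewrite aE//; under [X in _ <= Num.sqrt X * _]eq_bigr do rewrite aE//.
  have pE j : p j s = F j (aff2 1 (- sg) 0 (s, xi)).
    by rewrite /p indicE mem_set ?mulr1//= in_itv.
  under eq_bigr do rewrite pE; rewrite (hs sp) /g /fsum mulr_sumr.
  apply: ler_sum => j _; apply: le_trans (ler_norm _) _; rewrite normrM.
  apply: ler_pM => //; first exact: (le_sqrt_sum (fun j => spd sg j (s, xi))).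
  by rewrite indicE mem_set ?mulr1.
have := energy1 (a0 := fun j => e sg j xi) pI p0 H3 g0 key t0.
have tI : 0 <= t <= N%:R by rewrite t0.
under eq_bigr do rewrite aE//.
move=> /(le_trans (le_sqrt_sum (fun j => spd sg j (t, xi)) i)) /le_trans; apply.
by rewrite lerD2r; exact: sqrt_sum_le.
Qed.

Lemma null_le sg : sg = 1 \/ sg = -1 -> {ae leb2, forall z, forall i, 0 < z.1 ->
  `|(ut z + sg *: ux z) 0 i| <= maxspeed sg (z.2 + sg * z.1)}.
Proof.
move=> hsg; have h := ae_aff2 sg 0 (oner_neq0 R) (ae_snd (speed_le hsg)).
have := ae2S2 _ h (null_speed hsg); apply => z H E i z0.
have -> : z.2 + sg * z.1 = (aff2 1 sg 0 z).2 by rewrite /= mul1r addr0.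
by rewrite E// mxE; exact: (H z.1 i (ltW z0)).
Qed.

Lemma maxspeed_ge0 sg xi : 0 <= maxspeed sg xi.
Proof.
rewrite addr_ge0 ?sumr_ge0// mulr_ge0//; apply: Rintegral_ge0 => // s _; exact: sumr_ge0.
Qed.

Lemma maxspeed_prod_Int2 : Int2 (fun z => maxspeed 1 (z.2 + z.1) * maxspeed (- 1) (z.2 - z.1)).
Proof.
have n2 : (- 2 : R) != 0 by rewrite oppr_eq0 pnatr_eq0.
have := Int2_aff2 1 0 (oner_neq0 R) (Int2_swap (Int2_aff2 1 0 n2
  (Int2M (maxspeed_Int1 1) (maxspeed_Int1 (- 1))))).
congr (_.-integrable _ _); apply/funext => z /=; congr (maxspeed 1 _ * maxspeed (- 1) _)%:E; rewrite /aff2/=; ring.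
Qed.

Lemma rhs_Int2 i : Int2 (fun z => F i z * \1_halfplane z).
Proof.
have [C C0 hC] := rhs_bound hGam hP f u ut ux.
pose m : R := n%:R.
pose H z := C * m ^+ 2 * (maxspeed 1 (z.2 + z.1) * maxspeed (- 1) (z.2 - z.1)) + C * fsum z.
have HI : Int2 H by apply: Int2D; apply: Int2Z; [exact: maxspeed_prod_Int2|exact: fsum_Int2].
have H0 z : 0 <= H z.
  apply: addr_ge0; apply: mulr_ge0 => //; last exact: sumr_ge0.
    by rewrite mulr_ge0// sqr_ge0.
  by apply: mulr_ge0; exact: maxspeed_ge0.
apply: (Int2_le_ae _ _ HI); first exact: locint_measurable (rhs_locint hu i).
have hz := ae_fst (ae_neq (0 : R)).
have h1 := null_le (or_introl erefl : (1 : R) = 1 \/ (1 : R) = -1).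
have h2 := null_le (or_intror erefl : (- 1 : R) = 1 \/ (- 1 : R) = -1).
have h12 := ae2S2 (fun z a b => conj a b) h1 h2.
have := ae2S2 _ hz h12; apply => z zn0 [H1 H2].
rewrite (ger0_norm (H0 z)).
have [h|h] := pselect (halfplane z); last by rewrite indicE memNset ?mulr0 ?normr0.
have z0 : 0 < z.1 by rewrite lt_neqAle eq_sym zn0.
have fE : \sum_j `|f z 0 j| = fsum z.
  by apply: eq_bigr => j _; rewrite indicE mem_set ?mulr1.
rewrite indicE mem_set// mulr1.
apply: le_trans (hC 1 z i (or_introl erefl)) _; rewrite fE lerD2r -mulrA ler_wpM2l//.
apply: (@le_trans _ _ ((m * maxspeed 1 (z.2 + z.1)) * (m * maxspeed (-1) (z.2 - z.1)))); last first.
  by rewrite le_eqVlt; apply/orP; left; apply/eqP; ring.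
have sb (g : 'I_n -> R) (B : R) : (forall j, g j <= B) -> \sum_j g j <= m * B.
  move=> gB; apply: (@le_trans _ _ (\sum_(j < n) B)); first exact: ler_sum.
  by rewrite sumr_const card_ord mulr_natl.
apply: ler_pM; rewrite ?sumr_ge0//; apply: sb => j.
  by have := H1 j z0; rewrite !mul1r.
by have := H2 j z0; rewrite !scaleN1r scale1r mulN1r.
Qed.

End solution2.

Section translation.
Context {R : realType}.
Notation leb := (@leb R).
Notation leb2 := (@leb2 R).
Notation Int1 f := (leb.-integrable setT (fun x => (f x)%:E)).
Notation Int2 f := (leb2.-integrable setT (fun x => (f x)%:E)).

Lemma dct1_ae (F : nat -> R -> R) (f g : R -> R) :
  (forall n, measurable_fun [set: measurableTypeR R] (F n)) ->
  measurable_fun [set: measurableTypeR R] f ->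
  {ae leb, forall x, F n x @[n --> \oo] --> f x} -> Int1 g ->
  (forall n, {ae leb, forall x, `|F n x| <= g x}) ->
  \int[leb]_x F n x @[n --> \oo] --> \int[leb]_x f x.
Proof.
move=> mF mf Ff gi Fg.
have [] := @dominated_convergence _ _ R leb setT measurableT
  (fun n x => (F n x)%:E) (fun x => (f x)%:E) (fun x => (g x)%:E).
- by move=> n; exact/measurable_EFinP.
- exact/measurable_EFinP.
- by apply: aeS Ff => x h _; apply: cvg_EFin; [exact: nearW|exact: h].
- exact: gi.
- by apply: aeS (ae_count Fg) => x h n _; rewrite /= lee_fin.
move=> fi _ h.
rewrite /Rintegral; apply: fine_cvg; rewrite fineK//.
exact: integrable_fin_num.
Qed.

Lemma translate_measurable (k : R -> R) h : measurable_fun [set: measurableTypeR R] k ->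
  measurable_fun [set: measurableTypeR R] (fun x => k (x + h)).
Proof.
move=> mk; have := measurableT_comp mk (measurable_affine 1 h).
by congr measurable_fun; apply/funext => x /=; rewrite mul1r.
Qed.

Lemma translate_Int1 (k : R -> R) h : Int1 k -> Int1 (fun x => k (x + h)).
Proof.
by move=> ki; have := Int1_affine h (oner_neq0 R) ki; under eq_fun do rewrite mul1r.
Qed.

Lemma translate_int (k : R -> R) h : Int1 k -> \int[leb]_x k (x + h) = \int[leb]_x k x.
Proof.
move=> ki; have := integral_affine h (oner_neq0 R) ki.
by under eq_Rintegral do rewrite mul1r; rewrite normr1 invr1 mul1r.
Qed.

Lemma translation_bounded (k : R -> R) (C N : R) :
  measurable_fun [set: measurableTypeR R] k -> (forall x, `|k x| <= C) ->
  (forall x, N < `|x| -> k x = 0) -> {ae leb, forall x : R, {for x, continuous k}} ->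
  \int[leb]_x `|k (x + h) - k x| @[h --> (0 : R)^'] --> (0 : R).
Proof.
move=> mk kC kN kc; apply/cvgr_dnbhsP => a [_ a0].
have [m hm] : exists m : nat, forall n, `|a (n + m)%N| <= 1.
  have /cvgrPdist_le/(_ _ ltr01) [m _ H] := a0; exists m => n.
  by have := H (n + m)%N; rewrite /= sub0r normrN; apply; exact: leq_addl.
rewrite -(cvg_shiftn m)/=.
suff : \int[leb]_x `|k (x + a (n + m)%N) - k x| @[n --> \oo] --> \int[leb]_x (cst 0 x : R).
  by rewrite Rintegral_cst// mul0r.
pose B x := 2 * C * \1_`[- (`|N| + 1), `|N| + 1] x.
apply: (@dct1_ae _ _ B).
- move=> n; apply: measurableT_comp => //; apply: measurable_funB => //.
  exact: translate_measurable.
- exact: measurable_cst.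
- apply: aeS kc => x kx.
  rewrite (_ : 0 = `|k x - k x|); last by rewrite subrr normr0.
  apply: cvg_norm; apply: cvgB; last exact: cvg_cst.
  have ha : x + a (n + m)%N @[n --> \oo] --> x.
    rewrite -[X in _ --> X]addr0; apply: cvgD; first exact: cvg_cst.
    by rewrite (cvg_shiftn m a).
  exact: (@cvg_comp _ _ _ (fun n => x + a (n + m)%N) k _ (nbhs x) _ ha kx).
- by apply: Int1Z; exact: Int1_indic_itv.
- move=> n; apply: aeW => x; rewrite normr_id /B.
  have [xN|xN] := leP `|x| (`|N| + 1).
    rewrite indicE mem_set/= ?in_itv/= -?ler_norml// mulr1.
    by apply: le_trans (ler_normB _ _) _; have := kC x; have := kC (x + a (n + m)%N); lra.
  have NN := ler_norm N.
  have C0 : 0 <= C by apply: le_trans (kC 0); exact: normr_ge0.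
  have k1 : k x = 0 by apply: kN; lra.
  have k2 : k (x + a (n + m)%N) = 0.
    apply: kN; have := hm n; have := ler_normB (x + a (n + m)%N) (a (n + m)%N).
    by rewrite addrK; lra.
  by rewrite k1 k2 subrr normr0; apply: mulr_ge0; [exact: mulr_ge0|rewrite indicE].
Qed.

Lemma Int1_tail (g : R -> R) (e : R) : Int1 g -> 0 < e ->
  exists N : nat, \int[leb]_x `|g x - g x * \1_`[- N%:R, N%:R] x| < e.
Proof.
move=> gi e0; have mg := Int1_measurable gi.
have : \int[leb]_x `|g x - g x * \1_`[- n%:R, n%:R] x| @[n --> \oo] --> (0 : R).
  suff : \int[leb]_x `|g x - g x * \1_`[- n%:R, n%:R] x| @[n --> \oo] --> \int[leb]_x (cst 0 x : R).
    by rewrite Rintegral_cst// mul0r.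
  apply: (@dct1_ae _ _ (fun x => `|g x|)).
  - move=> n; apply: measurableT_comp => //; apply: measurable_funB => //.
    by apply: measurable_funM => //; exact: measurable_indic.
  - exact: measurable_cst.
  - apply: aeW => x; apply: cvg_near_cst.
    exists (Num.truncn `|x|).+1 => // n /= hn.
    rewrite indicE mem_set ?mulr1 ?subrr ?normr0//= in_itv/= -ler_norml.
    by apply: le_trans (ltW (truncnS_gt _)) _; rewrite ler_nat.
  - exact: Int1_abs.
  - move=> n; apply: aeW => x; rewrite normr_id.
    by have [->|->] := @indic01 R _ `[- n%:R, n%:R]%classic x; rewrite ?mulr0 ?mulr1 ?subr0 ?subrr ?normr0.
move=> /cvgrPdist_lt/(_ _ e0)[N _ H]; exists N.
by have := H N (leqnn N); rewrite /= sub0r normrN ger0_norm//; exact: Rintegral_ge0.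
Qed.

Lemma Int1_approx (g : R -> R) (e : R) : Int1 g -> 0 < e ->
  exists k : R -> R, [/\ Int1 k, \int[leb]_x `|g x - k x| < e &
    \int[leb]_x `|k (x + h) - k x| @[h --> (0 : R)^'] --> (0 : R)].
Proof.
move=> gi e0; have e20 : 0 < e / 2 by rewrite divr_gt0.
have [N hN] := Int1_tail gi e20.
pose E : set (measurableTypeR R) := `[- N%:R, N%:R]%classic.
have [h_ [hc hi /fine_cvgP[_ /cvgrPdist_lt/(_ _ e20)[m _ Hm]]]] : exists g_ : nat -> R -> R,
    [/\ forall n, continuous (g_ n), forall n, leb.-integrable E (fun x => (g_ n x)%:E) &
     (\int[leb]_(z in E) `|(g z - g_ n z)%:E|)%E @[n --> \oo] --> 0%E].
  apply: (@approximation_continuous_integrable R E g); first exact: measurable_itv.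
    by rewrite [X in (X < _)%E]lebesgue_measure_itv/=; case: ifP => _; rewrite ltry.
  by have := Int1_itv `[- N%:R, N%:R] gi.
pose k x := h_ m x * \1_E x.
have ki : Int1 k by apply/(Int_indic leb (h_ m)); [exact: measurable_itv|exact: hi].
have [C hC] : exists C, forall x, `|k x| <= C.
  have NN : - N%:R <= N%:R :> R by apply: (le_trans _ (ler0n R N)); rewrite oppr_le0.
  have cN : {within `[- N%:R, N%:R], continuous (fun x => `|h_ m x|)}.
    by apply: continuous_subspaceT => x; apply: cvg_norm; exact: hc.
  have [c _ H] := EVT_max NN cN.
  exists `|h_ m c| => x; rewrite /k indicE; have [xE|xE] := boolP (x \in E); last by rewrite mulr0 normr0.
  by rewrite mulr1; apply: H; move: xE; rewrite inE.
exists k; split => //.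
- have gI : Int1 (fun x => `|g x - g x * \1_`[- N%:R, N%:R] x|).
    by apply: Int1_abs; apply: Int1B => //; exact: Int1_indicM.
  have hI : Int1 (fun x => `|g x * \1_`[- N%:R, N%:R] x - k x|).
    by apply: Int1_abs; apply: Int1B => //; exact: Int1_indicM.
  have := Hm m (leqnn m); rewrite /= sub0r normrN ger0_norm; last by rewrite fine_ge0// integral_ge0.
  rewrite -[fine _]/(\int[leb]_(z in E) `|g z - h_ m z|) int_indic => hh.
  apply: (@le_lt_trans _ _ (\int[leb]_x `|g x - g x * \1_`[- N%:R, N%:R] x| + \int[leb]_x `|g x * \1_`[- N%:R, N%:R] x - k x|)).
    rewrite -RintegralD//; apply: int_le; [by apply: Int1_abs; exact: Int1B|exact: Int1D|].
    by apply: aeW => x; exact: ler_distD.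
  rewrite [ltRHS]splitr; apply: ltrD => //; apply: le_lt_trans hh.
  rewrite le_eqVlt; apply/orP; left; apply/eqP/eq_Rintegral => x _.
  by rewrite /k -mulrBl normrM; have [->|->] := @indic01 R _ E x; rewrite ?normr0 ?normr1.
- apply: (@translation_bounded k C N%:R) => //; first exact: Int1_measurable.
    move=> x xN; rewrite /k indicE memNset ?mulr0// /E/= in_itv/= -ler_norml.
    by apply/negP; rewrite -ltNge.
  apply: aeS2 (ae_neq N%:R) (ae_neq (- N%:R)) => x xN xN'.
  have [xi|xi] := ltP `|x| N%:R.
    have : \forall y \near x, h_ m y = k y.
      have : nbhs x `]- N%:R, N%:R[%classic.
        by apply: open_nbhs_nbhs; split; [exact: interval_open|rewrite /= in_itv/= -ltr_norml].
      apply: filterS => y /=; rewrite in_itv/= => /andP[y1 y2].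
      by rewrite /k indicE mem_set ?mulr1// /E/= in_itv/= !ltW.
    move=> hk; have kx : h_ m x = k x := nbhs_singleton hk.
    have ch : h_ m y @[y --> x] --> k x by rewrite -kx; exact: hc.
    by apply: cvg_trans ch; apply: near_eq_cvg; exact: hk.
  have Nx : N%:R < `|x|.
    rewrite lt_neqAle xi andbT; apply/eqP => NE.
    have [x0|x0] := leP 0 x; first by move: xN; rewrite NE ger0_norm// eqxx.
    by move: xN'; rewrite NE ltr0_norm// opprK eqxx.
  have hk : \forall y \near x, 0 = k y.
    have : nbhs x [set y | N%:R < `|y|].
      apply: open_nbhs_nbhs; split => //.
      by apply: (@open_comp _ _ (fun y : R => `|y|) [set z | N%:R < z]); [move=> y _; exact: norm_continuous|exact: open_gt].
    apply: filterS => y /= Ny; rewrite /k indicE memNset ?mulr0// /E/= in_itv/= -ler_norml.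
    by apply/negP; rewrite -ltNge.
  have kx : 0 = k x := nbhs_singleton hk.
  have ch : (fun=> 0 : R) y @[y --> x] --> k x by rewrite -kx; exact: cvg_cst.
  by apply: cvg_trans ch; apply: near_eq_cvg; exact: hk.
Qed.

Lemma translation_L1 (g : R -> R) (e : R) : Int1 g -> 0 < e ->
  exists2 dl : R, 0 < dl & forall h, `|h| < dl -> \int[leb]_x `|g (x + h) - g x| < e.
Proof.
move=> gi e0; have e30 : 0 < e / 4 by rewrite divr_gt0.
have [k [ki gk kc]] := Int1_approx gi e30.
have /cvgrPdist_lt/(_ _ e30)[dl dl0 H] := kc; exists dl => // h hd.
have kh : \int[leb]_x `|k (x + h) - k x| < e / 4.
  have [->|h0] := eqVneq h 0.
    by under eq_Rintegral do rewrite addr0 subrr normr0; rewrite Rintegral_cst// mul0r.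
  have := H h; rewrite /= sub0r normrN => /(_ hd h0); rewrite sub0r normrN ger0_norm//.
  exact: Rintegral_ge0.
have I0 : Int1 (fun x => `|g x - k x|) by apply: Int1_abs; exact: Int1B.
have I1 : Int1 (fun x => `|g (x + h) - k (x + h)|) by exact: (translate_Int1 h I0).
have I2 : Int1 (fun x => `|k (x + h) - k x|) by apply: Int1_abs; apply: Int1B => //; exact: translate_Int1.
have I3 : Int1 (fun x => `|g (x + h) - g x|) by apply: Int1_abs; apply: Int1B => //; exact: translate_Int1.
apply: (@le_lt_trans _ _ (\int[leb]_x (`|g (x + h) - k (x + h)| + `|k (x + h) - k x| + `|g x - k x|))).
  apply: int_le => //; first by apply: Int1D => //; exact: Int1D.
  apply: aeW => x; apply: le_trans (ler_distD (k x) _ _) _; rewrite [X in _ + X]distrC lerD2r.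
  exact: ler_distD.
rewrite RintegralD; [|exact: measurableT|exact: Int1D|exact: I0].
rewrite RintegralD; [|exact: measurableT|exact: I1|exact: I2].
have := translate_int h I0 => /= ->; lra.
Qed.

End translation.

Section travelling.
Context {R : realType}.
Notation leb := (@leb R).
Notation leb2 := (@leb2 R).
Notation Int1 f := (leb.-integrable setT (fun x => (f x)%:E)).
Notation Int2 f := (leb2.-integrable setT (fun x => (f x)%:E)).

Lemma normLp1_le n (g : R -> 'rV[R]_n) : vintegrable leb setT g ->
  (normLp 1 g <= (\sum_i \int[leb]_x `|g x 0 i|)%:E)%E.
Proof.
move=> gi; rewrite /normLp Lnorm1.
have ai i : Int1 (fun x => `|g x 0 i|) by apply: Int1_abs; exact: gi.
rewrite -int_sum// /Rintegral fineK; last by apply: integrable_fin_num => //; exact: Int1_sum.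
apply: ge0_le_integral => //.
- apply/measurable_EFinP; apply: measurableT_comp => //.
  rewrite (_ : (fun _ => _) = (fun x => Num.sqrt (\sum_(i < n) g x 0 i ^+ 2))); last first.
    by apply/funext => x; rewrite enormE.
  apply: (measurableT_comp (continuous_measurable_fun (@sqrt_continuous R))).
  apply: measurable_sum => i; apply: measurable_funX; exact: Int1_measurable (gi i).
- by have := Int1_sum ai => /measurable_int.
- by move=> x _; rewrite lee_fin ger0_norm ?enorm_ge0// enorm_le_sum.
Qed.

Lemma le_normLp1 n (g : R -> 'rV[R]_n) i : vintegrable leb setT g ->
  ((\int[leb]_x `|g x 0 i|)%:E <= normLp 1 g)%E.
Proof.
move=> gi; rewrite /normLp Lnorm1.
have ai j : Int1 (fun x => `|g x 0 j|) by apply: Int1_abs; exact: gi.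
rewrite /Rintegral fineK; last exact: integrable_fin_num.
apply: ge0_le_integral => //.
- by have := ai i => /measurable_int.
- apply/measurable_EFinP; apply: measurableT_comp => //.
  rewrite (_ : (fun _ => _) = (fun x => Num.sqrt (\sum_(i < n) g x 0 i ^+ 2))); last first.
    by apply/funext => x; rewrite enormE.
  apply: (measurableT_comp (continuous_measurable_fun (@sqrt_continuous R))).
  apply: measurable_sum => j; apply: measurable_funX; exact: Int1_measurable (gi j).
- by move=> x _; rewrite lee_fin ger0_norm ?enorm_ge0// le_enorm.
Qed.

Lemma normLpy_le n (g : R -> 'rV[R]_n) (C : R) : (forall x, enorm (g x) <= C) ->
  (normLp +oo%E g <= C%:E)%E.
Proof.
move=> gC; rewrite /normLp Lnorm.unlock.
have C0 : 0 <= C by apply: le_trans (gC 0); exact: enorm_ge0.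
case: ifPn => // _.
apply/ess_sup_inf.ess_supP; apply: aeW => x /=; rewrite lee_fin ger0_norm ?enorm_ge0//.
Qed.

Lemma prim_translate (g : R -> R) h x : Int1 g -> prim g (x + h) = prim (fun y => g (y + h)) x.
Proof.
move=> gi; rewrite /prim [LHS]int_indic [RHS]int_indic.
rewrite -(translate_int h (Int1_indicM `]-oo, x + h] gi)); apply: eq_Rintegral => y _.
by congr (_ * _); rewrite !indicE !mem_setE/= !in_itv/= lerD2r.
Qed.

Lemma prim_reflect (g : R -> R) x t : Int1 g ->
  prim g (x - t) = \int[leb]_y g y - prim (fun y => g (x - y)) t.
Proof.
move=> gi.
have N1 : (- 1 : R) != 0 by rewrite oppr_eq0 oner_eq0.
have ri : Int1 (fun y => g (x - y)).
  by have := Int1_affine x N1 gi; under eq_fun do rewrite mulN1r addrC.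
have E1 : \int[leb]_y g y = \int[leb]_y g (x - y).
  have := integral_affine x N1 gi; rewrite normrN1 invr1 mul1r => <-.
  by apply: eq_Rintegral => y _; rewrite mulN1r addrC.
rewrite E1 {1}/prim [in LHS]int_indic.
have := integral_affine x N1 (Int1_indicM `]-oo, x - t] gi); rewrite normrN1 invr1 mul1r => <-.
rewrite /prim -Rintegral_itv_bndo_bndc; last exact: Int1_itv.
rewrite [X in _ = _ - X]int_indic -RintegralB//; last exact: (Int1_indicM `]-oo, t[ ri).
apply: eq_Rintegral => y _; rewrite mulN1r [- y + x]addrC !indicE !mem_setE/= !in_itv/=.
by rewrite lerD2l lerN2 leNgt; case: ltP; rewrite ?mulr1 ?mulr0 ?subrr ?subr0.
Qed.

Section test.
Variables (phi : R * R -> R).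
Hypothesis tphi : test_function phi.

Lemma test_diff z : differentiable phi z.
Proof. by have [sm _] := tphi; have [h _] := sm 1%N; exact: h. Qed.

Lemma test_cont : continuous phi.
Proof. by move=> z; exact/differentiable_continuous/test_diff. Qed.

Lemma test_dcont v : continuous ('D_v phi).
Proof. by move=> z; have [sm _] := tphi; have [_ h] := sm 1%N; exact: (h v). Qed.

Lemma test_support : exists N : nat, forall z v, ~ (quad N z /\ 0 < z.1) -> phi z = 0 /\ 'D_v phi z = 0.
Proof.
have [_ [C [cC C0] Cout]] := tphi.
have [B [_ HB]] := compact_bounded cC.
pose N := (Num.truncn (`|B| + 1)).+1.
have hN z : C z -> `|z| <= N%:R.
  move=> Cz; apply: le_trans (ltW (truncnS_gt _)).
  by apply: HB => //; rewrite (le_lt_trans (ler_norm B))// ltrDl.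
exists N => z v nz.
have nC : ~ C z.
  move=> Cz; apply: nz; split; last exact: C0.
  have := hN z Cz; rewrite /Num.Def.normr/= ge_max => /andP[h1 h2].
  apply/quad_in; split => //; first exact/ltW/C0.
  by apply: le_trans h1; exact: ler_norm.
split; first exact: Cout.
have oC : open (~` C) by apply: closed_openC; exact: compact_closed.
have hz : \forall y \near z, cst 0 y = phi y.
  have : nbhs z (~` C) by exact: open_nbhs_nbhs.
  by apply: filterS => y /Cout ->.
by rewrite -(near_eq_derive v hz) derive_cst.
Qed.

Lemma cont_quad_bounded (psi : R * R -> R) N : continuous psi -> (forall z, ~ quad N z -> psi z = 0) ->
  exists C, forall z, `|psi z| <= C.
Proof.
move=> cpsi out.
have [B [_ HB]] : bounded_set (psi @` quad N).
  apply: compact_bounded; apply: continuous_compact; last exact: compact_quad.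
  exact: continuous_subspaceT.
exists (`|B| + 1) => z; have [h|h] := pselect (quad N z); last first.
  by rewrite out// normr0 addr_ge0.
by apply: HB; [rewrite (le_lt_trans (ler_norm B))// ltrDl|exists z].
Qed.

Lemma locint_cont_mul (w psi : R * R -> R) N : locint w -> continuous psi ->
  (forall z, ~ quad N z -> psi z = 0) -> Int2 (fun z => w z * psi z).
Proof.
move=> wl cpsi out; have [C hC] := cont_quad_bounded cpsi out.
by apply: (locint_mul wl _ hC out); exact: continuous_measurable2.
Qed.

Lemma test_derive1 (t x : R) : is_derive x (1 : R) (fun y => phi (t, y)) ('D_(0, 1) phi (t, x)).
Proof.
have dv : derivable phi (t, x) (0, 1) by apply: diff_derivable; exact: test_diff.
have E : (fun h : R => h^-1 *: (phi (t, h *: 1 + x) - phi (t, x))) =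
         (fun h : R => h^-1 *: (phi (h *: (0, 1) + (t, x)) - phi (t, x))).
  apply/funext => h; congr (_ *: (phi _ - _)).
  by rewrite [RHS](_ : _ = (h * 0 + t, h * 1 + x))// mulr0 add0r.
by split; [rewrite /derivable /= E; exact: dv|rewrite /derive /= E].
Qed.

Lemma test_derive0 (t x : R) : is_derive t (1 : R) (fun y => phi (y, x)) ('D_(1, 0) phi (t, x)).
Proof.
have dv : derivable phi (t, x) (1, 0) by apply: diff_derivable; exact: test_diff.
have E : (fun h : R => h^-1 *: (phi (h *: 1 + t, x) - phi (t, x))) =
         (fun h : R => h^-1 *: (phi (h *: (1, 0) + (t, x)) - phi (t, x))).
  apply/funext => h; congr (_ *: (phi _ - _)).
  by rewrite [RHS](_ : _ = (h * 1 + t, h * 0 + x))// mulr0 add0r.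
by split; [rewrite /derivable /= E; exact: dv|rewrite /derive /= E].
Qed.

Lemma locint_line (g : R -> R) sg : Int1 g -> locint (fun z => g (z.2 + sg * z.1)).
Proof.
move=> gi; have := locint_shear sg (locint_snd gi).
by congr locint; apply/funext => z; rewrite /aff2/= mul1r addr0.
Qed.

Lemma locint_prim_line (g : R -> R) c sg : Int1 g -> locint (fun z => c + prim g (z.2 + sg * z.1)).
Proof.
move=> gi; apply: within_locint; apply: continuous_subspaceT => z.
apply: cvgD; first exact: cvg_cst.
apply: (@continuous_comp _ _ _ (fun z : R * R => z.2 + sg * z.1) (prim g)); last exact: prim_continuous.
by apply: cvgD; [exact: cvg_snd|apply: cvgM; [exact: cvg_cst|exact: cvg_fst]].
Qed.

Lemma half_test (w psi : R * R -> R) N : (forall z, ~ (quad N z /\ 0 < z.1) -> psi z = 0) ->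
  \int[leb2]_(z in halfplane) (w z * psi z) = \int[leb2]_z (w z * psi z).
Proof.
move=> h; rewrite [LHS]int_indic; apply: eq_Rintegral => z _.
have [z0|z0] := pselect (halfplane z); first by rewrite indicE mem_set// mulr1.
rewrite h ?mulr0 ?mul0r// => -[_ z1]; apply: z0; exact: ltW.
Qed.

Lemma travel_weak_x (g : R -> R) c sg : Int1 g ->
  \int[leb2]_(z in halfplane) ((c + prim g (z.2 + sg * z.1)) * 'D_(0, 1) phi z) =
  - \int[leb2]_(z in halfplane) (g (z.2 + sg * z.1) * phi z).
Proof.
move=> gi; have [N hN] := test_support.
have o1 z : ~ quad N z -> phi z = 0 by move=> q; have [] := hN z (0, 1) (fun p => q p.1).
have o2 z : ~ quad N z -> 'D_(0, 1) phi z = 0 by move=> q; have [] := hN z (0, 1) (fun p => q p.1).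
rewrite (@half_test _ _ N); last by move=> z /(hN z (0, 1))[].
rewrite (@half_test _ _ N); last by move=> z /(hN z (0, 1))[].
rewrite (int2_int1 (locint_cont_mul (locint_prim_line c sg gi) (test_dcont (v := (0, 1))) o2)).
rewrite (int2_int1 (locint_cont_mul (locint_line sg gi) test_cont o1)).
rewrite -[in RHS]mulN1r -RintegralZl//; last first.
  exact: (Int2_int1 (locint_cont_mul (locint_line sg gi) test_cont o1)).
apply: eq_Rintegral => t _; rewrite mulN1r.
have out x : ~ (- N%:R <= x <= N%:R) -> ~ quad N (t, x).
  by move=> xN /quad_in[_ _]; rewrite /= ler_norml.
transitivity (\int[leb]_x ((c + prim (fun y => g (y + sg * t)) x) * 'D_(0, 1) phi (t, x))).
  by apply: eq_Rintegral => x _; rewrite /= prim_translate.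
apply: (@ibp _ (fun x => g (x + sg * t)) (fun x => phi (t, x)) (fun x => 'D_(0, 1) phi (t, x)) (- N%:R) N%:R c).
- exact: translate_Int1.
- by move=> x; exact: test_derive1.
- move=> x; apply: (@continuous_comp _ _ _ (fun x => (t, x)) ('D_(0, 1) phi)); last exact: test_dcont.
  by apply: (@cvg_pair _ _ _ _ (nbhs t) (nbhs x)); [exact: cvg_cst|exact: cvg_id].
- by move=> x h; exact: (o1 _ (out x h)).
- by move=> x h; exact: (o2 _ (out x h)).
Qed.

Lemma travel_weak_t (g : R -> R) c sg : sg = 1 \/ sg = -1 -> Int1 g ->
  \int[leb2]_(z in halfplane) ((c + prim g (z.2 + sg * z.1)) * 'D_(1, 0) phi z) =
  - \int[leb2]_(z in halfplane) ((sg * g (z.2 + sg * z.1)) * phi z).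
Proof.
move=> hsg gi; have [N hN] := test_support.
have o1 z : ~ quad N z -> phi z = 0 by move=> q; have [] := hN z (1, 0) (fun p => q p.1).
have o2 z : ~ quad N z -> 'D_(1, 0) phi z = 0 by move=> q; have [] := hN z (1, 0) (fun p => q p.1).
have gl : locint (fun z => sg * g (z.2 + sg * z.1)) by apply: locintZ; exact: locint_line.
rewrite (@half_test _ _ N); last by move=> z /(hN z (1, 0))[].
rewrite (@half_test _ _ N); last by move=> z /(hN z (1, 0))[].
rewrite (int2_int2 (locint_cont_mul (locint_prim_line c sg gi) (test_dcont (v := (1, 0))) o2)).
rewrite (int2_int2 (locint_cont_mul gl test_cont o1)).
rewrite -[in RHS]mulN1r -RintegralZl//; last first.
  exact: (Int2_int2 (locint_cont_mul gl test_cont o1)).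
apply: eq_Rintegral => x _; rewrite mulN1r.
have out t : ~ (- N%:R <= t <= N%:R) -> ~ quad N (t, x).
  by move=> tN /quad_in[/= t0 tN' _]; apply: tN; rewrite tN' andbT (le_trans _ t0)// oppr_le0.
have sg0 : sg != 0 by case: hsg => ->; rewrite ?oppr_eq0 oner_eq0.
have li : Int1 (fun t => sg * g (x + sg * t)).
  by apply: Int1Z; have := Int1_affine x sg0 gi; under eq_fun do rewrite addrC.
have [K hK] : exists K, forall t, prim g (x + sg * t) = K + prim (fun t => sg * g (x + sg * t)) t.
  case: hsg => ->.
    exists 0 => t; rewrite add0r mul1r addrC -[t + x]/(t + x) prim_translate//.
    by rewrite /prim; apply: eq_Rintegral => y _; rewrite !mul1r addrC.
  exists (\int[leb]_y g y) => t; rewrite mulN1r prim_reflect//; congr (_ + _).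
  rewrite -[LHS]mulN1r /prim -RintegralZl//.
    by apply: eq_Rintegral => y _; congr (_ * g _); rewrite mulN1r.
  apply: (@Int1_itv _ (fun y => g (x - y)) `]-oo, t]).
  have N1 : (- 1 : R) != 0 by rewrite oppr_eq0 oner_eq0.
  by have := Int1_affine x N1 gi; under eq_fun do rewrite mulN1r addrC.
transitivity (\int[leb]_t ((c + K + prim (fun t => sg * g (x + sg * t)) t) * 'D_(1, 0) phi (t, x))).
  by apply: eq_Rintegral => t _; rewrite /= hK addrA.
apply: (@ibp _ (fun t => sg * g (x + sg * t)) (fun t => phi (t, x)) (fun t => 'D_(1, 0) phi (t, x)) (- N%:R) N%:R (c + K)).
- exact: li.
- by move=> t; exact: test_derive0.
- move=> t; apply: (@continuous_comp _ _ _ (fun t => (t, x)) ('D_(1, 0) phi)); last exact: test_dcont.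
  by apply: (@cvg_pair _ _ _ _ (nbhs t) (nbhs x)); [exact: cvg_id|exact: cvg_cst].
- by move=> t h; exact: (o1 _ (out t h)).
- by move=> t h; exact: (o2 _ (out t h)).
Qed.

End test.
End travelling.

Section free_waves.
Context {R : realType}.
Notation leb := (@leb R).
Notation leb2 := (@leb2 R).
Notation Int1 f := (leb.-integrable setT (fun x => (f x)%:E)).
Notation Int2 f := (leb2.-integrable setT (fun x => (f x)%:E)).

Lemma primD (f g : R -> R) x : Int1 f -> Int1 g -> prim (fun y => f y + g y) x = prim f x + prim g x.
Proof.
move=> fi gi; rewrite /prim RintegralD//; first exact: (@Int1_itv _ f `]-oo, x]).
exact: (@Int1_itv _ g `]-oo, x]).
Qed.

Lemma primZ (c : R) (f : R -> R) x : Int1 f -> prim (fun y => c * f y) x = c * prim f x.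
Proof. by move=> fi; rewrite /prim RintegralZl//; exact: (@Int1_itv _ f `]-oo, x]). Qed.

Lemma dalembert_free (k t x : R) (D v : R -> R) : 0 <= t -> Int1 D -> Int1 v ->
  2^-1 * ((k + prim D (x + t)) + (k + prim D (x - t))) + 2^-1 * \int[leb]_(y in `[x - t, x + t]) v y =
  k + 2^-1 * (prim (fun y => v y + 1 * D y) (x + t) - prim (fun y => v y + (- 1) * D y) (x - t)).
Proof.
move=> t0 Di vi; have xt : x - t <= x + t by lra.
rewrite -Rintegral_itv_obnd_cbnd -?prim_itv//; last exact: Int1_itv.
rewrite !primD ?primZ//; try exact: Int1Z.
by field.
Qed.

Lemma ex_min n (dl : 'I_n -> R) : (forall i, 0 < dl i) -> exists2 d, 0 < d & forall i, d <= dl i.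
Proof.
move=> dl0; exists (\big[Order.min/1]_i dl i); first exact: lt_bigmin.
by move=> i; exact: bigmin_le_cond.
Qed.

Lemma cvg_ereal0 (T : Type) (G : set_system T) {FG : Filter G} (h : T -> \bar R) :
  (forall z, 0 <= h z)%E -> (forall e : R, 0 < e -> \forall z \near G, (h z <= e%:E)%E) -> h @ G --> 0%E.
Proof.
move=> h0 H.
have fin e z : (h z <= e%:E)%E -> h z \is a fin_num.
  by move=> he; rewrite ge0_fin_numE//; apply: le_lt_trans he _; exact: ltry.
apply/fine_cvgP; split; first by apply: filterS (H 1 ltr01) => z; exact: fin.
apply/cvgrPdist_le => /= e e0; apply: filterS (H e e0) => z he.
rewrite sub0r normrN ger0_norm ?fine_ge0//.
by rewrite -lee_fin fineK//; exact: fin he.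
Qed.

Variables (n : nat) (k : 'I_n -> R) (a1 a2 : 'I_n -> R -> R).
Hypotheses (a1i : forall i, Int1 (a1 i)) (a2i : forall i, Int1 (a2 i)).

Definition free_u x : 'rV[R]_n := \row_i (k i + prim (fun y => 2^-1 * (a1 i y - a2 i y)) x).
Definition free_v x : 'rV[R]_n := \row_i (2^-1 * (a1 i x + a2 i x)).
Definition free_d (s : R) (z : R * R) : 'rV[R]_n :=
  \row_i (2^-1 * (a1 i (z.2 + 1 * z.1) + s * a2 i (z.2 + (- 1) * z.1))).

Let Dhalf i : Int1 (fun y => 2^-1 * (a1 i y - a2 i y)).
Proof. by apply: Int1Z; exact: Int1B. Qed.
Let vhalf i : Int1 (fun y => 2^-1 * (a1 i y + a2 i y)).
Proof. by apply: Int1Z; exact: Int1D. Qed.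

Lemma free_waveE t x i : 0 <= t -> linear_wave free_u free_v (t, x) 0 i =
  k i + 2^-1 * (prim (a1 i) (x + t) - prim (a2 i) (x - t)).
Proof.
move=> t0; rewrite /linear_wave /vintegral !mxE.
under eq_Rintegral do rewrite mxE.
rewrite dalembert_free; [|exact: t0|exact: Dhalf|exact: vhalf].
by congr (_ + _ * (_ - _)); apply: eq_Rintegral => y _; field.
Qed.

Lemma free_weak v s :
  (forall phi i, test_function phi ->
    \int[leb2]_(z in halfplane) ((2 * k i + prim (a1 i) (z.2 + 1 * z.1)) * 'D_v phi z) =
    - \int[leb2]_(z in halfplane) ((1 * a1 i (z.2 + 1 * z.1)) * phi z)) ->
  (forall phi i, test_function phi ->
    \int[leb2]_(z in halfplane) ((0 + prim (a2 i) (z.2 + (- 1) * z.1)) * 'D_v phi z) =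
    - \int[leb2]_(z in halfplane) ((- s * a2 i (z.2 + (- 1) * z.1)) * phi z)) ->
  weak_derivative v (linear_wave free_u free_v) (free_d s).
Proof.
move=> h1 h2 phi tphi i; have [N hN] := test_support tphi.
have w1 := h1 phi i tphi; have w2 := h2 phi i tphi.
have o1 z : ~ quad N z -> phi z = 0 by move=> q; have [] := hN z v (fun p => q p.1).
have o2 z : ~ quad N z -> 'D_v phi z = 0 by move=> q; have [] := hN z v (fun p => q p.1).
have S (f : R * R -> R) : Int2 f -> leb2.-integrable halfplane (fun z => (f z)%:E).
  by move=> fi; apply: integrableS fi => //; exact: measurable_halfplane.
have J1 := S _ (locint_cont_mul (locint_prim_line (2 * k i) 1 (a1i i)) (test_dcont tphi (v := v)) o2).
have J2 := S _ (locint_cont_mul (locint_prim_line 0 (- 1) (a2i i)) (test_dcont tphi (v := v)) o2).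
have l1 : locint (fun z => 1 * a1 i (z.2 + 1 * z.1)) by apply: locintZ; exact: locint_line.
have l2 : locint (fun z => - s * a2 i (z.2 + (- 1) * z.1)) by apply: locintZ; exact: locint_line.
have J3 := S _ (locint_cont_mul l1 (test_cont tphi) o1).
have J4 := S _ (locint_cont_mul l2 (test_cont tphi) o1).
transitivity (2^-1 * (\int[leb2]_(z in halfplane) ((2 * k i + prim (a1 i) (z.2 + 1 * z.1)) * 'D_v phi z) -
   \int[leb2]_(z in halfplane) ((0 + prim (a2 i) (z.2 + (- 1) * z.1)) * 'D_v phi z))).
  rewrite -RintegralB//; last exact: measurable_halfplane.
  rewrite -RintegralZl//; [|exact: measurable_halfplane|exact: (integrableB measurable_halfplane J1 J2)].
  by apply: eq_Rintegral => -[t x]; rewrite inE => t0; rewrite free_waveE//= mul1r mulN1r; field.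
rewrite w1 w2.
rewrite (_ : _ - - _ = - (\int[leb2]_(z in halfplane) (1 * a1 i (z.2 + 1 * z.1) * phi z) -
   \int[leb2]_(z in halfplane) (- s * a2 i (z.2 + (- 1) * z.1) * phi z))); last by rewrite opprB addrC opprK.
rewrite mulrN; congr (- _).
rewrite -RintegralB//; last exact: measurable_halfplane.
rewrite -RintegralZl//; [|exact: measurable_halfplane|exact: (integrableB measurable_halfplane J3 J4)].
by apply: eq_Rintegral => z _; rewrite mxE; ring.
Qed.

Lemma free_weak_t : weak_derivative (1, 0) (linear_wave free_u free_v) (free_d 1).
Proof.
apply: free_weak => phi i tphi.
  exact: (travel_weak_t tphi (2 * k i) (or_introl erefl : (1 : R) = 1 \/ (1 : R) = -1) (a1i i)).
exact: (travel_weak_t tphi 0 (or_intror erefl : (- 1 : R) = 1 \/ (- 1 : R) = -1) (a2i i)).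
Qed.

Lemma free_weak_x : weak_derivative (0, 1) (linear_wave free_u free_v) (free_d (- 1)).
Proof.
apply: free_weak => phi i tphi.
  rewrite (travel_weak_x tphi (2 * k i) 1 (a1i i)); congr (- _).
  by apply: eq_Rintegral => z _; rewrite [X in _ = X * _]mul1r.
rewrite (travel_weak_x tphi 0 (- 1) (a2i i)); congr (- _).
by apply: eq_Rintegral => z _; rewrite opprK [X in _ = X * _]mul1r.
Qed.

Lemma free_d_Int1 s t i : Int1 (fun x => free_d s (t, x) 0 i).
Proof.
under eq_fun do rewrite mxE/=.
by apply: Int1Z; apply: Int1D; [exact: translate_Int1|apply: Int1Z; exact: translate_Int1].
Qed.

Lemma free_d_locint s i : locint (fun z => free_d s z 0 i).
Proof.
have := locintZ 2^-1 (locintD (locint_line 1 (a1i i)) (locintZ s (locint_line (- 1) (a2i i)))).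
by congr locint; apply/funext => z; rewrite mxE.
Qed.

Lemma compact_halfplane_quad (C : set (R * R)) : compact C -> C `<=` halfplane -> exists N, C `<=` quad N.
Proof.
move=> cC Ch; have [B [_ HB]] := compact_bounded cC.
exists (Num.truncn (`|B| + 1)).+1 => z Cz.
have := HB (`|B| + 1) (ltac:(by rewrite (le_lt_trans (ler_norm B))// ltrDl)) z Cz.
rewrite /Num.Def.normr/= ge_max => /andP[h1 h2].
have hB := ltW (truncnS_gt (`|B| + 1)).
apply/quad_in; split; [exact: Ch|exact: le_trans (ler_norm _) (le_trans h1 hB)|exact: le_trans h2 hB].
Qed.

Lemma free_d_loc s : locally_integrable_halfplane (free_d s).
Proof.
move=> C cC Ch i; have [N CN] := compact_halfplane_quad cC Ch.
have mC : measurable (C : set (measurableTypeR R * measurableTypeR R)).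
  rewrite -[C]setCK; apply: measurableC; apply: open_measurable2; apply: closed_openC; exact: compact_closed.
apply: (integrableS (measurable_quad N) mC CN).
by apply/(Int_indic leb2 (fun z => free_d s z 0 i) (measurable_quad N)); exact: free_d_locint.
Qed.

Lemma free_d_cont s : s = 1 \/ s = -1 -> continuous_in_L1 (free_d s).
Proof.
move=> hs; split=> [t t0 i|t t0]; first exact: free_d_Int1.
apply: cvg_ereal0; first by move=> r; exact: Lnorm_ge0.
move=> e e0.
pose e' := e / n.+1%:R.
have e'0 : 0 < e' by rewrite divr_gt0.
have tr (a : R -> R) c : Int1 a -> exists2 dl : R, 0 < dl & forall r, `|r - t| < dl ->
    c = 1 \/ c = -1 -> \int[leb]_x `|a (x + c * r) - a (x + c * t)| <= e'.
  move=> ai; have [dl dl0 H] := translation_L1 ai e'0; exists dl => // r rt hc.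
  have I3 : Int1 (fun x => `|a (x + (c * r - c * t)) - a x|).
    by apply: Int1_abs; apply: Int1B => //; exact: translate_Int1.
  have := translate_int (c * t) I3 => /= E.
  apply: (@le_trans _ _ (\int[leb]_x `|a (x + c * t + (c * r - c * t)) - a (x + c * t)|)).
    rewrite le_eqVlt; apply/orP; left; apply/eqP/eq_Rintegral => x _.
    by congr (`|a _ - _|); ring.
  rewrite E; apply/ltW/H; rewrite -mulrBr normrM.
  by case: hc => ->; rewrite ?normrN normr1 mul1r.
have [dl dl0 Hdl] : exists2 dl : R, 0 < dl & forall r i, `|r - t| < dl ->
    \int[leb]_x `|a1 i (x + 1 * r) - a1 i (x + 1 * t)| <= e' /\
    \int[leb]_x `|a2 i (x + (- 1) * r) - a2 i (x + (- 1) * t)| <= e'.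
  pose d1 i := sval (cid2 (tr (a1 i) 1 (a1i i))); pose d2 i := sval (cid2 (tr (a2 i) (- 1) (a2i i))).
  have [m1 m10 h1] : exists2 d, 0 < d & forall i, d <= d1 i.
    by apply: ex_min => i; rewrite /d1; case: cid2.
  have [m2 m20 h2] : exists2 d, 0 < d & forall i, d <= d2 i.
    by apply: ex_min => i; rewrite /d2; case: cid2.
  exists (Num.min m1 m2); first by rewrite lt_min m10.
  move=> r i; rewrite lt_min => /andP[r1 r2]; split.
    have := lt_le_trans r1 (h1 i); rewrite /d1; case: cid2 => /= x _ H hx; apply: H => //; by left.
  have := lt_le_trans r2 (h2 i); rewrite /d2; case: cid2 => /= x _ H hx; apply: H => //; by right.
have nb : \forall r \near within [set r : R | 0 <= r] (nbhs t), `|r - t| < dl.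
  apply: cvg_within; have : \forall r \near t, ball t dl r by exact: nbhsx_ballx.
  by apply: filterS => r; rewrite /ball/= distrC.
apply: filterS nb => r rt.
have vI : vintegrable leb setT (fun x => free_d s (r, x) - free_d s (t, x)).
  move=> i; have := Int1B (free_d_Int1 s r i) (free_d_Int1 s t i).
  by congr (_.-integrable _ _); apply/funext => x; rewrite !mxE.
apply: le_trans (normLp1_le vI) _; rewrite lee_fin.
apply: (@le_trans _ _ (\sum_(i < n) e')); last first.
  rewrite sumr_const card_ord -mulr_natl /e' mulrCA ger_pMr// ler_pdivrMr// mul1r ler_nat//.
apply: ler_sum => i _; have [h1 h2] := Hdl r i rt.
have K1 : Int1 (fun x => `|a1 i (x + 1 * r) - a1 i (x + 1 * t)|).
  by apply: Int1_abs; apply: Int1B; exact: translate_Int1.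
have K2 : Int1 (fun x => `|a2 i (x + (- 1) * r) - a2 i (x + (- 1) * t)|).
  by apply: Int1_abs; apply: Int1B; exact: translate_Int1.
apply: (@le_trans _ _ (\int[leb]_x (2^-1 * (`|a1 i (x + 1 * r) - a1 i (x + 1 * t)| + `|a2 i (x + (- 1) * r) - a2 i (x + (- 1) * t)|)))).
  apply: int_le; [by apply: Int1_abs; exact: vI|by apply: Int1Z; exact: Int1D|].
  apply: aeW => x; rewrite !mxE/=.
  rewrite -mulrBr normrM ger0_norm ?invr_ge0// ler_wpM2l ?invr_ge0//.
  rewrite opprD addrACA -mulrBr; apply: le_trans (ler_normD _ _) _.
  by rewrite lerD2l normrM; case: hs => ->; rewrite ?normrN normr1 mul1r.
by rewrite RintegralZl ?RintegralD//; [lra|exact: Int1D].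
Qed.

Lemma free_derivatives : derivatives (linear_wave free_u free_v) (free_d 1) (free_d (- 1)).
Proof.
split; [exact: free_weak_t|exact: free_weak_x|split; exact: free_d_loc|].
by split; apply: free_d_cont; [left|right].
Qed.

Lemma free_L11 : L11 free_u free_v.
Proof.
split.
- pose B i := `|k i| + \int[leb]_y `|2^-1 * (a1 i y - a2 i y)|.
  apply: (@le_lt_trans _ _ (\sum_i B i)%:E); last exact: ltry.
  apply: normLpy_le => x; apply: le_trans (enorm_le_sum _) _; apply: ler_sum => i _.
  rewrite mxE; apply: le_trans (ler_normD _ _) _; rewrite lerD2l.
  exact: prim_le.
- split.
    move=> a b ab e e0; pose e' := e / n.+1%:R.
    have e'0 : 0 < e' by rewrite divr_gt0.
    have ac i := prim_abs_cont (Dhalf i) ab e'0.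
    pose dl i := sval (cid2 (ac i)).
    have [d d0 dle] : exists2 d, 0 < d & forall i, d <= dl i.
      by apply: ex_min => i; rewrite /dl; case: cid2.
    exists d => // m l r lr tF sd.
    apply: (@le_lt_trans _ _ (\sum_(i < n) \sum_(j < m) `|free_u (r j) 0 i - free_u (l j) 0 i|)).
      rewrite exchange_big/=; apply: ler_sum => j _; apply: le_trans (enorm_le_sum _) _.
      by apply: ler_sum => i _; rewrite !mxE.
    apply: (@le_lt_trans _ _ (\sum_(i < n) e')).
      apply: ler_sum => i _; apply: ltW.
      have := lt_le_trans sd (dle i); rewrite /dl; case: cid2 => /= y _ H yd.
      have := H m l r lr tF yd; congr (_ < _); apply: eq_bigr => j _.
      by rewrite !mxE; congr `|_|; ring.
    rewrite sumr_const card_ord -mulr_natl /e' mulrCA gtr_pMr//.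
    by rewrite ltr_pdivrMr// mul1r ltr_nat.
  exists (fun x => \row_i (2^-1 * (a1 i x - a2 i x))).
    by move=> i; have := Dhalf i; congr (_.-integrable _ _); apply/funext => x; rewrite mxE.
  have : {ae leb, forall x : R, forall i, is_derive (x : R) (1 : R) (prim (fun y => 2^-1 * (a1 i y - a2 i y))) (2^-1 * (a1 i x - a2 i x))}.
    by apply: ae_count => i; exact: (prim_derive (Dhalf i)).
  apply: aeS => x hx; apply/is_derive_row => i.
  have h := is_deriveD (is_derive_cst (k i) x (1 : R)) (hx i).
  rewrite mxE; rewrite add0r in h.
  rewrite (_ : (fun y => free_u y 0 i) = cst (k i) \+ prim (fun y => 2^-1 * (a1 i y - a2 i y))) //.
  by apply/funext => y; rewrite mxE.
- by move=> i; have := vhalf i; congr (_.-integrable _ _); apply/funext => x; rewrite mxE.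
Qed.

End free_waves.

Section solution3.
Context {R : realType} {n : nat}.
Notation leb := (@leb R).
Notation leb2 := (@leb2 R).
Notation Int1 f := (leb.-integrable setT (fun x => (f x)%:E)).
Notation Int2 f := (leb2.-integrable setT (fun x => (f x)%:E)).
Variables (d : nat) (M : set 'rV[R]_n).
Variables (A : 'rV[R]_n -> 'rV[R]_n -> 'rV[R]_n -> 'rV[R]_n).
Variables (Gam : 'I_n -> 'I_n -> 'rV[R]_n -> 'rV[R]_n) (P : 'rV[R]_n -> 'M[R]_n).
Hypotheses (hM : embedded_submanifold d M) (hA : second_fundamental_form M A).
Hypothesis hGam : forall j k : 'I_n, bounded_lipschitz (Gam j k).
Hypothesis hGamA : forall p a b : 'rV[R]_n, M p -> tangent M p a -> tangent M p b ->
  \sum_(j < n) \sum_(k < n) (a 0 j * b 0 k) *: Gam j k p = A p a b.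
Hypothesis hP : bounded_lipschitz P.
Hypothesis hPproj : forall p : 'rV[R]_n, M p -> orthogonal_projection M p (P p).
Variables (u0 v0 : R -> 'rV[R]_n) (f u ut ux : R * R -> 'rV[R]_n).
Hypothesis hf : vintegrable leb2 halfplane f.
Hypothesis hu : mild_solution M Gam P u0 v0 f u ut ux.
Variables (k0 : 'I_n -> R) (D : 'I_n -> R -> R).
Hypothesis vi : forall i, Int1 (fun x => v0 x 0 i).
Hypothesis Di : forall i, Int1 (D i).
Hypothesis hu0 : forall i x, u0 x 0 i = k0 i + prim (D i) x.

Let F i (z : R * R) : R := wave_map_rhs Gam P f u ut ux z 0 i.
Let e := edge v0 D.
Let spd := speed Gam P v0 f u ut ux D.
Let spdv := speedv Gam P v0 f u ut ux D.


Let half i (z : R * R) : R := F i z * \1_halfplane z.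
Let ms := maxspeed v0 f D.

Lemma half_Int2 i : Int2 (half i).
Proof. exact: (rhs_Int2 hM hA hGam hGamA hP hPproj hf hu vi Di hu0). Qed.

Definition source sg i (xi : R) : R := \int[leb]_s half i (aff2 1 (- sg) 0 (s, xi)).
Definition final sg i (xi : R) : R := e sg i xi + source sg i xi.
Definition tail i (t : R) : R := \int[leb2]_z (`|half i z| * (t < z.1)%R%:R).

Lemma source_Int1 sg i : Int1 (source sg i).
Proof. exact: (Int2_int2 (Int2_aff2 (- sg) 0 (oner_neq0 R) (half_Int2 i))). Qed.

Lemma final_Int1 sg i : Int1 (final sg i).
Proof. by apply: Int1D; [exact: edge_Int1|exact: source_Int1]. Qed.

Lemma measurable_pred_fst (p : R -> bool) : measurable_fun [set: measurableTypeR R] p ->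
  measurable_fun [set: measurableTypeR R * measurableTypeR R] (fun z => (p z.1)%:R : R).
Proof. by move=> mp; apply: measurable_pred; apply: measurableT_comp mp measurable_fst. Qed.

Lemma tail_Int2 i t : Int2 (fun z => `|half i z| * (t < z.1)%R%:R).
Proof.
apply: (@Int2_bddM _ _ (fun z => (t < z.1)%R%:R) 1).
- by apply: (@measurable_pred_fst (fun x => t < x)); exact: measurable_fun_ltr.
- by move=> z; case: (t < z.1); rewrite ?normr1 ?normr0.
- by apply: Int2_abs; exact: half_Int2.
Qed.

Lemma tail_ge0 i t : 0 <= tail i t.
Proof. by apply: Rintegral_ge0 => z _; apply: mulr_ge0. Qed.

Lemma tail_le i s t : s <= t -> tail i t <= tail i s.
Proof.
move=> st; apply: int_le; [exact: tail_Int2|exact: tail_Int2|].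
apply: aeW => z; apply: ler_wpM2l => //; rewrite ler_nat.
by case: (ltP t z.1) => // tz; rewrite (le_lt_trans st tz).
Qed.

Lemma tail_small i (eps : R) : 0 < eps -> exists N : nat, tail i N%:R <= eps.
Proof.
move=> e0.
have : tail i m%:R @[m --> \oo] --> \int[leb2]_z (cst 0 z : R).
  apply: (@dct2 _ _ _ (fun z => `|half i z|)).
  - by move=> m; exact: Int2_measurable (tail_Int2 i m%:R).
  - exact: measurable_cst.
  - move=> z; apply: cvg_near_cst; exists (Num.truncn `|z.1|).+1 => // m /= hm.
    rewrite ltNge (_ : z.1 <= m%:R) ?mulr0//.
    apply: le_trans (ler_norm _) _; apply: le_trans (ltW (truncnS_gt _)) _.
    by rewrite ler_nat.
  - by apply: Int2_abs; exact: half_Int2.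
  - move=> m z; rewrite normrM normr_id ler_piMr//.
    by case: (_ < _); rewrite ?normr1 ?normr0.
rewrite Rintegral_cst// mul0r => /cvgrPdist_le/(_ _ e0)[N _ H]; exists N.
by have := H N (leqnn N); rewrite /= sub0r normrN ger0_norm// tail_ge0.
Qed.

Lemma source_prim (b : bool) sg i c : prim (source sg i) c =
  \int[leb2]_z (half i z * (z.2 + sg * z.1 < c ?<= if b)%:R).
Proof.
have si := source_Int1 sg i.
have E1 : prim (source sg i) c = \int[leb]_x (source sg i x * (x < c ?<= if b)%:R).
  rewrite /prim; case: b.
    rewrite [LHS]int_indic; apply: eq_Rintegral => x _.
    by rewrite indicE mem_setE/= in_itv.
  rewrite -Rintegral_itv_bndo_bndc; last exact: Int1_itv.
  rewrite [LHS]int_indic; apply: eq_Rintegral => x _.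
  by rewrite indicE mem_setE/= in_itv.
have mb : measurable_fun [set: measurableTypeR R] (fun x : R => (x < c ?<= if b)).
  by case: b {E1}; [exact: measurable_fun_ler|exact: measurable_fun_ltr].
have mb2 : measurable_fun [set: measurableTypeR R * measurableTypeR R]
    (fun z => (z.2 + sg * z.1 < c ?<= if b)%:R : R).
  apply: (measurable_pred (p := fun z : R * R => z.2 + sg * z.1 < c ?<= if b)).
  apply: (measurableT_comp mb); apply: measurable_funD; first exact: measurable_snd.
  by apply: measurable_funM; [exact: measurable_cst|exact: measurable_fst].
have KI : Int2 (fun z => half i z * (z.2 + sg * z.1 < c ?<= if b)%:R).
  apply: (Int2_bddM mb2 (M := 1)); last exact: half_Int2.
  by move=> z; case: (_ < _ ?<= if _); rewrite ?normr1 ?normr0.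
have := integral_aff2 (- sg) 0 (oner_neq0 R) KI; rewrite normr1 invr1 mul1r => <-.
rewrite (int2_int2 (Int2_aff2 (- sg) 0 (oner_neq0 R) KI)) E1.
apply: eq_Rintegral => x _; rewrite /source -int_mul01; last first.
  by case: (_ < _ ?<= if _); [right|left].
apply: eq_Rintegral => s _; rewrite /aff2/=; congr (_ * (_ < _ ?<= if _)%:R); ring.
Qed.

Lemma duhamel_plane i t x : 0 <= t ->
  \int[leb]_(r in `[0, t]) \int[leb]_(y in `[x - t + r, x + t - r]) F i (r, y) =
  \int[leb2]_z (half i z * \1_(backward_triangle t x) z).
Proof.
move=> t0; have GI := Int_indicM (measurable_triangle t x) (half_Int2 i).
rewrite (int2_int1 GI) [LHS]int_indic; apply: eq_Rintegral => r _.
rewrite [X in X * _]int_indic -int_mul01; last first.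
  by have [->|->] := @indic01 R _ (`[0, t]%classic : set R) r; [left|right].
apply: eq_Rintegral => y _; rewrite /half -!mulrA; congr (_ * _).
rewrite !indicE -!natrM !mulnb; congr (nat_of_bool _)%:R; rewrite !mem_setE/= !in_itv/=.
apply/idP/idP.
  move=> /andP[/andP[h1 h2] /andP[h3 h4]]; apply/andP; split => //.
  by apply/mem_set; split; apply/andP.
by move=> /andP[_ /set_mem[/= -> ->]].
Qed.

Let ub := free_u k0 (final 1) (final (- 1)).
Let vb := free_v (final 1) (final (- 1)).

Lemma sup_bound i t x : 0 <= t ->
  `|u (t, x) 0 i - linear_wave ub vb (t, x) 0 i| <= 2^-1 * tail i t.
Proof.
move=> t0.
rewrite (mild_dalembert hu hu0 i x t0) /dalembert dalembert_free//.
rewrite /ub /vb (free_waveE k0 (final_Int1 1) (final_Int1 (- 1)) x i t0).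
rewrite /final [in X in _ - X]primD; [|exact: edge_Int1|exact: source_Int1].
rewrite [in X in _ - X]primD; [|exact: edge_Int1|exact: source_Int1].
rewrite (source_prim true) (source_prim false) duhamel_plane//.
set X1 := prim _ (x + t); set X2 := prim _ (x - t).
pose k1 (z : R * R) : R := \1_(backward_triangle t x) z.
pose k2 (z : R * R) : R := (z.2 + 1 * z.1 < x + t ?<= if true)%:R.
pose k3 (z : R * R) : R := (z.2 + (- 1) * z.1 < x - t ?<= if false)%:R.
have ml (b : bool) c sg : measurable_fun [set: measurableTypeR R * measurableTypeR R]
    (fun z => (z.2 + sg * z.1 < c ?<= if b)%:R : R).
  have mb : measurable_fun [set: measurableTypeR R] (fun x : R => (x < c ?<= if b)).
    by case: b; [exact: measurable_fun_ler|exact: measurable_fun_ltr].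
  apply: (measurable_pred (p := fun z : R * R => z.2 + sg * z.1 < c ?<= if b)).
  apply: (measurableT_comp mb); apply: measurable_funD; first exact: measurable_snd.
  by apply: measurable_funM; [exact: measurable_cst|exact: measurable_fst].
have J1 : Int2 (fun z => half i z * k1 z) by exact: (Int_indicM (measurable_triangle t x) (half_Int2 i)).
have J2 : Int2 (fun z => half i z * k2 z).
  apply: (Int2_bddM (ml true _ 1) (M := 1)); last exact: half_Int2.
  by move=> z; case: (_ < _ ?<= if _); rewrite ?normr1 ?normr0.
have J3 : Int2 (fun z => half i z * k3 z).
  apply: (Int2_bddM (ml false _ (- 1)) (M := 1)); last exact: half_Int2.
  by move=> z; case: (_ < _ ?<= if _); rewrite ?normr1 ?normr0.
have JK : Int2 (fun z => half i z * k1 z - half i z * k2 z + half i z * k3 z).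
  by apply: Int2D => //; exact: Int2B.
rewrite (_ : _ - _ = 2^-1 * \int[leb2]_z (half i z * k1 z - half i z * k2 z + half i z * k3 z)); last first.
  rewrite RintegralD//; last exact: Int2B.
  by rewrite RintegralB//; field.
rewrite normrM ger0_norm ?invr_ge0// ler_wpM2l ?invr_ge0//.
apply: le_trans (le_normr_Rintegral measurableT JK) _.
apply: int_le; [exact: Int2_abs|exact: tail_Int2|].
apply: aeW => z; rewrite -mulrBr -mulrDr normrM.
have [hz|hz] := pselect (halfplane z); last by rewrite /half indicE memNset// mulr0 normr0 !mul0r.
rewrite ler_wpM2l//.
have k1E : k1 z = [&& z.1 <= t, x - t + z.1 <= z.2 & z.2 <= x + t - z.1]%:R.
  rewrite /k1 indicE; congr (nat_of_bool _)%:R; apply/idP/idP.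
    by move=> /set_mem[/andP[_ ->] /andP[-> ->]].
  by move=> /and3P[h1 h2 h3]; apply/mem_set; split; apply/andP.
rewrite k1E /k2 /k3 /=.
have : 0 <= z.1 by exact: hz.
move: z.1 z.2 => s y s0.
case: (leP s t) => h1; case: (leP (x - t + s) y) => h2; case: (leP y (x + t - s)) => h3;
  case: (leP (y + 1 * s) (x + t)) => h4; case: (ltP (y + (- 1) * s) (x - t)) => h5 /=;
  rewrite ?subrr ?subr0 ?sub0r ?addr0 ?add0r ?addNr ?normrN ?normr1 ?normr0//; exfalso; lra.
Qed.

Lemma ae_exists (Q : R -> Prop) (a b : R) : {ae leb, forall x, Q x} -> a < b ->
  exists s, a < s < b /\ Q s.
Proof.
move=> [N [mN N0 NQ]] ab; apply: contrapT => h.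
have sub : `]a, b[ `<=` N.
  move=> s /=; rewrite in_itv/= => sab; apply: NQ => /= qs; apply: h; by exists s.
have : (leb (`]a, b[%classic : set (measurableTypeR R)) <= leb N)%E.
  by apply: le_measure; rewrite ?inE//; exact: measurable_itv.
by rewrite N0 (leb_itvoo (ltW ab)) leNgt lte_fin subr_gt0 ab.
Qed.

Definition remainder sg i t xi : R := \int[leb]_s (`|half i (aff2 1 (- sg) 0 (s, xi))| * (t < s)%R%:R).

Lemma remainder_Int1 sg i t : Int1 (remainder sg i t).
Proof. exact: (Int2_int2 (Int2_aff2 (- sg) 0 (oner_neq0 R) (tail_Int2 i t))). Qed.

Lemma remainder_int sg i t : \int[leb]_xi remainder sg i t xi = tail i t.
Proof.
have H := tail_Int2 i t.
have := integral_aff2 (- sg) 0 (oner_neq0 R) H; rewrite normr1 invr1 mul1r => E.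
by rewrite /tail -E (int2_int2 (Int2_aff2 (- sg) 0 (oner_neq0 R) H)).
Qed.

Lemma speed_final sg i : {ae leb, forall xi, forall t, 0 <= t ->
  `|spd sg i (t, xi) - final sg i xi| <= remainder sg i t xi}.
Proof.
have := Int2_slice2 (Int2_aff2 (- sg) 0 (oner_neq0 R) (half_Int2 i)).
apply: aeS => xi hI t t0.
have hI' : Int1 (fun s => half i (aff2 1 (- sg) 0 (s, xi))) by exact: hI.
have itv : Int1 (fun s => half i (aff2 1 (- sg) 0 (s, xi)) * \1_`[0, t] s).
  exact: (Int1_indicM `[0, t] hI').
have -> : spd sg i (t, xi) - final sg i xi =
    \int[leb]_s (half i (aff2 1 (- sg) 0 (s, xi)) * \1_`[0, t] s - half i (aff2 1 (- sg) 0 (s, xi))).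
  rewrite RintegralB// /spd /speed /charA /final /source /= opprD addrACA subrr add0r; congr (_ - _).
  rewrite int_indic; apply: eq_Rintegral => s _; rewrite /charF /half.
  have [s0|s0] := boolP (s \in (`[0, t]%classic : set R)); last by rewrite !indicE (negbTE s0) !mulr0.
  rewrite [in RHS]indicE mem_set ?mulr1//.
  by move: s0; rewrite inE/= in_itv/= => /andP[].
have JI : Int1 (fun s => half i (aff2 1 (- sg) 0 (s, xi)) * \1_`[0, t] s - half i (aff2 1 (- sg) 0 (s, xi))).
  exact: Int1B.
have RI : Int1 (fun s => `|half i (aff2 1 (- sg) 0 (s, xi))| * (t < s)%R%:R).
  apply: (Int1_bddM (M := 1) (g := fun s => (t < s)%R%:R)); last exact: Int1_abs.
    by apply: measurable_pred; exact: measurable_fun_ltr.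
  by move=> s; case: (t < s); rewrite ?normr1 ?normr0.
apply: le_trans (le_normr_Rintegral measurableT JI) _.
apply: int_le; [exact: Int1_abs|exact: RI|].
apply: aeW => s; have [s0|s0] := ltP s 0.
  rewrite /half indicE memNset ?mulr0 ?mul0r ?subrr ?normr0 ?mul0r//=.
  by rewrite /halfplane/=; apply/negP; rewrite -ltNge.
rewrite indicE mem_setE/= in_itv/= s0/=.
by case: leP => _; rewrite ?mulr1 ?mulr0 ?subrr ?sub0r ?normrN ?normr0//.
Qed.

Lemma null_final sg i : sg = 1 \/ sg = -1 -> {ae leb, forall t, 0 < t -> {ae leb, forall x,
  `|(ut (t, x) + sg *: ux (t, x)) 0 i - final sg i (x + sg * t)| <= remainder sg i t (x + sg * t)}}.
Proof.
move=> hsg; have := ae_slice1 (null_speed hu vi Di hu0 hsg).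
apply: aeS => t ht t0.
have := aeS2 _ ht (ae_affine (sg * t) (oner_neq0 R) (speed_final sg i)); apply => x h1 h2.
have := h2 t (ltW t0); rewrite mul1r; congr (`|_ - _| <= _).
rewrite h1// mxE; congr (speed _ _ _ _ _ _ _ _ _ _).
by rewrite /aff2/= mul1r addr0.
Qed.

Lemma L1_bound_ae (w : R * R -> R) c i : c = 1 \/ c = -1 ->
  (forall z, w z = 2^-1 * ((ut z + 1 *: ux z) 0 i + c * (ut z + (- 1) *: ux z) 0 i)) ->
  (forall t, 0 <= t -> Int1 (fun x => w (t, x))) ->
  {ae leb, forall t, 0 < t ->
    \int[leb]_x `|w (t, x) - free_d (final 1) (final (- 1)) c (t, x) 0 i| <= tail i t}.
Proof.
move=> hc wE wI.
have n1 := null_final i (or_introl erefl : (1 : R) = 1 \/ (1 : R) = -1).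
have n2 := null_final i (or_intror erefl : (- 1 : R) = 1 \/ (- 1 : R) = -1).
have := aeS2 _ n1 n2; apply => t h1 h2 t0.
have r1 := translate_Int1 (1 * t) (remainder_Int1 1 i t).
have r2 := translate_Int1 ((- 1) * t) (remainder_Int1 (- 1) i t).
have fI := free_d_Int1 (final_Int1 1) (final_Int1 (- 1)) c t i.
have -> : tail i t = \int[leb]_x (2^-1 * (remainder 1 i t (x + 1 * t) + remainder (- 1) i t (x + (- 1) * t))).
  rewrite RintegralZl; [|exact: measurableT|exact: Int1D].
  rewrite RintegralD; [|exact: measurableT|exact: r1|exact: r2].
  rewrite (translate_int _ (remainder_Int1 1 i t)) (translate_int _ (remainder_Int1 (- 1) i t)).
  by rewrite !remainder_int; field.
apply: int_le; [by apply: Int1_abs; apply: Int1B => //; exact: wI (ltW t0)|by apply: Int1Z; exact: Int1D|].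
have := aeS2 _ (h1 t0) (h2 t0); apply => x H1 H2.
rewrite wE [free_d _ _ _ _ 0 i]mxE -mulrBr normrM ger0_norm ?invr_ge0// ler_wpM2l ?invr_ge0//=.
rewrite opprD addrACA -mulrBr; apply: le_trans (ler_normD _ _) _; apply: lerD; first exact: H1.
by rewrite normrM (_ : `|c| = 1) ?mul1r//; case: hc => ->; rewrite ?normrN normr1.
Qed.

Lemma L1_bound (w : R * R -> 'rV[R]_n) c i : c = 1 \/ c = -1 ->
  (forall z, w z 0 i = 2^-1 * ((ut z + 1 *: ux z) 0 i + c * (ut z + (- 1) *: ux z) 0 i)) ->
  continuous_in_L1 w -> forall t, 0 <= t ->
  \int[leb]_x `|w (t, x) 0 i - free_d (final 1) (final (- 1)) c (t, x) 0 i| <= tail i t.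
Proof.
move=> hc wE [wI wc] t t0.
pose fr := free_d (final 1) (final (- 1)) c.
have [fI fc] : continuous_in_L1 fr by apply: free_d_cont hc => j; exact: final_Int1.
have H := @L1_bound_ae (fun z => w z 0 i) c i hc wE (fun t t0 => wI t t0 i).
have near_small (g : R * R -> 'rV[R]_n) (eps : R) : continuous_in_L1 g -> 0 < eps ->
    exists2 dl : R, 0 < dl & forall s, t <= s < t + dl -> \int[leb]_x `|g (s, x) 0 i - g (t, x) 0 i| <= eps.
  move=> [gI gc] e0.
  have [dl /= dl0 Hd] : \forall s \near within [set s : R | 0 <= s] (nbhs t),
      (normLp 1%E (fun x => (g (s, x) - g (t, x))%R) < eps%:E)%E.
    by apply: (gc t t0 [set z | (z < eps%:E)%E]); apply: open_nbhs_nbhs; split; [exact: open_ereal_lt_ereal|rewrite /= lte_fin].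
  exists dl => // s /andP[ts std].
  have vI : vintegrable leb setT (fun x => g (s, x) - g (t, x)).
    move=> j; have := Int1B (gI s (le_trans t0 ts) j) (gI t t0 j).
    by congr (_.-integrable _ _); apply/funext => x; rewrite !mxE.
  have := Hd s; rewrite /ball/= => /(_ _ (le_trans t0 ts)).
  rewrite distrC ger0_norm ?subr_ge0// ltrBlDl => /(_ std) /ltW.
  move=> /(le_trans (le_normLp1 i vI)); rewrite lee_fin; apply: le_trans.
  by rewrite le_eqVlt; apply/orP; left; apply/eqP/eq_Rintegral => x _; rewrite !mxE.
apply/ler_addgt0Pr => ep e0; have e20 : 0 < ep / 2 by rewrite divr_gt0.
have [d1 d10 h1] := near_small w _ (conj wI wc) e20.
have [d2 d20 h2] := near_small fr _ (conj fI fc) e20.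
have [s [/andP[ts sd] Hs]] : exists s, t < s < t + Num.min d1 d2 /\ (0 < s ->
    \int[leb]_x `|w (s, x) 0 i - fr (s, x) 0 i| <= tail i s).
  by apply: ae_exists H _; rewrite ltrDl lt_min d10.
have s0 : 0 < s by exact: le_lt_trans ts.
have k1 := h1 s; have k2 := h2 s.
have {}k1 : \int[leb]_x `|w (s, x) 0 i - w (t, x) 0 i| <= ep / 2.
  by apply: k1; rewrite ltW//= (lt_le_trans sd)// lerD2l ge_min lexx.
have {}k2 : \int[leb]_x `|fr (s, x) 0 i - fr (t, x) 0 i| <= ep / 2.
  by apply: k2; rewrite ltW//= (lt_le_trans sd)// lerD2l ge_min lexx orbT.
have dI (g g' : R -> R) : Int1 g -> Int1 g' -> Int1 (fun x => `|g x - g' x|).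
  by move=> gi gi'; apply: Int1_abs; exact: Int1B.
have ws := wI s (ltW s0) i; have wt := wI t t0 i; have fs := fI s (ltW s0) i; have ft := fI t t0 i.
have B1 := dI _ _ ws wt; have B2 := dI _ _ fs ft; have B3 := dI _ _ ws fs.
apply: (@le_trans _ _ (\int[leb]_x (`|w (s, x) 0 i - w (t, x) 0 i| + `|w (s, x) 0 i - fr (s, x) 0 i| + `|fr (s, x) 0 i - fr (t, x) 0 i|))).
  apply: int_le; [exact: dI|by apply: Int1D => //; exact: Int1D|].
  apply: aeW => x; rewrite [X in X + _ + _]distrC -/fr.
  apply: le_trans (ler_distD (fr (s, x) 0 i) _ _) _; rewrite lerD2r.
  exact: ler_distD.
rewrite RintegralD; [|exact: measurableT|exact: Int1D|exact: B2].
rewrite RintegralD; [|exact: measurableT|exact: B1|exact: B3].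
apply: le_trans (lerD (lerD k1 (Hs s0)) k2) _.
by rewrite addrAC -splitr addrC lerD2r; exact: tail_le (ltW ts).
Qed.

Lemma limit : exists ub vb : R -> 'rV[R]_n, L11 ub vb /\
  let uL := linear_wave ub vb in
  exists uLt uLx : R * R -> 'rV[R]_n, derivatives uL uLt uLx /\
    (normLp +oo%E (fun x => (u (t, x) - uL (t, x))%R) +
     normLp 1%E (fun x => (ut (t, x) - uLt (t, x))%R) +
     normLp 1%E (fun x => (ux (t, x) - uLx (t, x))%R))%E @[t --> +oo] --> 0%E.
Proof.
exists ub, vb; split; first by apply: free_L11; exact: final_Int1.
exists (free_d (final 1) (final (- 1)) 1), (free_d (final 1) (final (- 1)) (- 1)).
split; first by apply: free_derivatives; exact: final_Int1.
have [_ [_ _ _ [ct cx]] _ _] := hu.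
have bt i t (t0 : 0 <= t) : \int[leb]_x `|ut (t, x) 0 i - free_d (final 1) (final (- 1)) 1 (t, x) 0 i| <= tail i t.
  apply: L1_bound ct t t0; first by left.
  by move=> z; rewrite !mxE; field.
have bx i t (t0 : 0 <= t) : \int[leb]_x `|ux (t, x) 0 i - free_d (final 1) (final (- 1)) (- 1) (t, x) 0 i| <= tail i t.
  apply: L1_bound cx t t0; first by right.
  by move=> z; rewrite !mxE; field.
have vt (w : R * R -> 'rV[R]_n) c t : continuous_in_L1 w -> 0 <= t ->
    vintegrable leb setT (fun x => w (t, x) - free_d (final 1) (final (- 1)) c (t, x)).
  move=> [wI _] t0 i; have := Int1B (wI t t0 i) (free_d_Int1 (final_Int1 1) (final_Int1 (- 1)) c t i).
  by congr (_.-integrable _ _); apply/funext => x; rewrite !mxE.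
have total t : 0 <= t -> (normLp +oo%E (fun x => (u (t, x) - linear_wave ub vb (t, x))%R) +
     normLp 1%E (fun x => (ut (t, x) - free_d (final 1) (final (- 1)) 1 (t, x))%R) +
     normLp 1%E (fun x => (ux (t, x) - free_d (final 1) (final (- 1)) (- 1) (t, x))%R) <=
     (\sum_(i < n) (3 * tail i t))%:E)%E.
  move=> t0; apply: (@le_trans _ _ ((\sum_(i < n) tail i t)%:E + (\sum_(i < n) tail i t)%:E + (\sum_(i < n) tail i t)%:E)%E).
    apply: leeD; first apply: leeD.
    - apply: normLpy_le => x; apply: le_trans (enorm_le_sum _) _; apply: ler_sum => i _.
      rewrite !mxE -[X in _ <= X]mul1r; apply: le_trans (ler_wpM2r (tail_ge0 i t) (_ : 2^-1 <= 1)); last by lra.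
      have := sup_bound i x t0; congr (`|_ - _| <= _).
      by rewrite /linear_wave !mxE.
    - apply: le_trans (normLp1_le (vt ut 1 t ct t0)) _; rewrite lee_fin; apply: ler_sum => i _.
      by apply: le_trans (bt i t t0); rewrite le_eqVlt; apply/orP; left; apply/eqP/eq_Rintegral => x _; rewrite !mxE.
    - apply: le_trans (normLp1_le (vt ux (- 1) t cx t0)) _; rewrite lee_fin; apply: ler_sum => i _.
      by apply: le_trans (bx i t t0); rewrite le_eqVlt; apply/orP; left; apply/eqP/eq_Rintegral => x _; rewrite !mxE.
  by rewrite -!EFinD lee_fin -mulr_sumr; set S := \sum_(i < n) _; lra.
apply: cvg_ereal0; first by move=> t; rewrite !adde_ge0// Lnorm_ge0.
move=> ep e0; pose e' := ep / (3 * n.+1%:R).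
have e'0 : 0 < e' by rewrite divr_gt0// mulr_gt0.
pose N i := sval (cid (tail_small i e'0)).
near=> t.
have tN : (\sum_(i < n) N i)%N%:R <= t by near: t; exact: nbhs_pinfty_ge.
have t0 : 0 <= t by apply: le_trans tN; exact: ler0n.
apply: le_trans (total t t0) _; rewrite lee_fin.
apply: (@le_trans _ _ (\sum_(i < n) 3 * e')).
  apply: ler_sum => i _; rewrite ler_wpM2l//.
  have hi : tail i (N i)%:R <= e' by rewrite /N; case: cid.
  apply: le_trans hi; apply: tail_le; apply: le_trans tN; rewrite ler_nat (bigD1 i)//=.
  exact: leq_addr.
have -> : \sum_(i < n) 3 * e' = ep * (n%:R / n.+1%:R).
  rewrite sumr_const card_ord -[LHS]mulr_natl /e'; field.
  by rewrite nat1r pnatr_eq0.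
by rewrite ger_pMr// ler_pdivrMr// mul1r ler_nat.
Unshelve. all: by end_near. Qed.

End solution3.

Theorem theorem7p1 (R : realType) (n d : nat) (M : set 'rV[R]_n)
    (A : 'rV[R]_n -> 'rV[R]_n -> 'rV[R]_n -> 'rV[R]_n)
    (Gam : 'I_n -> 'I_n -> 'rV[R]_n -> 'rV[R]_n)
    (P : 'rV[R]_n -> 'M[R]_n)
    (hMcompact : compact M) (hM : embedded_submanifold d M)
    (hA : second_fundamental_form M A)
    (hGam : forall j k : 'I_n, bounded_lipschitz (Gam j k))
    (hGamA : forall p a b : 'rV[R]_n, M p -> tangent M p a -> tangent M p b ->
       \sum_(j < n) \sum_(k < n) (a 0 j * b 0 k) *: Gam j k p = A p a b)
    (hP : bounded_lipschitz P)
    (hPproj : forall p : 'rV[R]_n, M p -> orthogonal_projection M p (P p))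
    (u0 v0 : R -> 'rV[R]_n) (hdata : L11_in M u0 v0)
    (hcompat : {ae leb, forall x : R, tangent M (u0 x) (v0 x)})
    (f : R * R -> 'rV[R]_n) (hf : vintegrable leb2 halfplane f)
    (u ut ux : R * R -> 'rV[R]_n)
    (hu : mild_solution M Gam P u0 v0 f u ut ux) :
  exists ub vb : R -> 'rV[R]_n, L11 ub vb /\
  let uL := linear_wave ub vb in
  exists uLt uLx : R * R -> 'rV[R]_n, derivatives uL uLt uLx /\
    (normLp +oo%E (fun x => (u (t, x) - uL (t, x))%R) +
     normLp 1%E (fun x => (ut (t, x) - uLt (t, x))%R) +
     normLp 1%E (fun x => (ux (t, x) - uLx (t, x))%R))%E @[t --> +oo] --> 0%E.
Proof.
have [u0c u0M W v0i] := hdata.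
have [D Di hu0] := W11dot_comp W.
exact: (limit hM hA hGam hGamA hP hPproj hf hu v0i Di hu0).
Qed.
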